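(* There exists a function $g:\mathbb N\to\mathbb N$ such that for every $n \in \mathbb N$ and for every set $U$ of vertices of a strongly connected directed graph $D$ with $|U| \geq g(n)$, there is a butterfly minor of $D$ that is either shaped by a star or shaped by a comb, and has $n$ teeth in $U$.
   Context: All graphs are finite. A directed graph $D$ is strongly connected if for all $u,v\in V(D)$ there is a directed $u$--$v$ path in $D$. Butterfly minors: an edge $e=(u,v)$ of a directed graph is butterfly contractible if $e$ is the only outgoing edge of $u$ or the only incoming edge of $v$. A directed graph $H$ is a butterfly minor of $D$ if $H$ can be obtained from a subgraph of $D$ by repeatedly contracting butterfly contractible edges. Vertices of a butterfly minor are tracked as follows: in each contraction step, the vertex $x_e$ obtained by contracting $e=(u,v)$ is identified with $u$ if $e$ is the only incoming edge of $v$, and with $v$ if $e$ is the only outgoing edge of $u$ (possibly with both). A vertex of the butterfly minor is said to be in $U$ (an element of $U$) if it is, or has been identified (through the sequence of contractions) with, a vertex of $U$. For an undirected graph $G$, $\mathcal{D}(G)$ is the directed graph obtained by replacing each edge $uv$ by the two directed edges $(u,v),(v,u)$. Shaped by a star: a directed graph $D$ is shaped by a star if either $D$ is a directed cycle, or there is a subdivided star $S$ such that either (i) $D=\mathcal{D}(S)$, or (ii) $D$ is obtained from $\mathcal{D}(S)$ by replacing the unique vertex $w$ with $d_S(w)>2$ by a directed cycle of length $d_S(w)$ such that the strong components of $\mathcal{D}(S)-w$ become incident with distinct vertices of this directed cycle. The teeth of such $D$ are the vertices corresponding to the leaves of $S$; if $D$ is a directed cycle, all its vertices are teeth. Shaped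 by a comb: a comb is the union of an (undirected) path $P$ with disjoint (possibly trivial) paths each having precisely its first vertex on $P$; the last vertices of these paths are the teeth of the comb. A junction of a comb $C$ is a vertex of degree $3$, or a tooth of degree $2$. A directed graph $D$ is shaped by a comb if there is a comb $C$ such that either (a) $D=\mathcal{D}(C)$, or (b) $D$ is obtained from $\mathcal{D}(C)$ by replacing each junction $j$ of $C$ by a directed cycle of length $3$ such that, if $d_C(j)=3$, the three strong components of $\mathcal{D}(C)-j$ become incident with distinct vertices of this directed cycle, and otherwise the tooth $j$ is a vertex of this directed cycle and the two strong components of $\mathcal{D}(C)-j$ become incident with distinct other vertices of this cycle. The teeth of such $D$ are the vertices corresponding to the teeth of $C$. *)

(* Defs.v *)
From mathcomp Require Import all_boot.

Set Implicit Arguments.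
Unset Strict Implicit.
Unset Printing Implicit Defensive.

(* Digraphs and graphs are finite and simple: no loops, no parallel edges.    *)
Record digraph := Digraph {
  dvertex :> finType;
  arc : rel dvertex;
  arc_irr : irreflexive arc }.

Record sgraph := SGraph {
  svertex :> finType;
  adj : rel svertex;
  adj_sym : symmetric adj;
  adj_irr : irreflexive adj }.

Definition strongly_connected (D : digraph) : Prop :=
  forall u v : D, connect (@arc D) u v.

Definition only_out (D : digraph) (u v : D) : bool :=
  arc u v && [forall y, arc u y ==> (y == v)].

Definition only_in (D : digraph) (u v : D) : bool :=
  arc u v && [forall x, arc x v ==> (x == u)].

Definition butterfly_contractible (D : digraph) (u v : D) : bool :=
  only_out u v || only_in u v.

Definition subgraph_embedding (H D : digraph) (i : H -> D) : Prop :=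
  injective i /\ forall x y : H, arc x y -> arc (i x) (i y).

(* [f] is the quotient map of the contraction of the edge (u, v) of H, up to  *)
(* isomorphism.  Loops are deleted and parallel edges are merged.             *)
Definition contraction (H H' : digraph) (u v : H) (f : H -> H') : Prop :=
  [/\ forall a : H', exists x : H, f x = a,
      forall x y : H, f x = f y <->
        x = y \/ (x \in [:: u; v]) && (y \in [:: u; v])
    & forall a b : H', arc a b <->
        a <> b /\ exists x y : H, [/\ f x = a, f y = b & arc x y] ].

(* When (u, v) is contracted, is the vertex x identified with its image?      *)
Definition retained (H : digraph) (u v x : H) : bool :=
  if x == u then only_in u v else if x == v then only_out u v else true.

(* [butterfly_minor D H t]: H is a butterfly minor of D, obtained by a        *)
(* sequence of contractions through which each vertex a of H is identified    *)
(* with exactly the vertices of D in [t a].                                   *)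
Inductive butterfly_minor (D : digraph) :
    forall H : digraph, (H -> {set D}) -> Prop :=
| BM_subgraph (H : digraph) (i : H -> D) :
    subgraph_embedding i ->
    butterfly_minor (fun x : H => [set i x])
| BM_contract (H H' : digraph) (t : H -> {set D}) (u v : H) (f : H -> H') :
    butterfly_minor t ->
    butterfly_contractible u v ->
    contraction u v f ->
    butterfly_minor
      (fun a : H' => \bigcup_(x | (f x == a) && retained u v x) t x).

Definition degree (G : sgraph) (x : G) : nat := #|[set y | adj x y]|.

Definition leaves (G : sgraph) : {set G} := [set x | degree x == 1].

Definition is_path (G : sgraph) (s : seq G) : bool :=
  [&& s != [::], sorted (@adj G) s & uniq s].

Definition consecutive (T : eqType) (s : seq T) (x y : T) : bool :=
  infix [:: x; y] s || infix [:: y; x] s.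

Definition union_of_paths (G : sgraph) (ss : seq (seq G)) : Prop :=
  [/\ all (@is_path G) ss,
      forall x : G, has (fun s => x \in s) ss
    & forall x y : G, adj x y = has (fun s => consecutive s x y) ss].

(* The edges of a star with centre w are replaced by the paths in Qs.         *)
Definition subdivided_star (S : sgraph) : Prop :=
  exists (w : S) (Qs : seq (seq S)),
    [/\ union_of_paths ([:: w] :: Qs),
        all (fun Q => (1 < size Q) && (head w Q == w)) Qs
      & pairwise (fun Q Q' => all (fun x => (x \in Q') ==> (x == w)) Q) Qs].

(* [comb C T]: C is a comb with set of teeth T.                               *)
Definition comb (C : sgraph) (T : {set C}) : Prop :=
  exists (P : seq C) (Qs : seq (seq C)),
    [/\ union_of_paths (P :: Qs),
        all (fun Q => all (fun x => (x \in P) == (x == head x Q)) Q) Qs,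
        pairwise (fun Q Q' => ~~ has (mem Q) Q') Qs
      & T = [set t | has (fun Q => (t \in Q) && (t == last t Q)) Qs] ].

Definition junctions (C : sgraph) (T : {set C}) : {set C} :=
  [set x | (degree x == 3) || (x \in T) && (degree x == 2)].

Definition bidirected (G : sgraph) : digraph := Digraph (@adj_irr G).

Definition iso (D D' : digraph) (f : D -> D') : Prop :=
  bijective f /\ forall x y : D, arc (f x) (f y) = arc x y.

Definition induces_cycle (D : digraph) (A : {set D}) (k : nat) : Prop :=
  exists c : seq D,
    [/\ uniq c, c =i A, size c = k
      & {in A &, forall x y, arc x y = (next c x == y)} ].

Definition directed_cycle (D : digraph) : Prop :=
  exists2 k, 1 < k & induces_cycle [set: D] k.

(* y and z lie in the same strong component of D - j                          *)
Definition same_strong_component_minus (D : digraph) (j y z : D) : bool :=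
  let e := [rel a b | [&& arc a b, a != j & b != j]] in
  [&& y != j, z != j, connect e y z & connect e z y].

Definition fiber (H G : finType) (p : H -> G) (x : G) : {set H} :=
  [set a | p a == x].

(* H is obtained from bidirected G by replacing every vertex j in J by a      *)
(* directed cycle of length [len j] so that distinct strong components of     *)
(* bidirected G - j become incident with distinct vertices of this cycle.     *)
(* The map [p] sends a vertex of H to the vertex of G it comes from, and for  *)
(* an edge xy of G, [att x y] is the end in [fiber p x] of the two edges of H *)
(* that correspond to (x, y) and (y, x).                                      *)
Record cycle_replacement (G : sgraph) (J : {set G}) (len : G -> nat)
    (H : digraph) (p : H -> G) (att : G -> G -> H) : Prop := CycleReplacement {
  cr_att : forall x y, adj x y -> p (att x y) = x;
  cr_vertex : forall x, x \notin J -> #|fiber p x| = 1;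
  cr_cycle : forall j, j \in J -> induces_cycle (fiber p j) (len j);
  cr_arc : forall a b : H, p a != p b ->
    arc a b = [&& adj (p a) (p b), a == att (p a) (p b) & b == att (p b) (p a)];
  cr_distinct : forall j y z, j \in J -> adj j y -> adj j z ->
    ~~ same_strong_component_minus (D := bidirected G) j y z ->
    att j y != att j z }.

(* [shaped_by_star D T]: D is shaped by a star, with set of teeth T.          *)
Definition shaped_by_star (D : digraph) (T : {set D}) : Prop :=
  (directed_cycle D /\ T = [set: D])
  \/ exists S : sgraph, subdivided_star S /\
      ((exists2 f : bidirected S -> D, iso f & T = f @: leaves S)
       \/ exists (w : S) (p : D -> S) (att : S -> S -> D),
           [/\ 2 < degree w,
               cycle_replacement [set w] (@degree S) p att
             & T = p @^-1: leaves S ]).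

(* [shaped_by_comb D T]: D is shaped by a comb, with set of teeth T.  The map *)
(* [tau] sends a tooth of the comb to the corresponding tooth of D; at a      *)
(* junction of degree 2 this is the cycle vertex at which nothing is attached. *)
Definition shaped_by_comb (D : digraph) (T : {set D}) : Prop :=
  exists (C : sgraph) (TC : {set C}), comb TC /\
    ((exists2 f : bidirected C -> D, iso f & T = f @: TC)
     \/ exists (p : D -> C) (att : C -> C -> D) (tau : C -> D),
         [/\ cycle_replacement (junctions TC) (fun=> 3) p att,
             forall t, t \in TC -> p (tau t) = t,
             forall t y, t \in TC -> degree t = 2 -> adj t y ->
               att t y != tau t
           & T = tau @: TC ]).

(* Main.v *)
From mathcomp Require Import all_boot.
From mathcomp Require Import zify.
Require Import Defs.

(* A butterfly minor is found as a model: each of its vertices becomes a      *)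
(* branch set, consisting of an in-tree and an out-tree that meet only in     *)
(* their common root, which is the vertex of D retained by the contractions.  *)
(*                                                                            *)
(* Let S be strongly connected and let P be a path in S from a to b, where b  *)
(* reaches a outside S.  If vertices of U lie in many strong components of    *)
(* S - P, then Mirsky's theorem, applied to reachability in S - P and then to *)
(* the intervals of P between first landings and last origins, gives either a *)
(* long closed route, hence a directed cycle or a star whose centre is a      *)
(* directed cycle, or many intervals with a common point, hence a bidirected  *)
(* star.  Otherwise some strong component K of S - P contains a large part of *)
(* U.  Rerouting P through K as long as K leaves P before it returns to it,   *)
(* we may assume that P lands at or before its last origin for K; then P is a *)
(* branch set with edges to and from K, and the argument is iterated in K.    *)
(*                                                                            *)
(* The result is a long chain of nested branch sets.  A vertex of U that is   *)
(* lost in passing from S to K becomes a tooth: a leg at a branch set of the  *)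
(* chain, or a leg on one of the two opposite connections of consecutive      *)
(* branch sets.  Depending on which of these three kinds is most frequent,    *)
(* the chain contains a bidirected comb, or a comb with triangles of one of   *)
(* the two orientations.                                                      *)

Set Implicit Arguments.
Unset Strict Implicit.
Unset Printing Implicit Defensive.

(** * Walks, links and strong components *)

(** Contractions are replaced by branch sets in $D$. A branch set ([bset]) consists of an in-tree
    and an out-tree that share exactly the root, and an arc of the minor is an arc from an out-tree
    to an in-tree. Leaves of an in-tree are contracted along their only outgoing arc and leaves of
    an out-tree along their only incoming arc. The root survives, so disjoint branch sets form a
    butterfly minor whose vertices keep the prescribed roots ([model_minor]). Teeth come from
    [strong_leg]: in a strong set with a prescribed entrance, exit and vertex $u$, some branch set
    uses this entrance and exit and is the start of a bidirected path of branch sets ending in one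
    rooted at $u$.

    Assume that there is no star. Let $S$ be strong and $P$ a path in $S$ whose end returns to its
    start outside $S$. By [wide], few vertices of $U$ lie in different strong components of $S-P$:
    many of them would form a long chain under reachability, or many disjoint intervals of $P$, both
    giving a cyclic route ([closed_route]), or many intervals with a common point, giving a star
    ([star_common]). So one component $K$ carries a large part of $U$ ([heavy_comp]). By [back], the
    path can be rerouted until $K$ lands on it at or before the last vertex from which it is
    entered. Then $P$ is a branch set with arcs to and from $K$, and $K$ inherits the hypotheses on
    $S$.

    Iterating this yields nested branch sets, a [chain]. A vertex of $U$ lost on the way from $S$ to
    $K$ becomes a tooth ([tooth]): on a leg at a branch set, or on an ear along the inward or the
    outward connection of two consecutive ones. Building an ear may require the next outer branch
    set ([opened]) or the outermost branch set inside $K$ ([cored]), which is why each tooth costs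
    three layers in [depth_bound]. Among $3n$ teeth, $n$ are of one kind. The others are absorbed
    into branch sets ([chain_beads]), and the chain becomes a bidirected comb ([comb_model]) or a
    comb with triangles of one orientation ([triangle_model]). The setting is symmetric under
    reversal of all arcs, which halves the case analysis. *)

Ltac keep_arith := repeat match goal with H : ?P |- _ =>
  lazymatch P with
  | is_true (leq _ _) => fail
  | is_true (andb (leq _ _) (leq _ _)) => fail
  | @eq nat _ _ => fail
  | _ => clear H
  end end.
Ltac slia := keep_arith; lia.

Section Conn.
Variables (V : finType) (e : rel V).
Implicit Types (X Y A B : {set V}) (x y z : V) (p q s : seq V).

Definition relin X : rel V := [rel x y | [&& x \in X, y \in X & e x y]].
(** Membership of [x] is required because [connect] is reflexive outside [X] as well; the other end
    then lies in [X] by [conn_inr]. *)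
Definition conn X x y := (x \in X) && connect (relin X) x y.

Lemma conn_inl X x y : conn X x y -> x \in X.
Proof. by case/andP. Qed.

Lemma conn_ind X (Q : V -> Prop) x y :
  conn X x y -> Q x ->
  (forall z w, z \in X -> w \in X -> e z w -> Q z -> Q w) -> Q y.
Proof.
case/andP=> _ /connectP[s + ->] + st; elim: s x => //= z s IH x /andP[+ /IH{}IH] Qx.
by case/and3P=> xX zX xz; apply: IH; apply: (st x).
Qed.

Lemma conn_inr X x y : conn X x y -> y \in X.
Proof. move=> c; by apply: (@conn_ind X (fun z => z \in X) x y c) => //; apply: conn_inl c. Qed.

Lemma conn_refl X x : x \in X -> conn X x x.
Proof. by move=> xX; rewrite /conn xX /=. Qed.

Lemma conn_trans X y x z : conn X x y -> conn X y z -> conn X x z.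
Proof.
by case/andP=> xX c1 /andP[_ c2]; rewrite /conn xX (connect_trans c1 c2).
Qed.

Lemma conn1 X x y : x \in X -> y \in X -> e x y -> conn X x y.
Proof. by move=> xX yX xy; rewrite /conn xX /=; apply: connect1; rewrite /relin /= xX yX. Qed.

Lemma conn_mono X Y x y : X \subset Y -> conn X x y -> conn Y x y.
Proof.
move=> sub c; have xX := conn_inl c.
apply: (@conn_ind X (fun z => conn Y x z) x y c) => [|z w zX wX zw].
  by apply: conn_refl; apply: (subsetP sub).
move=> c'; apply: conn_trans c' _.
by apply: conn1 => //; apply: (subsetP sub).
Qed.

Lemma path_conn x p X : path e x p -> x \in X -> {subset p <= X} ->
  forall y, y \in x :: p -> conn X x y /\ conn X y (last x p).
Proof.
elim: p x => [|z p IH] x /= => [_ xX _ y|/andP[xz zp] xX sub y].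
  by rewrite inE => /eqP->; split; apply: conn_refl.
have zX : z \in X by apply: sub; rewrite inE eqxx.
have c1 := conn1 xX zX xz.
have sub' : {subset p <= X} by move=> w wp; apply: sub; rewrite inE wp orbT.
have [cz cl] := IH z zp zX sub' z (mem_head _ _).
rewrite inE => /orP[/eqP->|yp].
  by split; [apply: conn_refl|apply: conn_trans c1 cl].
have [{}cz {}cl] := IH z zp zX sub' y yp.
by split=> //; apply: conn_trans c1 cz.
Qed.

Lemma connP X x y : conn X x y ->
  exists p, [/\ path e x p, last x p = y, uniq (x :: p) & {subset x :: p <= X}].
Proof.
case/andP=> xX /connectP[p0 + ->] => /shortenP[p pp up _].
exists p; split=> //.
- by elim: p x {xX up} pp => //= z p IH x /andP[/and3P[_ _ ->]] /IH.
- elim: p x xX pp {up} => /= [|z p IH] x xX; first by move=> _ w; rewrite inE => /eqP->.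
  case/andP=> /and3P[_ zX _] pp w; rewrite inE => /orP[/eqP-> //|].
  exact: IH.
Qed.

Definition strong X := forall x y, x \in X -> y \in X -> conn X x y.

Definition comp X x := [set y | conn X x y && conn X y x].

Lemma comp_sub X x : comp X x \subset X.
Proof. by apply/subsetP=> y; rewrite inE => /andP[/conn_inr]. Qed.

Lemma comp_self X x : x \in X -> x \in comp X x.
Proof. by move=> xX; rewrite inE !conn_refl. Qed.

Lemma comp_fullP X x y z : y \in comp X x -> conn X y z -> conn X z y -> z \in comp X x.
Proof.
rewrite !inE => /andP[xy yx] yz zy.
by rewrite (conn_trans xy yz) (conn_trans zy yx).
Qed.

Lemma comp_conn X x y z : y \in comp X x -> z \in comp X x -> conn X y z.
Proof.
by rewrite !inE => /andP[_ yx] /andP[xz _]; apply: conn_trans yx xz.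
Qed.

(** A path in [X] between two vertices of the component stays in it, since each of its vertices is
    reached from one of them and reaches the other. *)
Lemma comp_strong X x : strong (comp X x).
Proof.
suff H y : y \in comp X x -> conn (comp X x) x y /\ conn (comp X x) y x.
  by move=> y z /H[_ yx] /H[xz _]; apply: conn_trans yx xz.
move=> yC; have xX : x \in X by move: yC; rewrite inE => /andP[/conn_inl].
have xC := comp_self xX.
have aux z w : z \in comp X x -> w \in comp X x -> conn (comp X x) z w.
  move=> zC wC; have := comp_conn zC wC; have := comp_conn wC zC.
  move=> wz zw; have [p [pp lp up sp]] := connP zw.
  have wp : w \in z :: p by rewrite -lp mem_last.
  have sub : {subset p <= comp X x}.
    move=> v vp; have zX : z \in X by apply: sp; rewrite mem_head.
    have sp' : {subset p <= X} by move=> t tp; apply: sp; rewrite inE tp orbT.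
    have [|c1 c2] := path_conn pp zX sp' (y := v); first by rewrite inE vp orbT.
    by apply: (comp_fullP zC) => //; apply: conn_trans c2 _; rewrite lp.
  by have [] := path_conn pp zC sub wp.
by split; apply: aux.
Qed.

Definition link x q y := path e x (rcons q y).

(** A shortest walk in [X] from [A] to [B] meets these sets only at its ends, since any other vertex
    of either set would shorten it. Disjointness excludes the empty walk. *)
Lemma link_exists X A B x y : x \in A -> y \in B -> conn X x y ->
  [disjoint A & B] ->
  exists x' q y', [/\ x' \in A :&: X, y' \in B :&: X, link x' q y' &
    {in q, forall z, [/\ z \in X, z \notin A & z \notin B]}].
Proof.
move=> xA yB /connP[s0 [ps0 ls0 us0 ss0]] dAB.
pose Q n := [exists x : V, [exists t : n.-tuple V,
  [&& x \in A, path e x t, last x t \in B & all (mem X) (x :: t)]]].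
have exQ : exists n, Q n.
  exists (size s0); apply/existsP; exists x; apply/existsP; exists (in_tuple s0).
  by rewrite xA ps0 ls0 yB; apply/allP => z; apply: ss0.
clear xA yB ps0 ls0 us0 ss0.
case: (ex_minnP exQ) => n /existsP[x1 /existsP[t /and4P[xA pt ltB /allP at_]]] minn.
have {minn} mins x' t' : x' \in A -> path e x' t' -> last x' t' \in B ->
    all (mem X) (x' :: t') -> n <= size t'.
  move=> ? p' l' a'; apply: minn; apply/existsP; exists x'; apply/existsP.
  by exists (in_tuple t'); apply/and4P; split.
case/lastP: (tval t) (size_tuple t) pt ltB at_ => [|q k] sz pt ltB at_.
  by move: (disjointFr dAB xA) => /=; rewrite ltB.
rewrite last_rcons in ltB.
exists x1, q, k; split=> //.
- by rewrite inE xA; apply: at_; rewrite mem_head.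
- by rewrite inE ltB; apply: at_; rewrite inE mem_rcons mem_head orbT.
move=> z zq; split.
- by apply: at_; rewrite inE mem_rcons inE zq !orbT.
- apply/negP=> zA; move: pt sz at_.
  case/splitPr: zq => q1 q2; rewrite rcons_cat cat_path /= => /and3P[_ _ p2] sz at_.
  have al : all (mem X) (z :: rcons q2 k).
    by apply/allP=> w wq; apply: at_; rewrite inE mem_cat wq !orbT.
  have := mins z (rcons q2 k) zA p2; rewrite last_rcons => /(_ ltB al).
  by rewrite -sz size_cat /= !size_rcons; lia.
- apply/negP=> zB; move: pt sz at_.
  case/splitPr: zq => q1 q2; rewrite rcons_cat cat_path /= => /and3P[p1 p2 _] sz at_.
  have al : all (mem X) (x1 :: rcons q1 z).
    apply/allP=> w wq; apply: at_.
    move: wq; rewrite !inE mem_rcons inE mem_cat inE.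
    by case/or3P=> [->//|->|->]; rewrite ?orbT.
  have := mins x1 (rcons q1 z) xA.
  rewrite rcons_path p1 p2 last_rcons => /(_ isT zB al).
  by rewrite -sz size_cat /= !size_rcons; lia.
Qed.

Lemma disjI A B : (forall z, z \in A -> z \in B -> False) -> [disjoint A & B].
Proof.
move=> H; rewrite disjoints_subset; apply/subsetP=> z zA.
by rewrite in_setC; apply/negP; apply: H zA.
Qed.

Lemma disjE A B z : [disjoint A & B] -> z \in A -> z \in B -> False.
Proof. by move=> d zA zB; have /= := disjointFr d zA; rewrite zB. Qed.

End Conn.

(** * Branch sets and legs *)

Definition revr (V : Type) (e : rel V) : rel V := fun x y => e y x.

Lemma conn_rev (V : finType) (e : rel V) (X : {set V}) x y :
  conn (revr e) X x y = conn e X y x.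
Proof.
have H (f : rel V) z w : conn f X z w -> conn (revr f) X w z.
  move=> c; have zX := conn_inl c.
  apply: (@conn_ind _ f X (fun t => conn (revr f) X t z) z w c) => [|t v tX vX tv ct].
    exact: conn_refl.
  by apply: conn_trans ct; apply: conn1.
by apply/idP/idP; apply: H.
Qed.

Section Paths.
Variables (V : finType) (e : rel V).
Implicit Types (X Y A B I O J : {set V}) (x y z : V) (q s : seq V).
Local Notation conn := (conn e).

Lemma nth_path_conn X a s i j : path e a s -> i <= j <= size s ->
  (forall k, i <= k <= j -> nth a (a :: s) k \in X) ->
  conn X (nth a (a :: s) i) (nth a (a :: s) j).
Proof.
move=> /(pathP a) pth; elim: j => [|j IH] /andP[ij js] sub.
  have -> : i = 0 by lia.
  by apply: conn_refl; apply: sub; lia.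
have [eij|nij] := eqVneq i j.+1.
  by rewrite -eij; apply: conn_refl; apply: sub; lia.
apply: conn_trans (IH _ _) _; first by lia.
  by move=> k ?; apply: sub; lia.
by apply: conn1; [apply: sub; lia|apply: sub; lia|apply: pth].
Qed.

Lemma index_path_conn X a s x y : path e a s -> x \in a :: s -> y \in a :: s ->
  index x (a :: s) <= index y (a :: s) ->
  (forall z, z \in a :: s -> index x (a :: s) <= index z (a :: s) <= index y (a :: s) ->
     z \in X) -> uniq (a :: s) ->
  conn X x y.
Proof.
move=> pth xP yP xy sub un.
rewrite -[x](nth_index a xP) -[y](nth_index a yP).
have sy : index y (a :: s) <= size s by rewrite -ltnS index_mem.
apply: nth_path_conn => // [|k ?]; first by rewrite xy.
have ks : k < size (a :: s) by rewrite /= ltnS; lia.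
by apply: sub; rewrite ?mem_nth ?index_uniq.
Qed.

Definition arcs A B := exists x y, [/\ x \in A, y \in B & e x y].

Lemma arcs_sub A A' B B' : A \subset A' -> B \subset B' -> arcs A B -> arcs A' B'.
Proof.
move=> /subsetP sA /subsetP sB [x [y [xA yB xy]]].
by exists x, y; split; [apply: sA|apply: sB|].
Qed.

Lemma link_conn X x q y : link e x q y -> {subset q <= X} ->
  {in q, forall z, (x \in X -> conn X x z) /\ (y \in X -> conn X z y)}.
Proof.
rewrite /link => pth sub z zq; split.
  move=> xX; move: pth; rewrite rcons_path => /andP[pth _].
  by have [|//] := path_conn pth xX sub (y := z); rewrite inE zq orbT.
move=> yX; move: pth sub zq; case: q => //= z0 q /andP[_ pth] sub zq.
have zX : z0 \in X by apply: sub; rewrite mem_head.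
have [||_] := path_conn pth zX _ (y := z).
- move=> w; rewrite mem_rcons inE => /orP[/eqP->//|wq].
  by apply: sub; rewrite inE wq orbT.
- by move: zq; rewrite !inE mem_rcons inE => /orP[->|->] //; rewrite !orbT.
by rewrite last_rcons.
Qed.

Lemma link_first x q y : link e x q y -> exists2 z, z \in rcons q y & e x z.
Proof. by rewrite /link; case: q => [|z q] /= /andP[xz _]; [exists y|exists z]; rewrite ?mem_head. Qed.

Lemma link_last x q y : link e x q y -> exists2 z, z \in x :: q & e z y.
Proof. by rewrite /link rcons_path => /andP[_ xy]; exists (last x q); rewrite ?mem_last. Qed.

(* A branch set: an in-tree I and an out-tree O with common root r. *)
Definition bset I O r :=
  [/\ I :&: O = [set r], {in I, forall x, conn I x r} & {in O, forall x, conn O r x}].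

Lemma bset_root I O r : bset I O r -> r \in I /\ r \in O.
Proof. by case=> IO _ _; apply/setIP; rewrite IO set11. Qed.

Lemma bset_conn I O r x y : bset I O r -> x \in I -> y \in O -> conn (I :|: O) x y.
Proof.
case=> _ cI cO xI yO; apply: (@conn_trans _ _ _ r).
  by apply: conn_mono (cI _ xI); apply: subsetUl.
by apply: conn_mono (cO _ yO); apply: subsetUr.
Qed.

Lemma bset_extI I O r J : bset I O r -> [disjoint J & I :|: O] ->
  {in J, forall x, exists2 y, y \in I & conn (J :|: I) x y} -> bset (J :|: I) O r.
Proof.
move=> b dJ cJ; have [rI rO] := bset_root b; case: b => IO cI cO; split=> //.
  rewrite setIUl IO; apply/setUidPr; apply/subsetP=> x; case/setIP=> xJ xO.
  by have /= := disjointFr dJ xJ; rewrite in_setU xO orbT.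
have sI : I \subset J :|: I by apply: subsetUr.
have cI' x : x \in I -> conn (J :|: I) x r by move=> xI; apply: conn_mono (cI _ xI).
move=> x /setUP[/cJ[y yI xy]|/cI'//].
by apply: conn_trans xy (cI' _ yI).
Qed.

(* [leg A I O u l]: inside A, a bidirected path of l.+1 branch sets of which  *)
(* (I, O) is the first and the last has root u.                               *)
Inductive leg : {set V} -> {set V} -> {set V} -> V -> nat -> Prop :=
| leg0 A I O u : bset I O u -> I :|: O \subset A -> leg A I O u 0
| legS A I O r A' I' O' u l : bset I O r -> I :|: O \subset A -> leg A' I' O' u l ->
    A' \subset A -> [disjoint I :|: O & A'] -> arcs O I' -> arcs O' I ->
    leg A I O u l.+1.

Lemma leg_bset A I O u l : leg A I O u l -> (exists r, bset I O r) /\ I :|: O \subset A.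
Proof.
case=> {A I O u l} [A I O u b s|A I O r A' I' O' u l b s lg s' d a1 a2].
  by split=> //; exists u.
by split=> //; exists r.
Qed.

Lemma leg_sub A B I O u l : A \subset B -> leg A I O u l -> leg B I O u l.
Proof.
move=> sAB lg; case: lg sAB => {A I O u l} [A I O u b s|A I O r A' I' O' u l b s lg s' d a1 a2] sAB.
  by apply: leg0 b _; apply: subset_trans sAB.
by apply: legS b _ lg _ d a1 a2; apply: subset_trans sAB.
Qed.

Lemma leg_conn A I O u l x y : leg A I O u l -> x \in I -> y \in O -> conn A x y.
Proof.
move=> /leg_bset[[r b] s] xI yO; apply: conn_mono s _.
exact: bset_conn b xI yO.
Qed.

Lemma leg_extI A I O u l J : leg A I O u l -> [disjoint J & A] ->
  {in J, forall x, exists2 y, y \in I & conn (J :|: I) x y} ->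
  leg (J :|: A) (J :|: I) O u l.
Proof.
case=> {A I O u l} [A I O u b s|A I O r A' I' O' u l b s lg s' d a1 a2] dJ cJ.
  apply: leg0; last by rewrite -setUA setUS.
  by apply: bset_extI b _ cJ; apply: disjointWr dJ.
apply: (@legS _ _ _ r) lg _ _ _ _ => //.
- by apply: bset_extI b _ cJ; apply: disjointWr dJ.
- by rewrite -setUA setUS.
- exact: subset_trans s' (subsetUr _ _).
- rewrite -setUA -setI_eq0 setIUl; move: d dJ; rewrite -!setI_eq0 => /eqP-> /eqP dJ.
  by rewrite setU0 -subset0 -dJ setIS.
- by apply: arcs_sub a2 => //; apply: subsetUr.
Qed.

End Paths.

(** * Reversal of all arcs *)

Section Reversal.
Variables (V : finType).
Implicit Types (e : rel V) (A B I O J : {set V}).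

Lemma arcs_rev e A B : arcs (revr e) A B <-> arcs e B A.
Proof. by split=> -[x [y [? ? ?]]]; exists y, x. Qed.

Lemma bset_rev e I O r : bset (revr e) I O r <-> bset e O I r.
Proof.
split=> -[IO cI cO]; rewrite setIC in IO; split=> // x xX.
- by rewrite -(conn_rev e) cO.
- by rewrite -(conn_rev e) cI.
- by rewrite (conn_rev e) cO.
- by rewrite (conn_rev e) cI.
Qed.

Lemma leg_rev e A I O u l : leg e A I O u l -> leg (revr e) A O I u l.
Proof.
elim=> {A I O u l} [A I O u b s|A I O r A' I' O' u l b s _ IH s' d a1 a2].
  by apply: leg0; [apply/bset_rev|rewrite setUC].
have b' : bset (revr e) O I r by apply/bset_rev.
by apply: (legS b' _ IH s'); [rewrite setUC|rewrite setUC|apply/arcs_rev|apply/arcs_rev].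
Qed.

Lemma leg_extO e A I O u l J : leg e A I O u l -> [disjoint J & A] ->
  {in J, forall x, exists2 y, y \in O & conn e (J :|: O) y x} ->
  leg e (J :|: A) I (J :|: O) u l.
Proof.
move=> /leg_rev lg d cJ; apply: (@leg_rev (revr e)); apply: leg_extI lg d _.
by move=> x /cJ[y yO yx]; exists y => //; rewrite (conn_rev e).
Qed.

Lemma strong_rev e X : strong e X -> strong (revr e) X.
Proof. by move=> st x y xX yX; rewrite (conn_rev e) st. Qed.

Lemma comp_rev e X x : comp (revr e) X x = comp e X x.
Proof. by apply/setP=> y; rewrite !inE 2!(conn_rev e) andbC. Qed.

End Reversal.

Section StrongLeg.
Variables (V : finType) (e : rel V).
Implicit Types (X Y A B I O J K : {set V}) (a b x y z : V) (q s : seq V).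
Local Notation conn := (conn e).
Local Notation leg := (leg e).
Local Notation link := (link e).

Definition seg a s i j := [set z in a :: s | i <= index z (a :: s) <= j].

Lemma in_seg a s i j z :
  (z \in seg a s i j) = (z \in a :: s) && (i <= index z (a :: s) <= j).
Proof. by rewrite inE. Qed.

Lemma seg_conn a s i j x y : path e a s -> uniq (a :: s) -> x \in seg a s i j ->
  y \in seg a s i j -> index x (a :: s) <= index y (a :: s) -> conn (seg a s i j) x y.
Proof.
rewrite !in_seg => pth un /andP[xP xij] /andP[yP yij] xy.
apply: (index_path_conn pth xP yP xy) => // z zP zxy.
by rewrite in_seg zP; lia.
Qed.

Lemma nth_in_seg a s i j k : uniq (a :: s) -> i <= k <= j -> k <= size s ->
  nth a (a :: s) k \in seg a s i j.
Proof.
move=> un kij ks; have ks' : k < size (a :: s) by rewrite /= ltnS.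
by rewrite in_seg mem_nth // index_uniq.
Qed.

Lemma seg_bset a s i j k : path e a s -> uniq (a :: s) -> i <= k <= j -> k <= size s ->
  bset e (seg a s i k) (seg a s k j) (nth a (a :: s) k).
Proof.
move=> pth un kij ks; have ks' : k < size (a :: s) by rewrite /= ltnS.
split=> [|x|x].
- apply/setP=> z; rewrite in_setI !in_seg in_set1.
  apply/idP/eqP=> [/andP[/andP[zP z1] /andP[_ z2]]|->].
    by have -> : k = index z (a :: s) by [lia]; rewrite nth_index.
  by rewrite mem_nth // index_uniq //; lia.
- rewrite in_seg => /andP[xP xij]; apply: seg_conn => //.
  + by rewrite in_seg xP.
  + by apply: nth_in_seg => //; lia.
  + by rewrite index_uniq //; lia.
rewrite in_seg => /andP[xP xij]; apply: seg_conn => //.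
+ by apply: nth_in_seg => //; lia.
+ by rewrite in_seg xP.
by rewrite index_uniq //; lia.
Qed.

Lemma leg_linkI A I O u l x q y : leg A I O u l -> link x q y -> y \in I ->
  {in q, forall z, z \notin A} -> leg ([set z in q] :|: A) ([set z in q] :|: I) O u l.
Proof.
move=> lg lk yI qA; apply: leg_extI lg _ _.
  by rewrite disjoints_subset; apply/subsetP=> z; rewrite !inE => /qA.
move=> z; rewrite inE => zq; exists y => //.
have sub : {subset q <= [set z in q] :|: I} by move=> w wq; rewrite !inE wq.
by have [_] := link_conn lk sub zq; apply; rewrite in_setU yI orbT.
Qed.

Lemma leg_linkO A I O u l x q y : leg A I O u l -> link x q y -> x \in O ->
  {in q, forall z, z \notin A} -> leg ([set z in q] :|: A) I ([set z in q] :|: O) u l.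
Proof.
move=> lg lk yI qA; apply: leg_extO lg _ _.
  by rewrite disjoints_subset; apply/subsetP=> z; rewrite !inE => /qA.
move=> z; rewrite inE => zq; exists x => //.
have sub : {subset q <= [set z in q] :|: O} by move=> w wq; rewrite !inE wq.
by have [+ _] := link_conn lk sub zq; apply; rewrite in_setU yI orbT.
Qed.

Lemma link_arcsI x q y O I : link x q y -> x \in O -> y \in I ->
  arcs e O ([set z in q] :|: I).
Proof.
move=> /link_first[z zq xz] xO yI; exists x, z; split=> //.
by move: zq; rewrite mem_rcons !inE => /orP[/eqP->|->//]; rewrite yI orbT.
Qed.

Lemma link_arcsO x q y O I : link x q y -> x \in O -> y \in I ->
  arcs e ([set z in q] :|: O) I.
Proof.
move=> /link_last[z zq xz] xO yI; exists z, y; split=> //.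
by move: zq; rewrite !inE => /orP[/eqP->|->//]; rewrite xO orbT.
Qed.

(** A common interior vertex would reach the component along the first link and be reached from it
    along the second, hence lie in it. *)
Lemma links_disjoint X x x' q q' y y' u : link x q y -> link x' q' y' ->
  y \in comp e X u -> x' \in comp e X u ->
  {in q, forall z, z \in X /\ z \notin comp e X u} -> {subset q' <= X} ->
  {in q, forall z, z \notin q'}.
Proof.
move=> lk lk' yC xC qX q'X z zq; apply/negP=> zq'.
have [zX /negP[]] := qX z zq.
have sC := subsetP (comp_sub e X u).
have q_X : {subset q <= X} by move=> w /qX[].
have [_ /(_ (sC _ yC)) zy] := link_conn lk q_X zq.
have [/(_ (sC _ xC)) xz _] := link_conn lk' q'X zq'.
apply: (comp_fullP xC) => //.
exact: conn_trans zy (comp_conn yC xC).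
Qed.

(** Induction on the size of [K]. A path from [a] to [b] through [u] is a branch set rooted at [u].
    Otherwise the strong component of [u] off the path contains a leg by induction, with a link into
    it from [p] on the path and a link from it to [p']. If [p'] is not after [p], the path rooted at
    [p] is one more branch set in front of the leg. If [p] comes first, the parts of the path up to
    [p] and from [p'] on prolong the trees of the first branch set. *)
Lemma strong_leg K a u b : strong e K -> a \in K -> u \in K -> b \in K ->
  exists I O l, [/\ leg K I O u l, a \in I & b \in O].
Proof.
have [n] := ubnP #|K|; elim: n => // n IH in K a u b *; rewrite ltnS => Kn st aK uK bK.
have [s [pth ls un sK]] := connP (st _ _ aK bK).
have bP : b \in a :: s by rewrite -ls mem_last.
have ib : index b (a :: s) = size s by rewrite -ls index_last.
have segK i j : seg a s i j \subset K.
  by apply/subsetP=> z; rewrite in_seg => /andP[/sK].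
have aseg k : a \in seg a s 0 k by rewrite in_seg mem_head /= eqxx.
have bseg k : k <= size s -> b \in seg a s k (size s).
  by move=> ks; rewrite in_seg bP ib ks leqnn.
have [uP|uP] := boolP (u \in a :: s).
  have us : index u (a :: s) <= size s by rewrite -ltnS index_mem.
  exists (seg a s 0 (index u (a :: s))), (seg a s (index u (a :: s)) (size s)), 0.
  split=> //; last exact: bseg.
  apply: leg0; last by rewrite subUset !segK.
  rewrite -{3}(nth_index a uP); apply: seg_bset => //; lia.
pose P := [set z in a :: s]; pose X := K :\: P; pose C := comp e X u.
have uX : u \in X by rewrite !inE uK andbT; rewrite inE in uP.
have uC : u \in C by apply: comp_self.
have CX := subsetP (comp_sub e X u).
have dPC : [disjoint P & C].
  by rewrite disjoint_sym disjoints_subset; apply/subsetP=> z /CX; rewrite !inE => /andP[].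
have aP : a \in P by rewrite inE mem_head.
have [p [q1 [c1 [/setIP[pP _] /setIP[c1C _] lk1 q1X]]]] := link_exists aP uC (st _ _ aK uK) dPC.
rewrite disjoint_sym in dPC.
have [c2 [q2 [p' [/setIP[c2C _] /setIP[pP' _] lk2 q2X]]]] := link_exists uC aP (st _ _ uK aK) dPC.
have q1X' : {in q1, forall z, z \in X /\ z \notin C}.
  by move=> z /q1X[zK zP zC]; rewrite /X in_setD zP zK.
have q2X' : {in q2, forall z, z \in X /\ z \notin C}.
  by move=> z /q2X[zK zC zP]; rewrite /X in_setD zP zK.
have q12 := links_disjoint lk1 lk2 c1C c2C q1X' (fun z zq => (q2X' z zq).1).
have XK : X \subset K by apply: subsetDl.
have CK : C \subset K by apply: subset_trans (comp_sub _ _ _) XK.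
have Cn : #|C| < n.
  apply: leq_trans Kn; apply: proper_card; apply/properP; split=> //.
  by exists a => //; apply/negP=> /CX; rewrite !inE eqxx.
have [I [O [l [lg c1I c2O]]]] := IH C c1 u c2 Cn (@comp_strong _ _ _ _) c1C uC c2C.
have {I O c1I c2O lg} [A' [I' [O' [lg A'X [f fI' pf] [f' fO' pf']]]]] : exists A' I' O',
    [/\ leg A' I' O' u l, A' \subset X, exists2 f, f \in I' & e p f
      & exists2 f, f \in O' & e f p'].
  exists ([set z in q2] :|: ([set z in q1] :|: C)), ([set z in q1] :|: I), ([set z in q2] :|: O).
  split.
  - apply: leg_linkO lk2 c2O _; first exact: leg_linkI lg lk1 c1I (fun z zq => (q1X' z zq).2).
    move=> z zq; rewrite in_setU negb_or (q2X' z zq).2 andbT inE.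
    by apply/negP=> /q12; rewrite zq.
  - rewrite !subUset comp_sub andbT; apply/andP; split; apply/subsetP=> z; rewrite inE.
      by case/q2X'.
    by case/q1X'.
  - have [z zq pz] := link_first lk1; exists z => //.
    by move: zq; rewrite mem_rcons !inE => /orP[/eqP->|->//]; rewrite c1I orbT.
  have [z zq pz] := link_last lk2; exists z => //.
  by move: zq; rewrite !inE => /orP[/eqP->|->//]; rewrite c2O orbT.
have dseg i j : [disjoint seg a s i j & A'].
  rewrite disjoint_sym disjoints_subset; apply: subset_trans A'X _.
  by apply/subsetP=> z; rewrite in_setC in_seg !inE negb_and => /andP[->].
pose ip := index p (a :: s); pose ip' := index p' (a :: s).
have pP2 : p \in a :: s by move: pP; rewrite inE.
have pP2' : p' \in a :: s by move: pP'; rewrite inE.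
have ips : ip <= size s by rewrite -ltnS index_mem.
have ips' : ip' <= size s by rewrite -ltnS index_mem.
have pI : p \in seg a s 0 ip by rewrite in_seg pP2 leqnn.
have pO : p \in seg a s ip (size s) by rewrite in_seg pP2 leqnn.
have pO' : p' \in seg a s ip' (size s) by rewrite in_seg pP2' leqnn.
have [pp'|pp'] := ltnP ip ip'; last first.
  exists (seg a s 0 ip), (seg a s ip (size s)), l.+1; split=> //; last exact: bseg.
  apply: (@legS _ _ _ _ _ p) lg _ _ _ _ => //.
  - rewrite -(nth_index a pP2); apply: seg_bset => //; lia.
  - by rewrite subUset !segK.
  - exact: subset_trans A'X XK.
  - by rewrite -setI_eq0 setIUl setU_eq0 !setI_eq0 !dseg.
  - by exists p, f.
  - by exists f', p'; rewrite in_seg pP2'.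
have lI : {in seg a s 0 ip, forall z, exists2 y, y \in I' & conn (seg a s 0 ip :|: I') z y}.
  move=> z zs; exists f => //; apply: (@conn_trans _ _ _ p).
    apply: conn_mono (subsetUl _ _) _; apply: seg_conn => //.
    by move: zs; rewrite in_seg => /and3P[].
  by apply: conn1; rewrite ?in_setU ?fI' ?pI ?orbT.
have lO : {in seg a s ip' (size s), forall z, exists2 y, y \in O' &
    conn (seg a s ip' (size s) :|: O') y z}.
  move=> z zs; exists f' => //; apply: (@conn_trans _ _ _ p').
    by apply: conn1; rewrite ?in_setU ?fO' ?pO' ?orbT.
  apply: conn_mono (subsetUl _ _) _; apply: seg_conn => //.
  by move: zs; rewrite in_seg => /and3P[].
have {}lg := leg_extI lg (dseg _ _) lI.
exists (seg a s 0 ip :|: I'), (seg a s ip' (size s) :|: O'), l.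
split; last 2 first.
- by rewrite in_setU aseg.
- by rewrite in_setU bseg.
apply: leg_sub (leg_extO lg _ lO).
  by rewrite !subUset !segK (subset_trans A'X XK).
apply: disjI => z z1 /setUP[z2|z2]; last exact: disjE (dseg _ _) z1 z2.
move: z1 z2; rewrite !in_seg => /and3P[_ h1 _] /and3P[_ _ h2].
by have := leq_trans h1 h2; rewrite leqNgt pp'.
Qed.

End StrongLeg.

(** * Models of butterfly minors *)

Section Leaf.
Variables (V : finType) (e : rel V).
Implicit Types (A B : {set V}) (x y z r : V).

(** Let [B] be a largest proper subset of [A] containing [r] all of whose vertices reach [r] inside
    it. Some arc enters [B] from the rest of [A]; by maximality its tail together with [B] is all of
    [A], so this tail is the leaf. *)
Lemma intree_leaf A r : r \in A -> {in A, forall y, conn e A y r} -> 1 < #|A| ->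
  exists x y, [/\ x \in A, x != r, y \in A :\ x, e x y &
    {in A :\ x, forall z, conn e (A :\ x) z r}].
Proof.
move=> rA cA A1.
pose good B := [&& B \proper A, r \in B & [forall y in B, conn e B y r]].
have g0 : good [set r].
  apply/and3P; split; rewrite ?set11 //.
    by rewrite properEcard sub1set rA cards1.
  by apply/forall_inP=> y /set1P->; apply: conn_refl; rewrite set11.
have [B /and3P[pB rB /forall_inP cB] maxB] := @arg_maxnP _ [set r] good (fun B => #|B|) g0.
have [sBA [z zA zB]] := properP pB.
have [x [y [xAB yB xy]]] : exists x y, [/\ x \in A :\: B, y \in B & e x y].
  have zAB : z \in A :\: B by rewrite inE zB.
  have rAB : r \notin A :\: B by rewrite inE rB.
  case E : [exists x in A :\: B, exists y in B, e x y].
    by have [x xAB /exists_inP[y yB xy]] := exists_inP E; exists x, y.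
  case/negP: rAB; apply: (@conn_ind _ e A (fun w => w \in A :\: B) z r (cA _ zA)) => //.
  move=> v w vA wA vw vAB; rewrite in_setD wA andbT; apply/negP=> wB.
  by case/exists_inP: E; exists v => //; apply/exists_inP; exists w.
have /setDP[xA xB] := xAB.
have cxB : {in x |: B, forall w, conn e (x |: B) w r}.
  have cB' w : w \in B -> conn e (x |: B) w r.
    by move=> wB; apply: conn_mono (cB _ wB); apply: subsetUr.
  move=> w /setU1P[->|/cB'//].
  by apply: conn_trans (cB' _ yB); apply: conn1; rewrite ?setU11 // in_setU1 yB orbT.
have AxB : A = x |: B.
  apply/eqP; rewrite eq_sym eqEproper subUset sub1set xA sBA /=; apply/negP=> pxB.
  have := maxB (x |: B); rewrite cardsU1 xB /= => H.
  have : #|B|.+1 <= #|B|; last by rewrite ltnn.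
  apply: H; apply/and3P; split=> //; first by rewrite in_setU1 rB orbT.
  exact/forall_inP.
have Ax : A :\ x = B by rewrite AxB setU1K.
exists x, y; split; rewrite ?Ax //.
by apply: contraNneq xB => ->.
Qed.

End Leaf.

Section Model.
Variable D : digraph.

Definition model (H : digraph) (I O : H -> {set D}) (r : H -> D) :=
  [/\ forall h, bset (@arc D) (I h) (O h) (r h),
      forall h h', h != h' -> [disjoint I h :|: O h & I h' :|: O h']
    & forall h h', arc h h' -> arcs (@arc D) (O h) (I h')].

Section PeelIn.
Variables (H : digraph) (I O : H -> {set D}) (r : H -> D) (h0 : H) (x : D).

(** [None] is the leaf [x] split off the in-tree of [h0]; its only outgoing arc goes to [h0]. An arc
    into [h0] survives towards each of [x] and the remaining in-tree that some arc of $D$ from the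
    out-tree enters. *)
Definition peel_in_arc : rel (option H) := fun a b =>
  match a, b with
  | Some h, Some h' => arc h h' &&
      ((h' == h0) ==> [exists z in O h, exists w in I h0 :\ x, arc z w])
  | Some h, None => arc h h0 && [exists z in O h, arc z x]
  | None, Some h' => h' == h0
  | None, None => false
  end.

Lemma peel_in_irr : irreflexive peel_in_arc.
Proof. by case=> [h|] //=; rewrite arc_irr. Qed.

Definition peel_in := Digraph peel_in_irr.

Definition unpeel (a : option H) : H := odflt h0 a.

Lemma peel_in_contraction : model I O r ->
  @contraction peel_in H None (Some h0) unpeel.
Proof.
move=> [mb md ma]; split.
- by move=> a; exists (Some a).
- move=> [h|] [h'|] /=; rewrite !inE /=; split.
  + by move->; left.
  + by case=> [[]//|/andP[/eqP[->] /eqP[->]]].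
  + by move->; right; rewrite eqxx.
  + by case=> // /andP[/eqP[->]].
  + by move<-; right; rewrite eqxx.
  + by case=> // /eqP[->].
  + by left.
  + by [].
- move=> a b; split=> [ab|[nab [[h|] [[h'|] /= [ha hb]]]]].
  + split; first by move=> E; rewrite E arc_irr in ab.
    have [bh|nbh] := eqVneq b h0; last first.
      by exists (Some a), (Some b); split=> //=; rewrite ab (negPf nbh).
    have [z [w [zO wI zw]]] := ma _ _ ab; rewrite bh in wI.
    have [wx|nwx] := eqVneq w x.
      exists (Some a), None; split=> //=; rewrite -bh ab /=.
      by apply/exists_inP; exists z; rewrite -?wx.
    exists (Some a), (Some b); split=> //=; rewrite ab bh eqxx /=.
    apply/exists_inP; exists z => //; apply/exists_inP; exists w => //.
    by rewrite in_setD1 nwx.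
  + by rewrite ha hb => /andP[].
  + by rewrite ha hb => /andP[].
  + by move=> /eqP E; case: nab; rewrite -ha -hb E.
  + by [].
Qed.

End PeelIn.

Section PeelOut.
Variables (H : digraph) (I O : H -> {set D}) (r : H -> D) (h0 : H) (x : D).

(** Mirror image of [peel_in_arc]: the leaf of the out-tree has the arc from [h0] as its only
    incoming arc. *)
Definition peel_out_arc : rel (option H) := fun a b =>
  match a, b with
  | Some h, Some h' => arc h h' &&
      ((h == h0) ==> [exists z in O h0 :\ x, exists w in I h', arc z w])
  | Some h, None => h == h0
  | None, Some h' => arc h0 h' && [exists w in I h', arc x w]
  | None, None => false
  end.

Lemma peel_out_irr : irreflexive peel_out_arc.
Proof. by case=> [h|] //=; rewrite arc_irr. Qed.

Definition peel_out := Digraph peel_out_irr.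

Lemma peel_out_contraction : model I O r ->
  @contraction peel_out H (Some h0) None (unpeel h0).
Proof.
move=> [mb md ma]; split.
- by move=> a; exists (Some a).
- move=> [h|] [h'|] /=; rewrite !inE /=; split.
  + by move->; left.
  + by case=> [[]//|]; rewrite !orbF => /andP[/eqP[->] /eqP[->]].
  + by move->; right; rewrite eqxx.
  + by case=> //; rewrite !orbF andbT => /eqP[->].
  + by move<-; right; rewrite eqxx.
  + by case=> //; rewrite !orbF => /eqP[->].
  + by left.
  + by [].
- move=> a b; split=> [ab|[nab [[h|] [[h'|] /= [ha hb]]]]].
  + split; first by move=> E; rewrite E arc_irr in ab.
    have [ah|nah] := eqVneq a h0; last first.
      by exists (Some a), (Some b); split=> //=; rewrite ab (negPf nah).
    have [z [w [zO wI zw]]] := ma _ _ ab; rewrite ah in zO.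
    have [zx|nzx] := eqVneq z x.
      exists None, (Some b); split=> //=; rewrite -ah ab /=.
      by apply/exists_inP; exists w; rewrite -?zx.
    exists (Some a), (Some b); split=> //=; rewrite ab ah eqxx /=.
    apply/exists_inP; exists z; first by rewrite in_setD1 nzx.
    by apply/exists_inP; exists w.
  + by rewrite ha hb => /andP[].
  + by move=> /eqP E; case: nab; rewrite -ha -hb E.
  + by rewrite ha hb => /andP[].
  + by [].
Qed.

End PeelOut.

(** Induction on the number of non-root vertices in the trees. A leaf is peeled off as a vertex of
    its own and the induction hypothesis realises the larger digraph. Contracting the only arc that
    leaves the new vertex, or the only arc that enters it, gives [H] back and identifies the new
    vertex with the end that has the root. When every tree is its root, [r] embeds [H] in $D$. *)
Theorem model_minor (H : digraph) (I O : H -> {set D}) (r : H -> D) : model I O r ->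
  exists t : H -> {set D}, butterfly_minor t /\ forall h, r h \in t h.
Proof.
pose w (H : digraph) (I O : H -> {set D}) := \sum_h (#|I h|.-1 + #|O h|.-1).
have [n] := ubnP (w H I O); elim: n => // n IH in H I O r *; rewrite ltnS => wn m.
have [mb md ma] := m.
have rI h := (bset_root (mb h)).1; have rO h := (bset_root (mb h)).2.
have cI1 h : 0 < #|I h| by apply/card_gt0P; exists (r h).
case: (boolP [exists h, 1 < #|I h|]) => [/existsP[h0 Ih0]|/existsPn nI].
  have [bI cI cO] := mb h0.
  have [x [y [xI nxr yI xy cIx]]] := intree_leaf (rI h0) cI Ih0.
  pose I' (a : peel_in I O h0 x) := if a is Some h then (if h == h0 then I h0 :\ x else I h) else [set x].
  pose O' (a : peel_in I O h0 x) := if a is Some h then O h else [set x].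
  pose r' (a : peel_in I O h0 x) := if a is Some h then r h else x.
  have xO : x \notin O h0.
    by apply/negP=> xO; case/negP: nxr; rewrite -in_set1 -bI inE xI.
  have I'sub h : I' (Some h) \subset I h.
    by rewrite /I'; case: eqP => [->|_] //; apply: subD1set.
  have m' : model I' O' r'.
    split.
    - case=> [h|] /=; last first.
        by split=> [|y'|y'] /=; rewrite ?setIid // => /set1P->; apply: conn_refl; rewrite set11.
      rewrite /I'; case: (eqVneq h h0) => [->|_]; last exact: mb.
      split=> //; rewrite setIDAC bI; apply/setDidPl.
      by rewrite disjoint_sym disjoints1 in_set1.
    - have aux h : [disjoint I' None :|: O' None & I' (Some h) :|: O' (Some h)].
        rewrite /= setUid disjoints1 in_setU negb_or /I'.
        have [->|nh] := eqVneq h h0; first by rewrite in_setD1 eqxx.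
        have d : x \in I h0 :|: O h0 by rewrite in_setU xI.
        by rewrite -negb_or -in_setU; apply/negP=> /(disjE (md _ _ nh)); apply.
      case=> [h|] [h'|] //= nh; last exact: (aux h'); last first.
        by rewrite disjoint_sym; apply: (aux h).
      apply: disjointWl (setSU _ (I'sub h)) _; apply: disjointWr (setSU _ (I'sub h')) _.
      by apply: md; apply/eqP=> E; case/eqP: nh; rewrite E.
    - case=> [h|] [h'|] //=.
      + case/andP=> ab; rewrite /I'; case: (eqVneq h' h0) => [_|_ _]; last exact: ma.
        by move=> /exists_inP[z zO /exists_inP[v vI zv]]; exists z, v.
      + by case/andP=> ab /exists_inP[z zO zx]; exists z, x; rewrite set11.
      + by move/eqP->; exists x, y; rewrite set11 /I' eqxx.
  have wn' : w (peel_in I O h0 x) I' O' < n.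
    apply: leq_trans wn; rewrite /w (bigD1 None) //= !cards1 add0n.
    rewrite (reindex_onto (@Some H) (unpeel h0)) /=; last by case.
    rewrite (eq_bigl xpredT) => [|h]; last by rewrite /= eqxx.
    rewrite (bigD1 h0) //= [X in _ < X](bigD1 h0) //= eqxx.
    rewrite -addSn; apply: leq_add; last first.
      by apply: leq_sum => h nh; rewrite (negPf nh).
    rewrite -addSn leq_add2r.
    by move: (cardsD1 x (I h0)) Ih0; rewrite xI => ->; case: #|_|.
  have [t [bt rt]] := IH _ I' O' r' wn' m'.
  have oo : @only_out (peel_in I O h0 x) None (Some h0).
    rewrite /only_out /= eqxx; apply/forallP=> -[h|] //=.
    by apply/implyP=> /eqP->.
  have bc : @butterfly_contractible (peel_in I O h0 x) None (Some h0) by rewrite /butterfly_contractible oo.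
  have bt' := BM_contract bt bc (@peel_in_contraction H I O r h0 x m).
  eexists; split; first exact: bt'.
  move=> h; apply/bigcupP; exists (Some h); last exact: (rt (Some h)).
  by rewrite /= eqxx /retained /=; case: eqP => // _; rewrite oo.
case: (boolP [exists h, 1 < #|O h|]) => [/existsP[h0 Oh0]|/existsPn nO].
  have [bI cI cO] := mb h0.
  have cO' : {in O h0, forall y, conn (revr (@arc D)) (O h0) y (r h0)}.
    by move=> y yO; rewrite (conn_rev (@arc D)); apply: cO.
  have [x [y [xI nxr yI xy cIx]]] := intree_leaf (rO h0) cO' Oh0.
  pose O' (a : peel_out I O h0 x) := if a is Some h then (if h == h0 then O h0 :\ x else O h) else [set x].
  pose I' (a : peel_out I O h0 x) := if a is Some h then I h else [set x].
  pose r' (a : peel_out I O h0 x) := if a is Some h then r h else x.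
  have xO : x \notin I h0.
    by apply/negP=> xO; case/negP: nxr; rewrite -in_set1 -bI inE xI andbT.
  have O'sub h : O' (Some h) \subset O h.
    by rewrite /O'; case: eqP => [->|_] //; apply: subD1set.
  have m' : model I' O' r'.
    split.
    - case=> [h|] /=; last first.
        by split=> [|y'|y'] /=; rewrite ?setIid // => /set1P->; apply: conn_refl; rewrite set11.
      rewrite /O'; case: (eqVneq h h0) => [->|_]; last exact: mb.
      split=> //; last by move=> z /cIx; rewrite (conn_rev (@arc D)).
      rewrite setIDA bI; apply/setDidPl.
      by rewrite disjoint_sym disjoints1 in_set1.
    - have aux h : [disjoint I' None :|: O' None & I' (Some h) :|: O' (Some h)].
        rewrite /= setUid disjoints1 in_setU negb_or /O'.
        have [->|nh] := eqVneq h h0; first by rewrite in_setD1 eqxx andbT.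
        have d : x \in I h0 :|: O h0 by rewrite in_setU xI orbT.
        by rewrite -negb_or -in_setU; apply/negP=> /(disjE (md _ _ nh)); apply.
      case=> [h|] [h'|] //= nh; last exact: (aux h'); last first.
        by rewrite disjoint_sym; apply: (aux h).
      apply: disjointWl (setUS _ (O'sub h)) _; apply: disjointWr (setUS _ (O'sub h')) _.
      by apply: md; apply/eqP=> E; case/eqP: nh; rewrite E.
    - case=> [h|] [h'|] //=.
      + case/andP=> ab; rewrite /O'; case: (eqVneq h h0) => [_|_ _]; last exact: ma.
        by move=> /exists_inP[z zO /exists_inP[v vI zv]]; exists z, v.
      + by move/eqP->; exists y, x; rewrite set11 /O' eqxx.
      + by case/andP=> ab /exists_inP[z zO zx]; exists x, z; rewrite set11.
  have wn' : w (peel_out I O h0 x) I' O' < n.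
    apply: leq_trans wn; rewrite /w (bigD1 None) //= !cards1 add0n.
    rewrite (reindex_onto (@Some H) (unpeel h0)) /=; last by case.
    rewrite (eq_bigl xpredT) => [|h]; last by rewrite /= eqxx.
    rewrite (bigD1 h0) //= [X in _ < X](bigD1 h0) //= eqxx.
    rewrite -addSn; apply: leq_add; last first.
      by apply: leq_sum => h nh; rewrite (negPf nh).
    rewrite -addnS leq_add2l.
    by move: (cardsD1 x (O h0)) Oh0; rewrite xI => ->; case: #|_|.
  have [t [bt rt]] := IH _ I' O' r' wn' m'.
  have oo : @only_in (peel_out I O h0 x) (Some h0) None.
    rewrite /only_in /= eqxx; apply/forallP=> -[h|] //=.
    by apply/implyP=> /eqP->.
  have bc : @butterfly_contractible (peel_out I O h0 x) (Some h0) None.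
    by rewrite /butterfly_contractible oo orbT.
  have bt' := BM_contract bt bc (@peel_out_contraction H I O r h0 x m).
  eexists; split; first exact: bt'.
  move=> h; apply/bigcupP; exists (Some h); last exact: (rt (Some h)).
  by rewrite /= eqxx /retained /=; case: eqP => // _; rewrite oo.
have I1 h : I h = [set r h].
  apply/eqP; rewrite eq_sym eqEcard sub1set rI cards1.
  by move: (nI h); rewrite -leqNgt.
have O1 h : O h = [set r h].
  apply/eqP; rewrite eq_sym eqEcard sub1set rO cards1.
  by move: (nO h); rewrite -leqNgt.
have emb : subgraph_embedding r.
  split=> [h h' E|h h' /ma[z [v []]]].
    apply/eqP; apply: contraT => /md d; case: (disjE d (z := r h)).
      by rewrite in_setU rI.
    by rewrite E in_setU rI.
  by rewrite I1 O1 => /set1P-> /set1P->.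
exists (fun h => [set r h]); split; last by move=> h; rewrite set11.
exact: BM_subgraph.
Qed.

End Model.

Section Conclusion.
Variables (D : digraph) (U : {set D}) (n : nat).

Definition unavoidable := exists (H : digraph) (t : H -> {set D}) (T : {set H}),
  [/\ butterfly_minor t, shaped_by_star T \/ shaped_by_comb T
    & n <= #|[set a in T | t a :&: U != set0]|].

Lemma unavoidable_model (H : digraph) (I O : H -> {set D}) (r : H -> D) (T : {set H})
    (f : 'I_n -> H) :
  model I O r -> shaped_by_star T \/ shaped_by_comb T -> injective f ->
  (forall j, f j \in T) -> (forall j, r (f j) \in U) -> unavoidable.
Proof.
move=> m sh inj fT rU; have [t [bt rt]] := model_minor m.
exists H, t, T; split=> //.
rewrite -[n]card_ord -cardsT -(card_imset _ inj); apply: subset_leq_card.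
apply/subsetP=> _ /imsetP[j _ ->]; rewrite inE fT /=.
by apply/set0Pn; exists (r (f j)); rewrite inE rt rU.
Qed.

End Conclusion.

Section LegFun.
Variables (V : finType) (e : rel V).
Implicit Types (A I O : {set V}).

(** The branch sets of a leg as a sequence: index 0 is the first one, index [l] the one rooted at
    [u], and [L k] packs in-tree, out-tree and root. *)
Definition legfun A I O u l (L : nat -> {set V} * {set V} * V) :=
  [/\ (L 0).1 = (I, O), (L l).2 = u,
      forall k, k <= l -> bset e (L k).1.1 (L k).1.2 (L k).2 /\
                          (L k).1.1 :|: (L k).1.2 \subset A,
      forall k k', k < k' -> k' <= l ->
        [disjoint (L k).1.1 :|: (L k).1.2 & (L k').1.1 :|: (L k').1.2]
    & forall k, k < l -> arcs e (L k).1.2 (L k.+1).1.1 /\ arcs e (L k.+1).1.2 (L k).1.1].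

Lemma leg_legfun A I O u l : leg e A I O u l -> exists L, legfun A I O u l L.
Proof.
elim=> {A I O u l} [A I O u b s|A I O r A' I' O' u l b s _ [L [L0 Ll Lb Ld La]] s' d a1 a2].
  exists (fun=> (I, O, u)); split=> // k k' kk' k'0.
  by have := leq_trans kk' k'0.
exists (fun k => if k is k'.+1 then L k' else (I, O, r)); split=> //=.
- move=> [|k] kl //=; have [bk sk] := Lb k kl; split=> //.
  exact: subset_trans sk s'.
- move=> [|k] [|k'] //= kk' k'l; last exact: Ld.
  by apply: disjointWr (Lb k' k'l).2 d.
- by move=> [|k] kl /=; [rewrite L0|apply: La].
Qed.

End LegFun.

Section Infix.
Variable T : eqType.

Lemma infix_mkseq (g : nat -> T) m x y :
  reflect (exists k, [/\ k.+1 < m, x = g k & y = g k.+1]) (infix [:: x; y] (mkseq g m)).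
Proof.
apply: (iffP (@infixP _ [:: x; y] (mkseq g m))) => [[p [q E]]|[k [km -> ->]]].
  have sz := congr1 size E; rewrite size_mkseq !size_cat /= in sz.
  exists (size p); split; first by lia.
    by rewrite -(nth_mkseq x g (_ : size p < m)) ?E ?nth_cat ?ltnn ?subnn //; lia.
  rewrite -(nth_mkseq x g (_ : (size p).+1 < m)) ?E ?nth_cat; last by lia.
  by rewrite ltnNge leqnSn /= subSnn.
exists (take k (mkseq g m)), (drop k.+2 (mkseq g m)).
rewrite -{1}(cat_take_drop k (mkseq g m)); congr (_ ++ _).
rewrite (drop_nth (g 0)) ?size_mkseq; last by lia.
rewrite (drop_nth (g 0)) ?size_mkseq //.
by rewrite !nth_mkseq //; lia.
Qed.

Lemma consecutive_mkseq (g : nat -> T) m x y :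
  reflect (exists k, k.+1 < m /\ ((x = g k /\ y = g k.+1) \/ (y = g k /\ x = g k.+1)))
          (consecutive (mkseq g m) x y).
Proof.
apply: (iffP orP) => [[/infix_mkseq[k [? ? ?]]|/infix_mkseq[k [? ? ?]]]|].
- by exists k; split=> //; left.
- by exists k; split=> //; right.
by case=> k [km [[-> ->]|[-> ->]]]; [left|right]; apply/infix_mkseq; exists k.
Qed.

Lemma sorted_mkseq (r : rel T) (g : nat -> T) m :
  (forall k, k.+1 < m -> r (g k) (g k.+1)) -> sorted r (mkseq g m).
Proof.
move=> H; apply/(sortedP (g 0)) => i; rewrite size_mkseq => im.
by rewrite !nth_mkseq; [apply: H| |]; lia.
Qed.

End Infix.

Lemma next_enum_ord n (i : 'I_n) : next (enum 'I_n) i = ordS i.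
Proof.
apply: val_inj; rewrite /= -(next_map val_inj) ?enum_uniq // val_enum_ord.
case: n i => [[]//|n] i; rewrite next_nth mem_iota leq0n ltn_ord.
have idx : index (val i) (iota 0 n.+1) = i.
  have E : nth 0 (iota 0 n.+1) i = i by rewrite nth_iota.
  by rewrite -[X in index X]E index_uniq ?size_iota ?iota_uniq.
rewrite idx -[LHS]/(nth 0 (iota 1 n) i).
case: (ltngtP i n) => [lt|gt|E].
- by rewrite nth_iota // modn_small.
- by move: (ltn_ord i); rewrite ltnS leqNgt gt.
- by rewrite E modnn nth_default // size_iota.
Qed.

Lemma induces_cycle_ord (H : digraph) n (f : 'I_n -> H) (A : {set H}) :
  injective f -> A = f @: setT -> (forall i j, arc (f i) (f j) = (j == ordS i)) ->
  induces_cycle A n.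
Proof.
move=> inj -> fa; exists [seq f i | i <- enum 'I_n]; split.
- by rewrite map_inj_uniq // enum_uniq.
- move=> x; apply/mapP/imsetP=> [[i _ ->]|[i _ ->]]; exists i; rewrite ?inE //.
  by rewrite mem_enum.
- by rewrite size_map size_enum_ord.
move=> _ _ /imsetP[i _ ->] /imsetP[j _ ->].
by rewrite fa next_map // ?enum_uniq // next_enum_ord (inj_eq inj) eq_sym.
Qed.

(** * Directed cycles *)

Section Cycle.
Variables (n : nat).
Hypothesis n2 : 1 < n.

Definition cycle_arc : rel 'I_n := fun i j => j == ordS i.

Lemma ordS_neq (i : 'I_n) : ordS i != i.
Proof.
apply/eqP=> /(congr1 val) /=; have := ltn_ord i.
case: (ltngtP i.+1 n) => [lt _|gt|E _]; first by rewrite modn_small //; lia.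
  by [].
by rewrite E modnn; lia.
Qed.

Lemma cycle_irr : irreflexive cycle_arc.
Proof. by move=> i; rewrite /cycle_arc eq_sym (negPf (ordS_neq i)). Qed.

Definition cycle_digraph := Digraph cycle_irr.

Lemma cycle_shaped : @shaped_by_star cycle_digraph setT.
Proof.
left; split=> //; exists n => //.
by apply: (@induces_cycle_ord cycle_digraph n id) => //; rewrite imset_id.
Qed.

End Cycle.

(** * Stars *)

Definition near (a b : nat) := (a == b.+1) || (b == a.+1).

Lemma near_sym : symmetric near.
Proof. by move=> a b; rewrite /near orbC. Qed.

Lemma near_irr a : near a a = false.
Proof. by rewrite /near; lia. Qed.

(* The vertex [legv j k] is the k-th vertex of the j-th of n disjoint paths,  *)
(* the j-th path having (l j).+1 vertices.                                    *)
Section Legs.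
Variables (n : nat) (l : 'I_n -> nat).

Definition legs := {j : 'I_n & 'I_(l j).+1}.

Definition legv (j : 'I_n) (k : nat) : legs := @Tagged _ j (fun j => 'I_(l j).+1) (inord k).

Lemma legvP (x : legs) : exists j k, k <= l j /\ x = legv j k.
Proof.
case: x => j k; exists j, k; split; first by rewrite -ltnS.
by rewrite /legv inord_val.
Qed.

Lemma legv_tag j k : tag (legv j k) = j. Proof. by []. Qed.

Lemma legv_tagged j k : k <= l j -> tagged (legv j k) = k :> nat.
Proof. by move=> kj; rewrite /= inordK. Qed.

Lemma legv_inj j j' k k' : k <= l j -> k' <= l j' -> legv j k = legv j' k' -> j = j' /\ k = k'.
Proof.
move=> kj k'j' E; split; first exact: (congr1 (fun x : legs => tag x) E).
by rewrite -(legv_tagged kj) -(legv_tagged k'j') E.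
Qed.

Lemma legv_eq j j' k k' : k <= l j -> k' <= l j' ->
  (legv j k == legv j' k') = (j == j') && (k == k').
Proof.
move=> kj kj'; apply/eqP/andP=> [/legv_inj[] // -> ->|[/eqP-> /eqP->] //].
by rewrite !eqxx.
Qed.

End Legs.

Section Star.
Variables (n : nat) (l : 'I_n -> nat).

Definition star_adj : rel (option (legs l)) := fun x y =>
  match x, y with
  | Some a, Some b => (tag a == tag b) && near (tagged a) (tagged b)
  | Some a, None | None, Some a => tagged a == 0 :> nat
  | None, None => false
  end.

Lemma star_sym : symmetric star_adj.
Proof. by move=> [a|] [b|] //=; rewrite eq_sym near_sym. Qed.

Lemma star_irr : irreflexive star_adj.
Proof. by move=> [a|] //=; rewrite near_irr andbF. Qed.

Definition star := SGraph star_sym star_irr.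

(** Leg [j] as a path starting at the centre [None], so positions are shifted by one against
    [legv]. *)
Definition star_leg (j : 'I_n) (k : nat) : star := if k is k'.+1 then Some (legv l j k') else None.

Lemma star_leg_inj j j' k k' : k <= (l j).+1 -> k' <= (l j').+1 -> 0 < k ->
  star_leg j k = star_leg j' k' -> j = j' /\ k = k'.
Proof.
case: k k' => // k [|k'] // kj kj' _ /Some_inj E.
by have [|| -> ->] := legv_inj _ _ E; rewrite // -ltnS.
Qed.

Lemma star_legP (x : star) : x = None \/ exists j k, k < (l j).+1 /\ x = star_leg j k.+1.
Proof.
case: x => [x|]; last by left.
by right; have [j [k [kj ->]]] := legvP x; exists j, k.
Qed.

Lemma star_leg_adj j k : k <= l j -> star_adj (star_leg j k) (star_leg j k.+1).
Proof.
case: k => [|k] kj /=; first by rewrite inordK.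
rewrite eqxx !inordK //= /near ?eqxx ?orbT //; lia.
Qed.

Lemma star_adjP x y : star_adj x y ->
  exists j k, k <= l j /\ ((x = star_leg j k /\ y = star_leg j k.+1) \/
                            (y = star_leg j k /\ x = star_leg j k.+1)).
Proof.
have [->|[j [k [kj ->]]]] := star_legP x; have [->|[j' [k' [kj' ->]]]] := star_legP y => //=.
- by rewrite inordK // => /eqP->; exists j', 0; split=> //; left.
- by rewrite inordK // => /eqP->; exists j, 0; split=> //; right.
case/andP=> /eqP E; subst j'; rewrite !inordK //.
case/orP=> /eqP E; subst; [exists j, k'.+1|exists j, k.+1]; split=> //.
- by right.
- by left.
Qed.

Lemma star_subdivided : subdivided_star star.
Proof.
exists None, [seq mkseq (star_leg j) (l j).+2 | j <- enum 'I_n]; split.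
- split.
  + rewrite /= {1}/is_path /=; apply/allP=> _ /mapP[j _ ->].
    rewrite /is_path sorted_mkseq => [|k kj]; last by apply: star_leg_adj; lia.
    apply/andP; split=> //; rewrite andTb; apply/mkseq_uniqP=> k k'.
    rewrite !inE => kj kj'.
    case: k k' kj kj' => [|k] [|k'] // kj kj' /Some_inj E.
    by have [|| _ ->] := legv_inj _ _ E; rewrite // -ltnS.
  + move=> x; apply/hasP; have [->|[j [k [kj ->]]]] := star_legP x.
      by exists [:: None]; rewrite ?mem_head // inE.
    exists (mkseq (star_leg j) (l j).+2).
      by rewrite inE; apply/orP; right; apply/mapP; exists j; rewrite ?mem_enum.
    by apply/mapP; exists k.+1 => //; rewrite mem_iota /= add0n ltnS.
  + move=> x y; apply/idP/hasP=> [/star_adjP[j [k [kj H]]]|[s]].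
      exists (mkseq (star_leg j) (l j).+2).
        by rewrite inE; apply/orP; right; apply/mapP; exists j; rewrite ?mem_enum.
      by apply/consecutive_mkseq; exists k.
    rewrite inE => /orP[/eqP->|/mapP[j _ ->]].
      have -> : [:: None] = mkseq (fun=> None) 1 :> seq star by [].
      by case/consecutive_mkseq=> k [].
    case/consecutive_mkseq=> k [kj [[-> ->]|[-> ->]]].
      by apply: star_leg_adj; lia.
    by rewrite -[adj _ _]/(star_adj _ _) star_sym; apply: star_leg_adj; lia.
- by apply/allP=> _ /mapP[j _ ->]; rewrite size_mkseq.
rewrite pairwise_map; have := enum_uniq 'I_n; rewrite uniq_pairwise.
apply: sub_pairwise => j j' njj'; apply/allP=> x /mapP[k kj ->].
apply/implyP=> /mapP[k' kj' E]; case: k kj E => // k kj E.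
rewrite !mem_iota in kj kj'.
have [|||E' _] := star_leg_inj _ _ _ E; [lia|lia|by []|].
by move: njj'; rewrite /= E' eqxx.
Qed.

Definition leaf j : star := star_leg j (l j).+1.

Lemma leaf_leaves j : leaf j \in leaves star.
Proof.
rewrite inE /degree; apply/eqP.
suff -> : [set y | adj (leaf j) y] = [set star_leg j (l j)] by rewrite cards1.
apply/setP=> y; rewrite !inE; apply/idP/eqP=> [/star_adjP[j' [k [kj' [[E ->]|[-> E]]]]]|->].
- by have [|||-> E'] := star_leg_inj _ _ _ E => //; lia.
- by have [|||-> E'] := star_leg_inj _ _ _ E; rewrite //; case: E' => ->.
by rewrite -[adj _ _]/(star_adj _ _) star_sym; apply: star_leg_adj.
Qed.

Lemma leaf_inj : injective leaf.
Proof. by move=> j j' E; have [|||] := star_leg_inj _ _ _ E. Qed.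

Lemma star_shaped : @shaped_by_star (bidirected star) (id @: leaves star).
Proof.
right; exists star; split; first exact: star_subdivided.
left; exists id => //; by split=> //; exists id.
Qed.

Section Ring.
Hypothesis n3 : 2 < n.

Definition ring_p (x : 'I_n + legs l) : star := if x is inr a then Some a else None.

(** Leg [j] is attached to vertex [j] of the cycle. The value at [None, None] is a dummy, as the
    centre is not adjacent to itself. *)
Definition ring_att (x y : star) : 'I_n + legs l :=
  match x, y with
  | Some a, _ => inr a
  | None, Some b => inl (tag b)
  | None, None => inl (Ordinal (ltnW (ltnW n3)))
  end.

Definition ring_arc : rel ('I_n + legs l) := fun a b =>
  if ring_p a == ring_p b then
    match a, b with inl i, inl j => j == ordS i | _, _ => false end
  else [&& star_adj (ring_p a) (ring_p b), a == ring_att (ring_p a) (ring_p b)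
         & b == ring_att (ring_p b) (ring_p a)].

Lemma ring_irr : irreflexive ring_arc.
Proof.
move=> [i|a]; rewrite /ring_arc eqxx //.
by apply/negbTE; rewrite eq_sym ordS_neq // ltnW.
Qed.

Definition ring := Digraph ring_irr.

Lemma degree_centre : @degree star None = n.
Proof.
rewrite /degree -[RHS]card_ord -cardsT.
have inj : injective (fun j => star_leg j 1).
  by move=> j j' E; have [|||] := star_leg_inj _ _ _ E.
rewrite -(card_imset _ inj); congr #|pred_of_set _|; apply/setP=> y; rewrite inE.
apply/idP/imsetP=> [/star_adjP[j [k [kj [[E ->]|[-> E]]]]]|[j _ ->]].
- by exists j => //; case: k E kj.
- by [].
- by rewrite /= inordK.
Qed.

Lemma ring_shaped : @shaped_by_star ring (ring_p @^-1: leaves star).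
Proof.
right; exists star; split; first exact: star_subdivided.
right; exists None, ring_p, ring_att; split; rewrite ?degree_centre //.
split.
- by move=> [a|] [b|].
- move=> [a|]; last by rewrite inE eqxx.
  move=> _; rewrite /fiber (_ : [set _ | _] = [set inr a]) ?cards1 //.
  by apply/setP=> -[i|b]; rewrite !inE.
- move=> j /set1P->; rewrite degree_centre.
  apply: (@induces_cycle_ord ring n inl) => [i j' []//||i j'].
    apply/setP=> -[i|b]; rewrite !inE; first by rewrite imset_f.
    by apply/esym/negbTE/negP=> /imsetP[].
  by rewrite /= /ring_arc.
- by move=> a b nab; rewrite /= /ring_arc (negPf nab).
move=> j y z /set1P->.
case: y => [y|//]; case: z => [z|//] /= y0 z0 nsc; apply: contra nsc => /eqP[E].
(* Neighbours of the centre that are attached to the same cycle vertex both have position 0 on the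
   same leg. *)
suff -> : y = z by rewrite /same_strong_component_minus /= !connect0.
case: y z y0 z0 E => [j1 k1] [j2 k2] /= /eqP k10 /eqP k20 E; subst j2.
by congr (Tagged _ _); apply: val_inj; rewrite /= k10 k20.
Qed.

End Ring.

End Star.

(** * Models of stars and directed cycles *)

Section StarModels.
Variables (D : digraph) (U : {set D}) (n : nat).
Variables (A I O : 'I_n -> {set D}) (u : 'I_n -> D) (l : 'I_n -> nat).
Hypothesis leg_j : forall j, leg (@arc D) (A j) (I j) (O j) (u j) (l j).
Hypothesis uU : forall j, u j \in U.
Hypothesis disA : forall j j', j != j' -> [disjoint A j & A j'].

Lemma legfun_choice : exists L : 'I_n -> nat -> {set D} * {set D} * D,
  forall j, legfun (@arc D) (A j) (I j) (O j) (u j) (l j) (L j).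
Proof. exact: (fin_all_exists (fun j => leg_legfun (leg_j j))). Qed.

Lemma legs_disjoint (L : 'I_n -> nat -> {set D} * {set D} * D) j j' k k' :
  (forall j, legfun (@arc D) (A j) (I j) (O j) (u j) (l j) (L j)) ->
  k <= l j -> k' <= l j' -> (j, k) != (j', k') ->
  [disjoint (L j k).1.1 :|: (L j k).1.2 & (L j' k').1.1 :|: (L j' k').1.2].
Proof.
move=> Lf kj kj' ne; have [E|njj'] := eqVneq j j'; last first.
  have [_ _ Lb _ _] := Lf j; have [_ _ Lb' _ _] := Lf j'.
  by apply: disjointWl (Lb k kj).2 _; apply: disjointWr (Lb' k' kj').2 _; apply: disA.
subst j'; have [_ _ _ Ld _] := Lf j.
have [kk'|kk'|E] := ltngtP k k'; first exact: Ld.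
  by rewrite disjoint_sym; apply: Ld.
by rewrite E eqxx in ne.
Qed.

Lemma star_model (I0 O0 : {set D}) (r : D) : bset (@arc D) I0 O0 r ->
  (forall j, [disjoint I0 :|: O0 & A j]) ->
  (forall j, arcs (@arc D) O0 (I j)) -> (forall j, arcs (@arc D) (O j) I0) ->
  unavoidable U n.
Proof.
move=> b0 d0 a1 a2; have [L Lf] := legfun_choice.
pose M (x : star l) := if x is Some a then L (tag a) (tagged a) else (I0, O0, r).
have ML j k : k <= l j -> M (star_leg l j k.+1) = L j k.
  by move=> kj; rewrite /M /= inordK.
have dis0 j k : k <= l j -> [disjoint I0 :|: O0 & (L j k).1.1 :|: (L j k).1.2].
  by move=> kj; have [_ _ Lb _ _] := Lf j; apply: disjointWr (Lb k kj).2 _.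
have arcL j k : k <= l j -> arcs (@arc D) (M (star_leg l j k)).1.2 (M (star_leg l j k.+1)).1.1 /\
    arcs (@arc D) (M (star_leg l j k.+1)).1.2 (M (star_leg l j k)).1.1.
  have [L0 _ _ _ La] := Lf j; case: k => [|k] kj.
    by rewrite ML // L0; split; [apply: a1|apply: a2].
  by rewrite !ML //; [apply: La|apply: ltnW].
apply: (@unavoidable_model D U n (bidirected (star l)) (fun x => (M x).1.1) (fun x => (M x).1.2)
  (fun x => (M x).2) _ (@leaf n l)).
- split.
  + move=> x; have [->//|[j [k [kj ->]]]] := star_legP x.
    by rewrite ML //; have [_ _ Lb _ _] := Lf j; case: (Lb k kj).
  + move=> x y; have [->|[j [k [kj ->]]]] := star_legP x;
      have [->|[j' [k' [kj' ->]]]] := star_legP y => nxy.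
    * by rewrite eqxx in nxy.
    * by rewrite ML //; apply: dis0.
    * by rewrite disjoint_sym ML //; apply: dis0.
    * rewrite !ML //; apply: legs_disjoint => //.
      by apply: contraNneq nxy => -[-> ->].
  + move=> x y /star_adjP[j [k [kj [[-> ->]|[-> ->]]]]]; by have [] := arcL j k kj.
- by left; apply: star_shaped.
- exact: leaf_inj.
- by move=> j; apply: imset_f; apply: leaf_leaves.
- by move=> j; rewrite /leaf ML //; have [_ -> _ _ _] := Lf j.
Qed.

Hypothesis arcO : forall j, arcs (@arc D) (O j) (I (ordS j)).

Lemma cycle_model : 1 < n -> (forall j, l j = 0) -> unavoidable U n.
Proof.
move=> n2 l0; have [L Lf] := legfun_choice.
have L00 j : (L j 0).1 = (I j, O j) by have [-> _ _ _ _] := Lf j.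
apply: (@unavoidable_model D U n (cycle_digraph n2) (fun j => (L j 0).1.1)
  (fun j => (L j 0).1.2) (fun j => (L j 0).2) setT id) => //.
- split.
  + by move=> j; have [_ _ Lb _ _] := Lf j; case: (Lb 0).
  + move=> j j' njj'; apply: legs_disjoint => //.
    by apply: contraNneq njj' => -[->].
  + by move=> j j'; rewrite /= => /eqP->; rewrite !L00; apply: arcO.
- by left; apply: cycle_shaped.
- by move=> j; have [_ + _ _ _] := Lf j; rewrite l0 => ->.
Qed.

(** The first branch sets of the legs form the central cycle, so only the remaining ones, at least
    one per leg, belong to the legs of the star. *)
Lemma ring_model : 2 < n -> (forall j, 0 < l j) -> unavoidable U n.
Proof.
move=> n3 l0; have [L Lf] := legfun_choice.
pose l' j := (l j).-1; have l'E j : l j = (l' j).+1 by rewrite prednK.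
have L00 j : (L j 0).1 = (I j, O j) by have [-> _ _ _ _] := Lf j.
pose M (x : ring l' n3) := match x with inl j => L j 0 | inr a => L (tag a) (tagged a).+1 end.
have MP x : exists j k, [/\ k <= l j, M x = L j k & x = if k is k'.+1 then inr (legv l' j k') else inl j].
  case: x => [j|a]; first by exists j, 0.
  have [j [k [kj ->]]] := legvP a; exists j, k.+1; split; rewrite ?l'E //.
  by rewrite /M legv_tagged.
apply: (@unavoidable_model D U n (ring l' n3) (fun x => (M x).1.1)
  (fun x => (M x).1.2) (fun x => (M x).2) (@ring_p n l' @^-1: leaves (star l'))
  (fun j => inr (legv l' j (l' j)))) => //.
- split.
  + move=> x; have [j [k [kj -> _]]] := MP x.
    by have [_ _ Lb _ _] := Lf j; case: (Lb k kj).
  + move=> x y nxy; have [j [k [kj -> ex]]] := MP x; have [j' [k' [kj' -> ey]]] := MP y.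
    apply: legs_disjoint => //; apply: contraNneq nxy => -[E1 E2].
    by rewrite ex ey E1 E2.
  + have leg0 j (a : legs l') : tagged a = 0 :> nat -> tag a = j ->
        arcs (@arc D) (M (inl j)).1.2 (M (inr a)).1.1 /\ arcs (@arc D) (M (inr a)).1.2 (M (inl j)).1.1.
      move=> a0 aj; rewrite /M a0 aj; have [_ _ _ _ La] := Lf j; by apply: La.
    move=> [i|a] [j|b] /=; rewrite /ring_arc /=.
    * by move=> /eqP->; rewrite !L00; apply: arcO.
    * by case/and3P=> /eqP b0 /eqP[ib] _; apply: (leg0 i b b0 _).1.
    * by case/and3P=> /eqP b0 _ /eqP[ib]; apply: (leg0 j a b0 _).2.
    * have [ja [ka [kja ->]]] := legvP a; have [jb [kb [kjb ->]]] := legvP b.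
      rewrite !legv_tagged //; case: ifP => // _ /andP[/andP[/eqP E]].
      have {}E : ja = jb := E; subst jb; have [_ _ _ _ La] := Lf ja.
      case/orP=> /eqP E _; subst; [have [|_ //] := La kb.+1|have [|//] := La ka.+1];
        by rewrite l'E.
- by left; apply: ring_shaped.
- by move=> j j' /(congr1 (fun x : 'I_n + legs l' => if x is inr a then tag a else j)).
- by move=> j; rewrite inE; exact: (@leaf_leaves n l' j).
- by move=> j; rewrite /M legv_tagged // -l'E; have [_ -> _ _ _] := Lf j.
Qed.

End StarModels.

(** * Combs *)

Lemma last_mkseq T (g : nat -> T) k x : last x (mkseq g k.+1) = g k.
Proof. by rewrite -nth_last size_mkseq nth_mkseq. Qed.

Section Comb.
Variables (m : nat) (l : 'I_m.+1 -> nat) (fl : pred 'I_m.+1).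
Hypothesis l_fl : forall j, ~~ fl j -> l j = 0.

(** The vertices [legv l j 0] form the spine, and the other vertices over [j] form the leg there.
    [fl] marks the spine vertices whose leg ends in a tooth. *)
Definition comb_adj : rel (legs l) := fun x y =>
  (tag x == tag y) && near (tagged x) (tagged y)
  || [&& tagged x == 0 :> nat, tagged y == 0 :> nat & near (tag x) (tag y)].

Lemma comb_sym : symmetric comb_adj.
Proof.
by move=> x y; rewrite /comb_adj eq_sym near_sym [near (tag x) _]near_sym andbCA.
Qed.

Lemma comb_irr : irreflexive comb_adj.
Proof. by move=> x; rewrite /comb_adj !near_irr !andbF. Qed.

Definition combG := SGraph comb_sym comb_irr.

Definition spine (k : nat) : combG := legv l (inord k) 0.

Lemma comb_adjE j k j' k' : k <= l j -> k' <= l j' ->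
  comb_adj (legv l j k) (legv l j' k') =
  ((j == j') && near k k') || [&& k == 0, k' == 0 & near j j'].
Proof. by move=> kj kj'; rewrite /comb_adj !legv_tagged. Qed.

Lemma legv_adj j k : k < l j -> comb_adj (legv l j k) (legv l j k.+1).
Proof. by move=> kj; rewrite comb_adjE ?eqxx /near ?eqxx ?orbT // ltnW. Qed.

Lemma spine_adj k : k < m -> comb_adj (spine k) (spine k.+1).
Proof.
by move=> km; rewrite comb_adjE // !inordK /near ?eqxx ?orbT //; apply: leqW.
Qed.

Lemma comb_adjP x y : comb_adj x y ->
  (exists j k, k < l j /\ ((x = legv l j k /\ y = legv l j k.+1) \/
                           (y = legv l j k /\ x = legv l j k.+1))) \/
  (exists k, k < m /\ ((x = spine k /\ y = spine k.+1) \/ (y = spine k /\ x = spine k.+1))).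
Proof.
have [j [k [kj ->]]] := legvP x; have [j' [k' [kj' ->]]] := legvP y.
rewrite comb_adjE //.
case/orP=> [/andP[/eqP jj'] nk|/and3P[/eqP-> /eqP-> /orP[/eqP E|/eqP E]]].
  subst j'; left; case/orP: nk => /eqP E; subst.
    by exists j, k'; split=> //; right.
  by exists j, k; split=> //; left.
- right; exists j'; split; first by rewrite -ltnS -E ltn_ord.
  by right; rewrite /spine -E !inord_val.
- right; exists j; split; first by rewrite -ltnS -E ltn_ord.
  by left; rewrite /spine -E !inord_val.
Qed.

Definition legpath j := mkseq (legv l j) (l j).+1.

Definition combT : {set combG} := [set legv l j (l j) | j in fl].

Lemma mem_legpath x j : reflect (exists2 k, k <= l j & x = legv l j k) (x \in legpath j).
Proof.
apply: (iffP mapP) => -[k kj ->]; exists k => //; move: kj.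
  by rewrite mem_iota add0n ltnS.
by rewrite mem_iota add0n ltnS.
Qed.

Lemma mem_spine j k : k <= l j -> (legv l j k \in mkseq spine m.+1) = (k == 0).
Proof.
move=> kj; apply/mapP/eqP=> [[i _ /legv_inj[]//]|->].
exists (j : nat); first by rewrite mem_iota add0n ltn_ord.
by rewrite /spine inord_val.
Qed.

(** The spine covers the unflagged vertices. A flagged leg of length 0 is a trivial path, and its
    tooth lies on the spine. *)
Lemma comb_comb : comb combT.
Proof.
exists (mkseq spine m.+1), [seq legpath j | j <- enum fl]; split.
- split.
  + apply/allP=> s; rewrite inE => /orP[/eqP->|/mapP[j _ ->]]; rewrite /is_path.
      rewrite sorted_mkseq => [|k]; last by rewrite ltnS; apply: spine_adj.
      apply/andP; split=> //; rewrite andTb; apply/mkseq_uniqP=> k k'; rewrite !inE => km km' /legv_inj[]// + _.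
      by move/(congr1 val); rewrite /= !inordK.
    rewrite sorted_mkseq => [|k]; last by rewrite ltnS; apply: legv_adj.
    apply/andP; split=> //; rewrite andTb; apply/mkseq_uniqP=> k k'; rewrite !inE !ltnS => km km' E.
    by have [] := legv_inj km km' E.
  + move=> x; have [j [k [kj ->]]] := legvP x; apply/hasP.
    have [fj|/l_fl lj] := boolP (fl j).
      exists (legpath j); first by rewrite inE map_f ?orbT // mem_enum.
      by apply/mem_legpath; exists k.
    by exists (mkseq spine m.+1); rewrite ?mem_head // mem_spine //; move: kj; rewrite lj leqn0.
  + move=> x y; apply/idP/hasP=> [/comb_adjP[[j [k [kj H]]]|[k [km H]]]|[s]].
    * exists (legpath j); last by apply/consecutive_mkseq; exists k.
      rewrite inE map_f ?orbT // mem_enum; apply: contraT => /l_fl E.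
      by rewrite E in kj.
    * by exists (mkseq spine m.+1); rewrite ?mem_head //; apply/consecutive_mkseq; exists k.
    * rewrite inE => /orP[/eqP->|/mapP[j _ ->]] /consecutive_mkseq[k [km [[-> ->]|[-> ->]]]].
      - exact: spine_adj.
      - by rewrite -[adj _ _]/(comb_adj _ _) comb_sym; apply: spine_adj.
      - exact: legv_adj.
      - by rewrite -[adj _ _]/(comb_adj _ _) comb_sym; apply: legv_adj.
- apply/allP=> _ /mapP[j _ ->]; apply/allP=> x /mem_legpath[k kj ->].
  by rewrite mem_spine //= legv_eq // eqxx.
- rewrite pairwise_map; have := enum_uniq fl; rewrite uniq_pairwise.
  apply: sub_pairwise => j j' njj'; apply/hasP=> -[x /mem_legpath[k kj ->]] /mem_legpath[k' kj'].
  by case/legv_inj=> // E; case/eqP: njj'.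
- apply/setP=> x; rewrite inE; apply/imsetP/hasP=> [[j fj ->]|[_ /mapP[j fj ->]]].
    exists (legpath j); first by rewrite map_f // mem_enum.
    apply/andP; split; first by apply/mem_legpath; exists (l j).
    by rewrite last_mkseq.
  case/andP=> _ /eqP->; exists j; first by rewrite -mem_enum.
  by rewrite last_mkseq.
Qed.

Lemma comb_shaped : @shaped_by_comb (bidirected combG) (id @: combT).
Proof.
exists combG, combT; split; first exact: comb_comb.
by left; exists id => //; split=> //; exists id.
Qed.

Section Triangles.
Hypothesis fl_in : forall j, fl j -> 0 < j < m.
Variable sgn : bool.

(** Keeps the vertices off the spine from being junctions: inside a leg they are no teeth and have
    degree at most 2, and at its end the degree is at most 1. *)
Lemma degree_leg j k : 0 < k -> k <= l j -> @degree combG (legv l j k) <= (k < l j).+1.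
Proof.
move=> k0 kj; rewrite /degree.
have sub : [set y | comb_adj (legv l j k) y] \subset
    (if k < l j then [set legv l j k.-1; legv l j k.+1] else [set legv l j k.-1]).
  apply/subsetP=> y; rewrite inE; have [j' [k' [kj' ->]]] := legvP y.
  rewrite comb_adjE // (gtn_eqF k0) orbF => /andP[/eqP E]; subst j'.
  case/orP=> /eqP E; subst; last by rewrite ifT // !inE eqxx orbT.
  by case: ifP; rewrite !inE eqxx.
apply: leq_trans (subset_leq_card sub) _; case: ifP => _; last by rewrite cards1.
by rewrite cards2; case: (_ != _).
Qed.

Lemma degree_plain j : l j = 0 -> @degree combG (legv l j 0) <= 2.
Proof.
move=> lj; rewrite /degree.
have sub : [set y | comb_adj (legv l j 0) y] \subset [set spine j.-1; spine j.+1].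
  apply/subsetP=> y; rewrite inE; have [j' [k' [kj' ->]]] := legvP y.
  rewrite comb_adjE // => /orP[/andP[/eqP E]|/and3P[_ /eqP-> /orP[]/eqP E]].
  - by subst; move: kj'; rewrite lj leqn0 => /eqP->.
  - by rewrite !inE /spine E /= inord_val eqxx.
  - by rewrite !inE /spine -E inord_val eqxx orbT.
apply: leq_trans (subset_leq_card sub) _.
by rewrite cards2; case: (_ != _).
Qed.

(** By [fl_in] a flagged vertex is an inner vertex of the spine and has two neighbours there,
    besides the start of its leg if this has positive length. So the junctions are exactly the
    flagged spine vertices. *)
Lemma degree_flag j : fl j -> @degree combG (legv l j 0) = if l j is 0 then 2 else 3.
Proof.
move=> fj; have /andP[j0 jm] := fl_in fj; rewrite /degree.
have spn k : k <= m -> spine k = legv l (inord k) 0 by [].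
have ne : spine j.-1 != spine j.+1.
  apply/eqP=> /legv_inj[]// /(congr1 val) /=; rewrite !inordK; lia.
have sub : [set y | comb_adj (legv l j 0) y] =
    if l j is 0 then [set spine j.-1; spine j.+1] else legv l j 1 |: [set spine j.-1; spine j.+1].
  apply/setP=> y; rewrite inE; apply/idP/idP.
    have [j' [k' [kj' ->]]] := legvP y.
    rewrite comb_adjE // => /orP[/andP[/eqP E]|/and3P[_ /eqP-> /orP[]/eqP E]].
    - subst; rewrite /near; case/orP=> // /eqP E; subst.
      by case: (l j') kj' => // n _; rewrite !inE eqxx.
    - by case: (l j) => *; rewrite !inE /spine E /= inord_val eqxx ?orbT.
    - by case: (l j) => *; rewrite !inE /spine -E inord_val eqxx ?orbT.
  have a1 : comb_adj (legv l j 0) (spine j.-1).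
    by rewrite comb_adjE // inordK /near ?prednK ?eqxx ?orbT //; lia.
  have a2 : comb_adj (legv l j 0) (spine j.+1).
    by rewrite comb_adjE // inordK /near ?eqxx ?orbT //; lia.
  case lj : (l j) => [|n]; rewrite !inE.
    by case/orP=> /eqP->.
  case/or3P=> /eqP-> //; apply: legv_adj; by rewrite lj.
rewrite sub; case lj : (l j) => [|n]; first by rewrite cards2 ne.
rewrite cardsU1 cards2 ne !inE !legv_eq ?lj //.
by rewrite !andbF.
Qed.

Lemma legv_combT j k : k <= l j -> (legv l j k \in combT) = fl j && (k == l j).
Proof.
move=> kj; apply/imsetP/andP=> [[j' fj' /legv_inj[]// -> ->]|[fj /eqP->]]; last by exists j.
by rewrite eqxx.
Qed.

Lemma in_junctions j k : k <= l j -> (legv l j k \in junctions combT) = (k == 0) && fl j.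
Proof.
move=> kj; rewrite inE legv_combT //.
have [k0|k0] := posnP k; last first.
  apply/negbTE; rewrite negb_or; have := degree_leg k0 kj.
  case: ltngtP kj => // [lt|->] _; last by case: degree => [|[]] //=; rewrite andbF.
  by rewrite andbF /=; case: degree => [|[|[]]].
subst k; have [fj|fj] := boolP (fl j); rewrite /=.
  by rewrite degree_flag //; case: (l j).
by rewrite orbF; have := degree_plain (l_fl fj); case: degree => [|[|[]]].
Qed.

(** At a flagged [j], the corner [inl] carries the leg, or is the tooth itself if the leg has length
    0; [inr (j, true)] and [inr (j, false)] are the corners towards the previous and the next spine
    vertex. *)
Definition triangle_vertex := (legs l + ({j | fl j} * bool))%type.

Definition tri_p (a : triangle_vertex) : combG :=
  match a with inl x => x | inr (j, _) => legv l (val j) 0 end.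

(* At a flagged vertex of the spine, the vertex of the triangle at which the  *)
(* rest of the spine is attached carries the bool [tag y < tag x].            *)
Definition tri_att (x y : combG) : triangle_vertex :=
  if tagged x == 0 :> nat then
    if (insub (tag x) : option {j | fl j}) is Some j then
      if tag y == tag x then inl x else inr (j, tag y < tag x)
    else inl x
  else inl x.

(** The cyclic order next side, leg, previous side; [sgn] decides whether the triangles follow it or
    run against it. *)
Definition tri_idx (a : triangle_vertex) : nat :=
  match a with inl _ => 1 | inr (_, false) => 0 | inr (_, true) => 2 end.

Definition tri_arc : rel triangle_vertex := fun a b =>
  if tri_p a == tri_p b then
    if sgn then tri_idx b == (tri_idx a).+1 %% 3 else tri_idx a == (tri_idx b).+1 %% 3
  else [&& comb_adj (tri_p a) (tri_p b), a == tri_att (tri_p a) (tri_p b)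
         & b == tri_att (tri_p b) (tri_p a)].

Lemma tri_irr : irreflexive tri_arc.
Proof. by move=> [x|[j []]]; rewrite /tri_arc eqxx; case: sgn. Qed.

Definition triangles := Digraph tri_irr.

Lemma tri_attE j k j' k' (k0 : k <= l j) (fj : fl j) : tri_att (legv l j k) (legv l j' k') =
  if k == 0 then
    if j' == j then inl (legv l j k) else inr (Sub j fj : {j | fl j}, j' < j)
  else inl (legv l j k).
Proof.
rewrite /tri_att legv_tagged // !legv_tag; case: eqP => // _.
by rewrite (insubT (fun j => fl j) fj).
Qed.

Lemma tri_att_plain j k y : k <= l j -> (k == 0) && fl j = false -> tri_att (legv l j k) y = inl (legv l j k).
Proof.
move=> kj; rewrite /tri_att legv_tagged // legv_tag; case: eqP => //= _ fj.
by rewrite insubF.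
Qed.

Lemma tri_shaped : @shaped_by_comb triangles ((fun t => inl t : triangles) @: combT).
Proof.
exists combG, combT; split; first exact: comb_comb.
right; exists tri_p, tri_att, inl; split=> //; last first.
  move=> t y; have [j [k [kj ->]]] := legvP t; rewrite legv_combT // => /andP[fj /eqP E].
  subst k; have [l0 _|lj] := posnP (l j); last by have := degree_leg lj (leqnn _); rewrite ltnn => /[swap] ->.
  have [j' [k' [kj' ->]]] := legvP y.
  rewrite -[adj _ _]/(comb_adj _ _) comb_adjE // l0 => /orP[/andP[/eqP E]|].
    by subst; move: kj'; rewrite l0 leqn0 => /eqP->.
  case/and3P=> _ _ nj; rewrite (tri_attE _ _ _ fj) //=; case: (eqVneq j' j) => // E.
  by rewrite E near_irr in nj.
split.
- move=> x y _; have [j [k [kj ->]]] := legvP x; have [j' [k' [kj' ->]]] := legvP y.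
  have [/andP[/eqP-> fj]|/negbTE h] := boolP ((k == 0) && fl j).
    by rewrite (tri_attE _ _ _ fj) //=; case: ifP.
  by rewrite tri_att_plain.
- move=> x; have [j [k [kj ->]]] := legvP x; rewrite in_junctions // => h.
  rewrite /fiber (_ : [set _ | _] = [set inl (legv l j k)]) ?cards1 //.
  apply/setP=> -[y|[i b]]; rewrite !inE //=.
  apply/negbTE; apply: contra h => /eqP/legv_inj[]// <- <-.
  by rewrite eqxx (valP i).
- move=> x; have [j [k [kj ->]]] := legvP x; rewrite in_junctions // => /andP[/eqP k0 fj].
  subst k; pose J : {j | fl j} := Sub j fj.
  (* The corners in the direction of the cycle; [sgn] only exchanges the two corners on the
     spine. *)
  pose c (i : 'I_3) : triangles := nth (inl (legv l j 0)) [:: inr (J, ~~ sgn); inl (legv l j 0); inr (J, sgn)] i.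
  apply: (@induces_cycle_ord triangles 3 c).
  + by case=> [[|[|[|i]]] ? [[|[|[|i']]]]] ? //= E; apply: val_inj => //=; case: E; case: sgn.
  + apply/setP=> a; rewrite inE; apply/eqP/imsetP=> [|[i _ ->]]; last first.
      by case: i => [[|[|[|i]]]].
    case: a => [y /= ->|[i b] /= /legv_inj[]// E _]; first by exists (inord 1); rewrite ?inE // /c inordK.
    have -> : i = J by apply: val_inj.
    have [bs|bs] := eqVneq b sgn.
      by exists (inord 2); rewrite ?inE // /c inordK //= bs.
    exists (inord 0); rewrite ?inE // /c inordK //=; congr (inr (_, _)).
    by move: bs; case: b sgn => -[].
  + move=> i i'; rewrite /= /tri_arc.
    have pc (h : 'I_3) : tri_p (c h) = legv l j 0 by case: h => [[|[|[|h]]]].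
    rewrite !pc eqxx -val_eqE /= /c.
    by case: i i' => [[|[|[|i]]] ? [[|[|[|i']]]]] ? //; case: sgn.
- by move=> a b nab; rewrite /= /tri_arc (negPf nab).
move=> x y z; have [j [k [kj ->]]] := legvP x; rewrite in_junctions // => /andP[/eqP k0 fj].
subst k; have [j1 [k1 [kj1 ->]]] := legvP y; have [j2 [k2 [kj2 ->]]] := legvP z.
move=> a1 a2 nsc; apply: contra nsc; rewrite !(tri_attE _ _ _ fj) //= => E.
suff -> : legv l j1 k1 = legv l j2 k2.
  rewrite /same_strong_component_minus /= !connect0 !andbT andbb.
  by apply: contraTneq a2 => ->; rewrite -[adj _ _]/(comb_adj _ _) comb_irr.
move: a1 a2; rewrite -![adj _ _]/(comb_adj _ _) !comb_adjE //.
move: E; case: (eqVneq j1 j) => [->|n1]; case: (eqVneq j2 j) => [->|n2] // E.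
  rewrite !near_irr !andbF !orbF /=.
  by rewrite ?eqxx /near => /orP[]// /eqP-> /orP[]// /eqP->.
rewrite /= => /andP[/eqP-> h1] /andP[/eqP-> h2].
case/eqP: E => E; congr (legv _ _ _); apply: val_inj => /=.
move: h1 h2 E; rewrite /near; clear; case: j j1 j2 => [j ?] [j1 ?] [j2 ?] /=; lia.
Qed.

End Triangles.

End Comb.

(* A bead of a comb: a spine vertex or, if flagged and in the presence of     *)
(* triangles, a junction that is replaced by a triangle, with its leg.        *)
(* [pI true], [pO true] is the branch set towards the previous bead and       *)
(* [pI false], [pO false] the one towards the next bead.                      *)
Record bead (V : finType) := Bead {
  bB : {set V}; bA : {set V}; bI : {set V}; bO : {set V}; bu : V; bl : nat; bf : bool;
  pI : bool -> {set V}; pO : bool -> {set V} }.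

Section Beads.
Variables (V : finType) (e : rel V) (U : {set V}).
(* [None]: no triangles; [Some s]: triangles with orientation s. *)
Variable kind : option bool.

Definition single_bead (b : bead V) := forall x, pI b x = bI b /\ pO b x = bO b.

(** A directed triangle of branch sets: the first branch set of the leg and two further ones outside
    the region [bA] of the leg. The three arcs are those of [tri_arc] for [sgn = s]. *)
Definition triangle_bead (s : bool) (b : bead V) :=
  [/\ forall x, (exists r, bset e (pI b x) (pO b x) r) /\
        pI b x :|: pO b x \subset bB b :\: bA b,
      [disjoint pI b true :|: pO b true & pI b false :|: pO b false],
      arcs e (pO b (~~ s)) (bI b),
      arcs e (bO b) (pI b s)
    & arcs e (pO b s) (pI b (~~ s))].

Definition bead_ok (b : bead V) :=
  [/\ leg e (bA b) (bI b) (bO b) (bu b) (bl b), bA b \subset bB b,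
      (bf b -> bu b \in U) /\ (~~ bf b -> bl b = 0)
    & match kind with
      | Some s => if bf b then triangle_bead s b else single_bead b
      | None => single_bead b
      end].

Definition linked (b b' : bead V) :=
  arcs e (pO b false) (pI b' true) /\ arcs e (pO b' true) (pI b false).

Inductive beads : {set V} -> seq (bead V) -> Prop :=
| beads1 (A : {set V}) b : bead_ok b -> bB b \subset A -> beads A [:: b]
| beadsS (A A' : {set V}) b b' s : beads A (b' :: s) -> bead_ok b -> linked b b' ->
    [disjoint bB b & A] -> A \subset A' -> bB b \subset A' -> beads A' (b :: b' :: s).

Lemma beads_nth A s b0 : beads A s ->
  [/\ forall j, j < size s -> bead_ok (nth b0 s j) /\ bB (nth b0 s j) \subset A,
      forall i j, i < j -> j < size s -> [disjoint bB (nth b0 s i) & bB (nth b0 s j)]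
    & forall j, j.+1 < size s -> linked (nth b0 s j) (nth b0 s j.+1)].
Proof.
elim=> {A s} [A b ok sA|A A' b b' s bd [IH1 IH2 IH3] ok lk d sA sB]; split.
- by case.
- by case=> [|i] [|j].
- by case.
- by case=> [|j] // js; have [ok' s'] := IH1 j js; split=> //; apply: subset_trans s' sA.
- case=> [|i] [|j] // ij js; last exact: IH2.
  by apply: disjointWr (IH1 j js).2 d.
- by case=> [|j] // js; apply: IH3.
Qed.

End Beads.

Lemma flagged_enum n m (fl : pred 'I_m) (s : seq bool) : (forall j : 'I_m, fl j = nth false s j) ->
  size s = m -> n <= count id s -> exists f : 'I_n -> 'I_m, injective f /\ forall i, fl (f i).
Proof.
move=> fls sz ns.
have : n <= #|fl|.
  have Es : s = [seq fl j | j <- enum 'I_m].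
    apply: (@eq_from_nth _ false) => [|i]; first by rewrite size_map size_enum_ord.
    rewrite sz => im; rewrite (nth_map (Ordinal im)) ?size_enum_ord //.
    by rewrite (nth_ord_enum _ (Ordinal im)) fls.
  apply: leq_trans ns _; rewrite Es count_map -size_filter cardE.
  apply: uniq_leq_size => [|j]; first by rewrite filter_uniq // enum_uniq.
  by rewrite mem_filter mem_enum => /andP[fj _]; rewrite mem_enum; apply: fj.
move=> nf; exists (fun i => enum_val (widen_ord nf i)); split=> [i j /enum_val_inj /(congr1 val)|i].
  by move=> /= E; apply: val_inj.
exact: enum_valP.
Qed.

(** * Models of combs *)

Section CombModel.
Variables (D : digraph) (U : {set D}) (n : nat).
Let e := @arc D.

Section Common.
Variables (k : option bool) (s : seq (bead D)) (b0 : bead D) (A : {set D}).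
Hypothesis bds : beads e U k A (b0 :: s).
Let m := size s.
Let b (j : 'I_m.+1) := nth b0 (b0 :: s) j.

Lemma bead_legs : exists L : 'I_m.+1 -> nat -> {set D} * {set D} * D,
  forall j, legfun e (bA (b j)) (bI (b j)) (bO (b j)) (bu (b j)) (bl (b j)) (L j).
Proof.
apply: (fin_all_exists (P := fun j L => legfun e (bA (b j)) _ _ _ _ L)) => j.
have [ok _ _] := beads_nth b0 bds; have [[lg _ _ _] _] := ok j (ltn_ord j).
exact: leg_legfun lg.
Qed.

Lemma bead_okj j : bead_ok e U k (b j).
Proof. by have [ok _ _] := beads_nth b0 bds; have [] := ok j (ltn_ord j). Qed.

Lemma bead_disj i j : i != j -> [disjoint bB (b i) & bB (b j)].
Proof.
have [_ dis _] := beads_nth b0 bds; move=> ne.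
have [ij|ij|E] := ltngtP i j; first exact: dis.
  by rewrite disjoint_sym; apply: dis.
by case/eqP: ne; apply: val_inj.
Qed.

Lemma bead_linked (i j : 'I_m.+1) : j = i.+1 :> nat -> linked e (b i) (b j).
Proof.
have [_ _ lk] := beads_nth b0 bds; move=> ij; rewrite /b ij; apply: lk.
by rewrite -ij.
Qed.

Lemma bead_leg0 j : ~~ bf (b j) -> bl (b j) = 0.
Proof. by have [_ _ [_ +] _] := bead_okj j. Qed.

Lemma bead_legs_disj (L : 'I_m.+1 -> nat -> {set D} * {set D} * D) j j' i i' :
  (forall j, legfun e (bA (b j)) (bI (b j)) (bO (b j)) (bu (b j)) (bl (b j)) (L j)) ->
  i <= bl (b j) -> i' <= bl (b j') -> (j, i) != (j', i') ->
  [disjoint (L j i).1.1 :|: (L j i).1.2 & (L j' i').1.1 :|: (L j' i').1.2].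
Proof.
move=> Lf ij ij' ne; have [E|njj'] := eqVneq j j'; last first.
  have [_ _ Lb _ _] := Lf j; have [_ _ Lb' _ _] := Lf j'.
  have [_ s1 _ _] := bead_okj j; have [_ s2 _ _] := bead_okj j'.
  apply: disjointWl (Lb i ij).2 _; apply: disjointWr (Lb' i' ij').2 _.
  by apply: disjointWl s1 _; apply: disjointWr s2 _; apply: bead_disj.
subst j'; have [_ _ _ Ld _] := Lf j.
have [kk'|kk'|E] := ltngtP i i'; first exact: Ld.
  by rewrite disjoint_sym; apply: Ld.
by rewrite E eqxx in ne.
Qed.

End Common.

Lemma comb_model A s : beads e U None A s -> n <= count (@bf _) s -> unavoidable U n.
Proof.
case: s => [|b0 s] bds cnt; first by inversion bds.
have [L Lf] := bead_legs bds.
pose m := size s; pose b (j : 'I_m.+1) := nth b0 (b0 :: s) j.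
pose l (j : 'I_m.+1) := bl (b j); pose fl : pred 'I_m.+1 := fun j => bf (b j).
have l_fl j : ~~ fl j -> l j = 0 by apply: (bead_leg0 bds).
have [|||f [finj ffl]] := @flagged_enum n m.+1 fl [seq bf x | x <- b0 :: s].
- by move=> j; rewrite (nth_map b0).
- by rewrite size_map.
- by rewrite count_map (eq_count (a2 := @bf _)).
pose M (x : combG l) := L (tag x) (tagged x).
have MT j k : k <= l j -> M (legv l j k) = L j k by move=> kj; rewrite /M legv_tagged.
have sb j x : pI (b j) x = (L j 0).1.1 /\ pO (b j) x = (L j 0).1.2.
  by have [_ _ _ /(_ x)[-> ->]] := bead_okj bds j; have [-> _ _ _ _] := Lf j.
apply: (@unavoidable_model D U n (bidirected (combG l)) (fun x => (M x).1.1) (fun x => (M x).1.2)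
  (fun x => (M x).2) (id @: @combT m l fl) (fun i => legv l (f i) (l (f i)))).
- split.
  + move=> x; have [j [k [kj ->]]] := legvP x.
    by rewrite MT //; have [_ _ Lb _ _] := Lf j; case: (Lb k kj).
  + move=> x y; have [j [k [kj ->]]] := legvP x; have [j' [k' [kj' ->]]] := legvP y.
    move=> ne; rewrite !MT //; apply: (bead_legs_disj bds) => //.
    by apply: contraNneq ne => -[-> ->].
  + move=> x y; rewrite -[arc _ _]/(comb_adj _ _).
    have [j [k [kj ->]]] := legvP x; have [j' [k' [kj' ->]]] := legvP y.
    rewrite comb_adjE // !MT // => /orP[/andP[/eqP E]|/and3P[/eqP-> /eqP->]].
      subst j'; have [_ _ _ _ La] := Lf j.
      by case/orP=> /eqP E; subst; [have [] := La k'|have [] := La k].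
    case/orP=> /eqP E.
      by have [_] := bead_linked bds E; rewrite -/b (sb j' _).1 (sb j _).2.
    by have [+ _] := bead_linked bds E; rewrite -/b (sb j _).2 (sb j' _).1.
- right; exact: comb_shaped l_fl.
- by move=> i i' /legv_inj[]// /finj.
- by move=> i; rewrite imset_id; apply: imset_f; apply: ffl.
- move=> i; rewrite MT //; have [_ -> _ _ _] := Lf (f i).
  by have [_ _ [+ _] _] := bead_okj bds (f i); apply; apply: ffl.
Qed.

(** A flagged vertex at an end of the spine would not be a junction of the comb, so the first and
    the last bead are required to be unflagged; this yields [fl_in]. *)
Lemma triangle_model sgn A s b0 : beads e U (Some sgn) A (b0 :: s) -> ~~ bf b0 ->
  ~~ bf (last b0 s) -> n <= count (@bf _) (b0 :: s) -> unavoidable U n.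
Proof.
move=> bds bf0 bfl cnt.
have [L Lf] := bead_legs bds.
pose m := size s; pose b (j : 'I_m.+1) := nth b0 (b0 :: s) j.
pose l (j : 'I_m.+1) := bl (b j); pose fl : pred 'I_m.+1 := fun j => bf (b j).
have l_fl j : ~~ fl j -> l j = 0 by apply: (bead_leg0 bds).
have fl_in (j : 'I_m.+1) : fl j -> 0 < j < m.
  rewrite /fl /b => fj; apply/andP; split.
    by rewrite lt0n; apply: contraTneq fj => ->.
  rewrite ltn_neqAle -ltnS ltn_ord andbT; apply: contraTneq fj => ->.
  by rewrite -[m]/(size (b0 :: s)).-1 nth_last.
have [|||f [finj ffl]] := @flagged_enum n m.+1 fl [seq bf x | x <- b0 :: s].
- by move=> j; rewrite (nth_map b0).
- by rewrite size_map.
- by rewrite count_map (eq_count (a2 := @bf _)).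
have tb (j : {j | fl j}) : triangle_bead e sgn (b (val j)).
  by have [_ _ _] := bead_okj bds (val j); rewrite (valP j : bf (nth _ _ _)).
have [R Rb] : exists R : {j | fl j} * bool -> D,
    forall x, bset e (pI (b (val x.1)) x.2) (pO (b (val x.1)) x.2) (R x).
  apply: (fin_all_exists (P := fun x r => bset e (pI (b (val x.1)) x.2) (pO (b (val x.1)) x.2) r)).
  by move=> [j x]; have [/(_ x)[]] := tb j.
pose M (a : triangles l fl sgn) := match a with
  | inl x => L (tag x) (tagged x)
  | inr x => (pI (b (val x.1)) x.2, pO (b (val x.1)) x.2, R x) end.
have MT j k : k <= l j -> M (inl (legv l j k)) = L j k by move=> kj; rewrite /M legv_tagged.
have L0 j : (L j 0).1 = (bI (b j), bO (b j)) by have [-> _ _ _ _] := Lf j.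
have Matt j j' : j != j' -> (M (tri_att fl (legv l j 0) (legv l j' 0))).1 =
    (pI (b j) (j' < j), pO (b j) (j' < j)).
  move=> njj'; have [fj|fj] := boolP (fl j).
    by rewrite (tri_attE _ _ _ fj) //= eq_sym (negPf njj').
  rewrite tri_att_plain ?(negPf fj) // MT // L0.
  by have [_ _ _] := bead_okj bds j; rewrite (negPf fj : bf (nth _ _ _) = false) => /(_ (j' < j))[-> ->].
have legs_bA j k : k <= l j -> (L j k).1.1 :|: (L j k).1.2 \subset bA (b j).
  by move=> kj; have [_ _ Lb _ _] := Lf j; apply: (Lb k kj).2.
have legs_bB j k : k <= l j -> (L j k).1.1 :|: (L j k).1.2 \subset bB (b j).
  by move=> kj; apply: subset_trans (legs_bA j k kj) _; have [] := bead_okj bds j.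
have tri_bB (x : {j | fl j} * bool) : (M (inr x)).1.1 :|: (M (inr x)).1.2 \subset bB (b (val x.1)).
  have [/(_ x.2)[_ h] _ _ _ _] := tb x.1.
  by apply: subset_trans h _; apply: subsetDl.
have dis_mix j k x : k <= l j ->
    [disjoint (L j k).1.1 :|: (L j k).1.2 & (M (inr x)).1.1 :|: (M (inr x)).1.2].
  move=> kj; have [E|ne] := eqVneq j (val x.1); last first.
    apply: disjointWl (legs_bB j k kj) _; apply: disjointWr (tri_bB x) _.
    exact: (bead_disj bds).
  apply: disjointWl (legs_bA j k kj) _; have [/(_ x.2)[_ h] _ _ _ _] := tb x.1.
  by apply: disjointWr h _; rewrite E; apply: disjI => z zA /setDP[_ /negP[]].
apply: (@unavoidable_model D U n (triangles l fl sgn) (fun x => (M x).1.1) (fun x => (M x).1.2)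
  (fun x => (M x).2) ((fun t => inl t : triangles l fl sgn) @: @combT m l fl)
  (fun i => inl (legv l (f i) (l (f i))))).
- split.
  + move=> [x|x]; last exact: Rb.
    have [j [k [kj ->]]] := legvP x.
    by rewrite MT //; have [_ _ Lb _ _] := Lf j; case: (Lb k kj).
  + move=> [x|x] [y|y] ne.
    * have [j [k [kj ex]]] := legvP x; have [j' [k' [kj' ey]]] := legvP y.
      rewrite ex ey !MT //; apply: (bead_legs_disj bds) => //.
      by apply: contraNneq ne => -[E1 E2]; rewrite ex ey E1 E2.
    * by have [j [k [kj ->]]] := legvP x; rewrite MT //; apply: dis_mix.
    * by have [j [k [kj ->]]] := legvP y; rewrite MT // disjoint_sym; apply: dis_mix.
    * have [E|njj'] := eqVneq (val x.1) (val y.1); last first.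
        apply: disjointWl (tri_bB x) _; apply: disjointWr (tri_bB y) _.
        exact: (bead_disj bds).
      have {}E : x.1 = y.1 by apply: val_inj.
      have xy : x.2 != y.2.
        apply: contra ne => /eqP E2; case: x y E E2 => [x1 x2] [y1 y2] /= -> ->.
        exact: eqxx.
      rewrite /M /= E; have [_ d _ _ _] := tb y.1.
      by case: x.2 y.2 xy => -[] // _; rewrite disjoint_sym.
  + move=> a c; rewrite /= /tri_arc; case: eqP => [pac|_].
      case: a c pac => [x|[j x]] [y|[j' y]] /=.
      - by case: (sgn).
      - move=> ->; have [_ _ _ t2 _] := tb j'; rewrite legv_tagged // -[L _ 0]/(L (val j') 0) L0 => xy.
        by have -> : y = sgn by move: xy; case: (y); case: (sgn).
      - move=> <-; have [_ _ t1 _ _] := tb j; rewrite legv_tagged // -[L _ 0]/(L (val j) 0) L0 => xy.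
        by have -> : x = ~~ sgn by move: xy; case: (x); case: (sgn).
      - case/legv_inj=> // /val_inj <- _; have [_ _ _ _ t3] := tb j => xy.
        have -> : x = sgn by move: xy; case: (x); case: (y); case: (sgn).
        by have -> : y = ~~ sgn by move: xy; case: (x); case: (y); case: (sgn).
    case/and3P=> adj /eqP ea /eqP ec; rewrite (congr1 M ea) (congr1 M ec); move: adj.
    have [j [k [kj ->]]] := legvP (tri_p a); have [j' [k' [kj' ->]]] := legvP (tri_p c).
    rewrite comb_adjE // => /orP[/andP[/eqP E]|/and3P[/eqP-> /eqP->]].
      subst j'; have [_ _ _ _ La] := Lf j.
      have MA i i' : i <= l j -> M (tri_att fl (legv l j i) (legv l j i')) = L j i.
        move=> ij; have [fj|fj] := boolP (fl j).
          by rewrite (tri_attE _ _ _ fj) // eqxx if_same MT.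
        by rewrite tri_att_plain ?MT // (negPf fj) andbF.
      rewrite !MA //.
      by case/orP=> /eqP E; subst; [have [] := La k'|have [] := La k].
    move=> nj; have njj' : j != j' by apply: contraTneq nj => ->; rewrite near_irr.
    rewrite Matt // Matt 1?eq_sym //=.
    case/orP: nj => /eqP E.
      have -> : j' < j by rewrite E.
      have -> : j < j' = false by rewrite E ltnNge leqnSn.
      by have [] := bead_linked bds E.
    have -> : j < j' by rewrite E.
    have -> : j' < j = false by rewrite E ltnNge leqnSn.
    by have [] := bead_linked bds E.
- right; exact: tri_shaped l_fl fl_in sgn.
- by move=> i i' /(congr1 (fun x : triangles l fl sgn => if x is inl y then tag y else f i)) /finj.
- by move=> i; apply: imset_f; apply: imset_f; apply: ffl.
- move=> i; rewrite MT //; have [_ -> _ _ _] := Lf (f i).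
  by have [_ _ [+ _] _] := bead_okj bds (f i); apply; apply: ffl.
Qed.

End CombModel.

(** * Closed routes *)

Section Reach.
Variables (V : finType).
Implicit Types (e : rel V) (X : {set V}) (a z : V).

Lemma conn_reach e X a z : conn e X a z -> conn e [set w in X | conn e X a w] a z.
Proof.
move=> c; have aX := conn_inl c.
have aR : a \in [set w in X | conn e X a w] by rewrite inE aX conn_refl.
apply: (@conn_ind _ e X (fun w => conn e [set w in X | conn e X a w] a w) a z c).
  exact: conn_refl.
move=> v w vX wX vw cv; apply: (conn_trans cv); apply: conn1 => //.
  exact: conn_inr cv.
have := conn_inr cv; rewrite !inE wX => /andP[_ av] /=.
by apply: conn_trans av _; apply: conn1.
Qed.

Lemma conn_coreach e X a z : conn e X z a -> conn e [set w in X | conn e X w a] z a.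
Proof.
have := conn_reach (e := revr e) (X := X) (a := a) (z := z); rewrite 2!(conn_rev e) => H /H{H}.
by apply: conn_mono; apply/subsetP=> w; rewrite !inE (conn_rev e).
Qed.

End Reach.

Section Routes.
Variables (V : finType) (e : rel V) (U : {set V}).
Implicit Types (A I O L : {set V}) (a c x y u : V).

(* [rt A a c n0 n1]: a route inside A from a that passes through n0 branch    *)
(* sets rooted in U and through n1 branch sets with a leg to U, and whose     *)
(* last arc enters c.                                                         *)
Inductive rt : {set V} -> V -> V -> nat -> nat -> Prop :=
| rt_nil A c : rt A c c 0 0
| rt_pre A A' x a c n0 n1 : rt A a c n0 n1 -> e x a -> x \notin A ->
    x |: A \subset A' -> rt A' x c n0 n1
| rt_leg A A' L I O u l x y a c n0 n1 : rt A a c n0 n1 -> leg e L I O u l -> u \in U ->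
    x \in I -> y \in O -> e y a -> [disjoint L & A] -> L :|: A \subset A' ->
    rt A' x c (n0 + (l == 0)) (n1 + (l != 0)).

Lemma rt_sub A A' a c n0 n1 : A \subset A' -> rt A a c n0 n1 -> rt A' a c n0 n1.
Proof.
move=> s r; case: r s => {A a c n0 n1} [A c|A B x a c n0 n1 r xa xA s|
  A B L I O u l x y a c n0 n1 r lg uU xI yO ya d s] s'.
- exact: rt_nil.
- exact: rt_pre r xa xA (subset_trans s s').
- exact: rt_leg r lg uU xI yO ya d (subset_trans s s').
Qed.

Lemma rt_path A A' x q a c n0 n1 : rt A a c n0 n1 -> link e x q a -> uniq (x :: q) ->
  {in x :: q, forall z, z \notin A} -> [set z in x :: q] :|: A \subset A' ->
  rt A' x c n0 n1.
Proof.
elim: q x A' => [|z q IH] x A' r /=.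
  rewrite /link /= andbT => xa _ qA s; apply: rt_pre r xa _ _; first by rewrite qA ?mem_head.
  by apply: subset_trans s; apply/subsetP=> w; rewrite !inE.
rewrite /link /= => /andP[xz lk] /andP[xq un] qA s.
have qA' : {in z :: q, forall w, w \notin A} by move=> w wq; apply: qA; rewrite inE wq orbT.
have r' := IH z _ r lk un qA' (subxx _).
apply: rt_pre r' xz _ _.
  by rewrite in_setU inE negb_or xq qA ?mem_head.
by apply: subset_trans s; apply/subsetP=> w; rewrite !inE => /or3P[->|->|->]; rewrite ?orbT.
Qed.

Variable f : bool.

(** [f] selects the teeth that are kept: those on the route itself, where the leg has length 0, or
    those at the end of a leg of positive length. *)
Definition rbead_ok (b : bead V) :=
  [/\ leg e (bA b) (bI b) (bO b) (bu b) (bl b), bu b \in U & (bl b == 0) = f].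

Inductive rbeads : {set V} -> seq (bead V) -> V -> Prop :=
| rbeads1 A b y c : rbead_ok b -> bA b \subset A -> y \in bO b -> e y c -> rbeads A [:: b] c
| rbeadsS A A' b b' s c : rbeads A (b' :: s) c -> rbead_ok b -> arcs e (bO b) (bI b') ->
    [disjoint bA b & A] -> A \subset A' -> bA b \subset A' -> rbeads A' (b :: b' :: s) c.

Definition ext_bead (J : {set V}) (b : bead V) :=
  Bead (bB b) (J :|: bA b) (J :|: bI b) (bO b) (bu b) (bl b) (bf b) (pI b) (pO b).

Lemma rbeads_ext A b s c (J : {set V}) : rbeads A (b :: s) c -> [disjoint J & A] ->
  {in J, forall z, exists2 y, y \in bI b & conn e (J :|: bI b) z y} ->
  rbeads (J :|: A) (ext_bead J b :: s) c.
Proof.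
move=> r dJ cJ; inversion r as [A0 b0 y c0 [lg uU lf] sA yO yc|A0 A' b0 b' s' c0 r' [lg uU lf] ar d sA sA']; subst.
  apply: (@rbeads1 _ _ y) => //=; last exact: setUS.
  by split=> //=; apply: leg_extI lg _ cJ; apply: disjointWr dJ.
apply: (@rbeadsS A0) => //=.
- by split=> //=; apply: leg_extI lg _ cJ; apply: disjointWr dJ.
- rewrite -setI_eq0 setIUl setU_eq0 !setI_eq0 d andbT.
  exact: disjointWr dJ.
- exact: subset_trans sA (subsetUr _ _).
- exact: setUS.
Qed.

Definition route_state A a c n :=
  exists s : seq (bead V), size s = n /\
  match s with
  | [::] => a = c \/ exists2 y, conn e A a y & e y c
  | b :: s' => rbeads A s c /\ a \in bI b
  end.

(** The selected legs become beads and everything else is absorbed: what precedes a bead joins its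
    in-tree, what follows the last bead joins its out-tree. As long as there is no bead, only a walk
    from [a] to an in-neighbour of [c] is recorded. *)
Lemma rt_state A a c n0 n1 : rt A a c n0 n1 -> route_state A a c (if f then n0 else n1).
Proof.
elim=> {A a c n0 n1} [A c|A A' x a c n0 n1 _ [[|b s] [sz st]] xa xA sA|
  A A' L I O u l x y a c n0 n1 _ [s [sz st]] lg uU xI yO ya d sA].
- by exists [::]; split; [case: f|left].
- exists [::]; split=> //; right; have xA' : x \in A' by apply: (subsetP sA); rewrite setU11.
  case: st => [<-|[y ay yc]]; first by exists x => //; apply: conn_refl.
  exists y => //; apply: (@conn_trans _ _ _ a).
    by apply: conn1 => //; apply: (subsetP sA); rewrite in_setU1 (conn_inl ay) orbT.
  by apply: conn_mono ay; apply: subset_trans sA; apply: subsetUr.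
- case: st => st aI; exists (ext_bead [set x] b :: s); split=> //; split; last by rewrite /= setU11.
  have : rbeads ([set x] :|: A) (ext_bead [set x] b :: s) c.
    apply: rbeads_ext => //; first by rewrite disjoints1.
    move=> z /set1P->; exists a => //; apply: conn1 => //; first by rewrite setU11.
    by rewrite in_setU aI orbT.
  move=> r; clear -r sA; inversion r as [A0 b0 y c0 ok s0 yO yc|A0 A'' b0 b' s' c0 r' ok ar d s1 s2]; subst.
    by apply: rbeads1 ok _ yO yc; apply: subset_trans s0 sA.
  apply: rbeadsS r' ok ar d _ _; first exact: subset_trans s1 sA.
  exact: subset_trans s2 sA.
have LA' : L \subset A' by apply: subset_trans sA; apply: subsetUl.
have AA' : A \subset A' by apply: subset_trans sA; apply: subsetUr.
have [[r bs] sIOL] := leg_bset lg.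
have xL : x \in L by apply: (subsetP sIOL); rewrite in_setU xI.
have yL : y \in L by apply: (subsetP sIOL); rewrite in_setU yO orbT.
have cxy : conn e L x y := leg_conn lg xI yO.
have [fl|nfl] := eqVneq (l == 0) f; last first.
  have -> : (if f then n0 + (l == 0) else n1 + (l != 0)) = (if f then n0 else n1).
    by move: nfl; case: f; case: (l == 0); rewrite ?addn0.
  case: s sz st => [|b s] sz st.
    exists [::]; split=> //; right.
    case: st => [<-|[w aw wc]]; first by exists y => //; apply: conn_mono cxy.
    exists w => //; apply: conn_trans (conn_mono LA' cxy) _.
    apply: conn_trans (conn_mono AA' aw); apply: conn1 => //; first exact: (subsetP LA').
    by apply: (subsetP AA'); apply: conn_inl aw.
  (* A leg of the other kind serves only as a walk from [x] to [y]: its vertices that reach [y] join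
     the in-tree of the next bead. *)
  case: st => st aI; pose J := [set w in L | conn e L w y].
  have JL : J \subset L by apply/subsetP=> w; rewrite inE => /andP[].
  exists (ext_bead J b :: s); split=> //; split; last by rewrite /= in_setU inE xL cxy.
  have : rbeads (J :|: A) (ext_bead J b :: s) c.
    apply: rbeads_ext => //; first exact: disjointWl JL d.
    move=> z; rewrite inE => /andP[zL zy]; exists a => //.
    apply: (@conn_trans _ _ _ y).
      by apply: conn_mono (conn_coreach zy); apply: subsetUl.
    by apply: conn1 => //; rewrite in_setU ?aI ?orbT // inE yL conn_refl.
  have sJ : J :|: A \subset A' by rewrite subUset AA' (subset_trans JL LA').
  move=> r'; clear -r' sJ; inversion r' as [A0 b0 y' c0 ok s0 yO yc|A0 A'' b0 b' s' c0 r0 ok ar d s1 s2]; subst.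
    by apply: rbeads1 ok _ yO yc; apply: subset_trans s0 sJ.
  apply: rbeadsS r0 ok ar d _ _; first exact: subset_trans s1 sJ.
  exact: subset_trans s2 sJ.
have -> : (if f then n0 + (l == 0) else n1 + (l != 0)) = (if f then n0 else n1).+1.
  by rewrite fl; case: f; rewrite addn1.
case: s sz st => [|b s] sz st.
  rewrite -sz.
  case: st => [ac|[w aw wc]].
    exists [:: Bead L L I O u l true (fun=> I) (fun=> O)]; split=> //; split=> //.
    by subst c; apply: (@rbeads1 _ _ y).
  (* This leg is the last bead, so its out-tree takes up all that [a] reaches, including the vertex
     with an arc to [c]. *)
  pose J := [set v in A | conn e A a v].
  have JA : J \subset A by apply/subsetP=> v; rewrite inE => /andP[].
  have dJ : [disjoint J & L] by rewrite disjoint_sym; apply: disjointWr d.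
  have aJ : a \in J by rewrite inE (conn_inl aw) conn_refl // (conn_inl aw).
  have lg' : leg e (J :|: L) I (J :|: O) u l.
    apply: leg_extO lg dJ _ => z zJ; exists y => //.
    apply: (@conn_trans _ _ _ a); first by apply: conn1; rewrite // in_setU ?yO ?aJ ?orbT.
    have := zJ; rewrite inE => /andP[_ /conn_reach]; apply: conn_mono; exact: subsetUl.
  exists [:: Bead L (J :|: L) I (J :|: O) u l true (fun=> I) (fun=> O)]; split=> //; split=> //.
  apply: (@rbeads1 _ _ w) => //=.
    by rewrite subUset LA' (subset_trans JA AA').
  by rewrite in_setU inE (conn_inr aw) aw.
exists [:: Bead L L I O u l true (fun=> I) (fun=> O), b & s]; split; first by rewrite -sz.
case: st => st aI; split=> //; apply: (rbeadsS st) => //=.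
by exists y, a.
Qed.

Lemma rbeads_nth A s c b0 : rbeads A s c ->
  [/\ forall j, j < size s -> rbead_ok (nth b0 s j) /\ bA (nth b0 s j) \subset A,
      forall i j, i < j -> j < size s -> [disjoint bA (nth b0 s i) & bA (nth b0 s j)],
      forall j, j.+1 < size s -> arcs e (bO (nth b0 s j)) (bI (nth b0 s j.+1))
    & exists2 y, y \in bO (nth b0 s (size s).-1) & e y c].
Proof.
elim=> {A s c} [A b y c ok sA yO yc|A A' b b' s c bd [IH1 IH2 IH3 IH4] ok lk d sA sB]; split.
- by case.
- by case=> [|i] [|j].
- by case.
- by exists y.
- by case=> [|j] // js; have [ok' s'] := IH1 j js; split=> //; apply: subset_trans s' sA.
- case=> [|i] [|j] // ij js; last exact: IH2.
  by apply: disjointWr (IH1 j js).2 d.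
- by case=> [|j] // js; apply: IH3.
- exact: IH4.
Qed.

End Routes.

Lemma unavoidable_leq (D : digraph) (U : {set D}) m n : m <= n -> unavoidable U n -> unavoidable U m.
Proof.
by move=> mn [H [t [T [? ? nT]]]]; exists H, t, T; split=> //; apply: leq_trans nT.
Qed.

(** At least [n] of the branch sets are of one kind. The walk from [c] back to [a] is absorbed into
    the in-tree of the first bead, so the beads close up cyclically: a directed cycle if the teeth
    are on the route, and otherwise a star whose centre is a directed cycle. *)
Theorem closed_route (D : digraph) (U : {set D}) n A a c n0 n1 :
  rt (@arc D) U A a c n0 n1 -> a \in A -> conn (@arc D) (a |: ~: A) c a -> n.*2 <= n0 + n1 ->
  2 < n -> unavoidable U n.
Proof.
move=> r aA cl nn n3; pose f := n <= n0.
have nf : n <= (if f then n0 else n1).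
  by rewrite /f; case: ifP => //; move: nn; rewrite -addnn; lia.
move: (rt_state f r); set N := (if f then n0 else n1) in nf * => -[[|b s] [sz]].
  by move: nf; rewrite -sz leqn0; case: (n) n3.
case=> rb aI; apply: (unavoidable_leq nf).
pose J := [set z in ~: A | conn (@arc D) (a |: ~: A) z a].
have dJ : [disjoint J & A] by apply: disjI => z; rewrite !inE => /andP[/negP].
have cJ : {in J, forall z, exists2 y, y \in bI b & conn (@arc D) (J :|: bI b) z y}.
  move=> z; rewrite inE => /andP[_ /conn_coreach za]; exists a => //.
  apply: conn_mono za; apply/subsetP=> w; rewrite !inE => /andP[/orP[/eqP->|->] ->].
    by rewrite aI orbT.
  by [].
have := rbeads_ext rb dJ cJ; set b1 := ext_bead J b => rb1.
have [ok dis ar [y yO yc]] := rbeads_nth b1 rb1.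
have cI : c \in J :|: bI b.
  have := conn_inl cl; rewrite !inE => /orP[/eqP->|cA]; first by rewrite aI orbT.
  by rewrite cA cl.
have sz' : size (b1 :: s) = N by rewrite -sz.
have n3' : 2 < N by apply: leq_trans nf.
pose g (j : 'I_N) := nth b1 (b1 :: s) j.
have gj (j : 'I_N) : j < size (b1 :: s) by rewrite sz'.
have lg j : leg (@arc D) (bA (g j)) (bI (g j)) (bO (g j)) (bu (g j)) (bl (g j)).
  by have [[]] := ok j (gj j).
have uU j : bu (g j) \in U by have [[]] := ok j (gj j).
have fj j : (bl (g j) == 0) = f by have [[]] := ok j (gj j).
have dA j j' : j != j' -> [disjoint bA (g j) & bA (g j')].
  move=> ne; have [lt|lt|E] := ltngtP j j'; first exact: dis.
    by rewrite disjoint_sym; apply: dis.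
  by case/eqP: ne; apply: val_inj.
have arS j : arcs (@arc D) (bO (g j)) (bI (g (ordS j))).
  rewrite /g /=; have := gj j; rewrite sz'; case: (ltngtP j.+1 N) => [lt _|//|E _].
    by rewrite modn_small //; apply: ar; rewrite sz'.
  rewrite E modnn; exists y, c; split=> //.
  have Ej : (size (b1 :: s)).-1 = j by rewrite sz'; clear -E; lia.
  by rewrite -Ej.
have [ft|ft] := boolP f.
  by apply: cycle_model lg uU dA arS _ _ => [|j]; [lia|apply/eqP; rewrite fj].
by apply: ring_model lg uU dA arS _ _ => // j; rewrite lt0n fj.
Qed.

(** Set aside the elements of [R] without a predecessor in [R]. If there are fewer than [k] of them,
    induction applies to the rest, and a sequence found there starts at an element that has a
    predecessor to prepend. *)
Lemma mirsky (T : finType) (lt : rel T) (R : {set T}) N k : 0 < k -> N * k <= #|R| ->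
  (exists s, [/\ size s = N, sorted lt s & {subset s <= R}]) \/
  (exists A : {set T}, [/\ A \subset R, k <= #|A| & {in A &, forall x y, ~~ lt x y}]).
Proof.
move=> k0; elim: N R => [|N IH] R NR; first by left; exists [::].
pose M := [set x in R | [forall y in R, ~~ lt y x]].
have [kM|Mk] := leqP k #|M|.
  right; exists M; split=> //; first by apply/subsetP=> x; rewrite inE => /andP[].
  by move=> x y; rewrite !inE => /andP[xR _] /andP[_ /forall_inP]; apply.
have MR : M \subset R by apply/subsetP=> x; rewrite inE => /andP[].
have [|[s [sz ss sR]]|[A [AR kA An]]] := IH (R :\: M).
- rewrite cardsD (setIidPr MR); move: NR; rewrite mulSn; lia.
- left; case: s sz ss sR => [|z s] sz ss sR.
    have /card_gt0P[x xR] : 0 < #|R| by apply: leq_trans NR; rewrite mulSn addn_gt0 k0.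
    by exists [:: x]; split; rewrite -?sz // => y; rewrite inE => /eqP->.
  have := sR z (mem_head _ _); rewrite inE => /andP[zM zR].
  have [y yR yz] : exists2 y, y \in R & lt y z.
    move: zM; rewrite inE zR /= negb_forall => /existsP[y].
    by rewrite negb_imply negbK => /andP[yR yz]; exists y.
  exists [:: y, z & s]; split; rewrite /= ?yz -?sz //.
  by move=> w; rewrite inE => /orP[/eqP->//|/sR]; rewrite inE => /andP[].
by right; exists A; split=> //; apply: subset_trans AR (subsetDl _ _).
Qed.

Lemma star_set (D : digraph) (U R I0 O0 : {set D}) (r : D) (K : D -> {set D}) n :
  n <= #|R| -> R \subset U -> bset (@arc D) I0 O0 r ->
  {in R, forall u, [disjoint I0 :|: O0 & K u] /\ exists I O l,
     [/\ leg (@arc D) (K u) I O u l, arcs (@arc D) O0 I & arcs (@arc D) O I0]} ->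
  {in R &, forall u v, u != v -> [disjoint K u & K v]} -> unavoidable U n.
Proof.
move=> nR RU b0 lg dK.
pose w (j : 'I_n) : D := enum_val (widen_ord nR j).
have wR j : w j \in R by apply: enum_valP.
have winj : injective w by move=> i j /enum_val_inj/(congr1 val) /= E; apply: val_inj.
have [F HF] : exists F : 'I_n -> {set D} * {set D} * nat, forall j,
    [/\ leg (@arc D) (K (w j)) (F j).1.1 (F j).1.2 (w j) (F j).2,
        arcs (@arc D) O0 (F j).1.1 & arcs (@arc D) (F j).1.2 I0].
  apply: (fin_all_exists (P := fun j F => [/\ leg (@arc D) (K (w j)) F.1.1 F.1.2 (w j) F.2,
        arcs (@arc D) O0 F.1.1 & arcs (@arc D) F.1.2 I0])) => j.
  by have [_ [I [O [l ?]]]] := lg _ (wR j); exists (I, O, l).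
apply: (@star_model D U n (K \o w) (fun j => (F j).1.1) (fun j => (F j).1.2) w (fun j => (F j).2)
  _ _ _ I0 O0 r b0) => [j|j|j j' ne|j|j|j].
- by have [] := HF j.
- by apply: (subsetP RU); apply: wR.
- by apply: dK; rewrite ?wR // (inj_eq winj).
- by have [] := lg _ (wR j).
- by have [] := HF j.
- by have [] := HF j.
Qed.

Section RouteTools.
Variables (V : finType) (e : rel V) (U : {set V}).

Lemma link_rt A a c p q n0 n1 : rt e U A a c n0 n1 -> link e p q a ->
  {in q, forall z, z \notin A} ->
  exists2 x, e p x & rt e U ([set z in q] :|: A) x c n0 n1.
Proof.
move=> r; case: q => [|z q]; first by rewrite /link /= andbT => pa _; exists a => //;
  apply: rt_sub r; apply: subsetUr.
rewrite /link /= rcons_path => /and3P[pz pth la] qA; exists z => //.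
move: la; have [q' pth' un' sub'] := shortenP pth => la.
have lk' : link e z q' a by rewrite /link rcons_path pth'.
apply: (rt_path r lk' un').
  by move=> w wq; apply: qA; move: wq; rewrite !inE => /orP[->//|/sub' ->]; rewrite orbT.
apply: setSU; apply/subsetP=> w; rewrite !inE => /orP[->//|/sub' ->].
by rewrite orbT.
Qed.

End RouteTools.

(** * Many strong components off a path *)

Lemma maxn_lt_minn p q p' q' : maxn p q < minn p' q' -> p < p' /\ q < q'.
Proof. by lia. Qed.

Lemma minn_le_maxn p q : minn p q <= maxn p q.
Proof. by lia. Qed.

(** For [p < q], the path between positions [p] and [q] uses at least one of the two steps at
    [x]. *)
Lemma straddle p q x : minn p q <= x <= maxn p q ->
  [|| q <= p, p <= x < q | p <= x.-1 < q].
Proof. by lia. Qed.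

Section Extrema.
Variables (Q : pred nat) (m : nat).

Definition minidx := find Q (iota 0 m.+1).

Lemma minidxP i : i <= m -> Q i -> Q minidx /\ minidx <= i.
Proof.
move=> im Qi; have iin : i \in iota 0 m.+1 by rewrite mem_iota.
have h : has Q (iota 0 m.+1) by apply/hasP; exists i.
have lt : minidx < m.+1 by move: h; rewrite has_find size_iota.
split; first by have := nth_find 0 h; rewrite nth_iota.
rewrite leqNgt; apply/negP=> lti; have := before_find 0 lti.
by rewrite nth_iota ?Qi // ltnS.
Qed.

End Extrema.

Definition maxidx Q m := m - minidx (fun i => Q (m - i)) m.

Lemma maxidxP (Q : pred nat) m i : i <= m -> Q i -> Q (maxidx Q m) /\ i <= maxidx Q m.
Proof.
move=> im Qi; have [||Qm le] := @minidxP (fun i => Q (m - i)) m (m - i).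
- exact: leq_subr.
- by rewrite subKn.
by split=> //; rewrite /maxidx; move: le im; lia.
Qed.

Section RouteConn.
Variables (V : finType) (e : rel V) (U : {set V}).

Lemma rt_conn A B a c x y n0 n1 : rt e U A a c n0 n1 -> conn e B x y -> e y a ->
  [disjoint B & A] -> rt e U (B :|: A) x c n0 n1.
Proof.
move=> r cB ya d; have [p [pp lp up sp]] := connP cB.
have lk : link e x p a by rewrite /link rcons_path pp lp.
apply: (rt_path r lk up).
  by move=> z /sp zB; apply/negP=> zA; apply: disjE d zB zA.
by apply: setSU; apply/subsetP=> z; rewrite inE => /sp.
Qed.

(** A link from [p] to [u] has its interior in [X], and each interior vertex is reached from [p] and
    reaches [u] without passing through [p] again. *)
Lemma conn_via (X : {set V}) p u : p \notin X -> u \in p |: X -> conn e (p |: X) p u ->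
  conn e (p |: [set z in X | conn e (p |: X) p z && conn e X z u]) p u.
Proof.
move=> pX; rewrite in_setU1 => /orP[/eqP-> _|uX c].
  by apply: conn_refl; rewrite setU11.
have d : [disjoint [set p] & [set u]].
  by rewrite disjoints1 in_set1; apply: contraNneq pX => ->.
have [x [q [y [/setIP[/set1P-> _] /setIP[/set1P-> _] lk qX]]]] :=
  link_exists (set11 p) (set11 u) c d.
have sub : {subset q <= X}.
  by move=> z /qX[+ + _]; rewrite in_setU1 in_set1 => /orP[->|].
have sub' : {subset q <= p |: X} by move=> z /sub zX; rewrite in_setU1 zX orbT.
set Y := p |: _; have uY : u \in Y by rewrite in_setU1 inE uX c conn_refl ?orbT.
have qY : {subset q <= Y}.
  move=> z zq; rewrite in_setU1 inE sub //=.
  have [/(_ (setU11 _ _)) -> _] := link_conn lk sub' zq.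
  by have [_ ->] := link_conn lk sub zq; rewrite ?orbT.
have [z zq pz] := link_first lk.
apply: (@conn_trans _ _ _ z); last first.
  move: zq; rewrite mem_rcons inE => /orP[/eqP->|zq]; first exact: conn_refl.
  by have [_ ->] := link_conn lk qY zq.
apply: conn1 => //; first exact: setU11.
by move: zq; rewrite mem_rcons inE => /orP[/eqP->|/qY].
Qed.

End RouteConn.

Lemma conn_via_rev (V : finType) (e : rel V) (X : {set V}) p u : p \notin X -> u \in p |: X -> conn e (p |: X) u p ->
  conn e (p |: [set z in X | conn e (p |: X) z p && conn e X u z]) u p.
Proof.
move=> pX uX; have := conn_via (e := revr e) pX uX; rewrite (conn_rev e) => H /H.
rewrite (conn_rev e); congr (is_true (conn _ (_ |: _) _ _)).
by apply/setP=> z; rewrite !inE !(conn_rev e).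
Qed.

Section Wide.
Variables (D : digraph) (U : {set D}) (n : nat).
Hypothesis n3 : 2 < n.
Local Notation e := (@arc D).
Local Notation conn := (conn (@arc D)).
Variables (S : {set D}) (a : D) (s : seq D).
Let P := [set z in a :: s].
Let X := S :\: P.
Hypothesis stS : strong e S.
Hypothesis pth : path e a s.
Hypothesis un : uniq (a :: s).
Hypothesis PS : P \subset S.
Hypothesis ret : last a s = a \/ exists2 c, e (last a s) c & conn (a |: ~: S) c a.
Local Notation idx z := (index z (a :: s)).
Local Notation pt i := (nth a (a :: s) i).

Lemma inP z : (z \in P) = (z \in a :: s). Proof. by rewrite inE. Qed.

Lemma segP i j : seg a s i j \subset P.
Proof. by apply/subsetP=> z; rewrite in_seg inP => /andP[]. Qed.

Lemma PX z : z \in P -> z \notin X. Proof. by move=> zP; rewrite in_setD zP. Qed.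

Lemma X_S : X \subset S. Proof. exact: subsetDl. Qed.

Lemma aP : a \in P. Proof. by rewrite inP mem_head. Qed.

Lemma bP : last a s \in P. Proof. by rewrite inP mem_last. Qed.

Lemma idx_b : idx (last a s) = size s. Proof. exact: index_last. Qed.

Lemma idx_le z : z \in P -> idx z <= size s.
Proof. by rewrite inP -ltnS => zP; have := zP; rewrite -index_mem. Qed.

Lemma idx_conn x y : x \in P -> y \in P -> idx x <= idx y -> conn (seg a s (idx x) (idx y)) x y.
Proof.
by rewrite !inP => xP yP xy; apply: seg_conn => //; rewrite in_seg ?xP ?yP leqnn xy.
Qed.

Lemma segX i j : seg a s i j \subset ~: X.
Proof. by apply: subset_trans (segP i j) _; apply/subsetP=> z /PX; rewrite in_setC. Qed.

(** Along the path to its end, back to [a] by the return walk, and along the path again. *)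
Lemma ring_conn q p : q \in P -> p \in P -> conn (~: X) q p.
Proof.
move=> qP pP; have [aX bX] : a \in ~: X /\ last a s \in ~: X.
  by rewrite !in_setC !PX ?aP ?bP.
apply: (@conn_trans _ _ _ (last a s)).
  by apply: conn_mono (segX _ _) (idx_conn qP bP _); rewrite idx_b idx_le.
apply: (@conn_trans _ _ _ a); last first.
  by apply: conn_mono (segX _ _) (idx_conn aP pP _); rewrite /= eqxx.
case: ret => [->|[c bc ca]]; first exact: conn_refl.
have sub : a |: ~: S \subset ~: X.
  by rewrite subUset sub1set aX setCS X_S.
apply: conn_trans (conn_mono sub ca); apply: conn1 => //.
by apply: (subsetP sub); apply: conn_inl ca.
Qed.

Lemma X_to_P v : v \in X -> exists p q k,
  [/\ p \in P, k \in comp e X v, link e p q k & {in q, forall z, z \in X /\ z \notin comp e X v}].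
Proof.
move=> vX; have /setDP[vS vP] := vX.
have dPC : [disjoint P & comp e X v].
  by apply: disjI => z zP /(subsetP (comp_sub _ _ _)); rewrite (negPf (PX zP)).
have aS := subsetP PS _ aP.
have [p [q [k [/setIP[pP _] /setIP[kC _] lk qX]]]] := link_exists aP (comp_self e vX) (stS aS vS) dPC.
by exists p, q, k; split=> // z /qX[zS zP zC]; rewrite in_setD zP.
Qed.

Lemma P_to_X v : v \in X -> exists k q p,
  [/\ p \in P, k \in comp e X v, link e k q p & {in q, forall z, z \in X /\ z \notin comp e X v}].
Proof.
move=> vX; have /setDP[vS vP] := vX.
have dPC : [disjoint comp e X v & P].
  by apply: disjI => z /(subsetP (comp_sub _ _ _)) zX zP; rewrite (negPf (PX zP)) in zX.
have aS := subsetP PS _ aP.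
have [k [q [p [/setIP[kC _] /setIP[pP _] lk qX]]]] := link_exists (comp_self e vX) aP (stS vS aS) dPC.
by exists k, q, p; split=> // z /qX[zS zP zC]; rewrite in_setD zC.
Qed.

Variable R : {set D}.
Hypothesis RU : R \subset U.
Hypothesis RS : R \subset S.
Hypothesis Rsep : {in R &, forall x y, x != y -> conn X x y -> conn X y x -> False}.

Definition below : rel D := fun u v => (u != v) && conn X u v.

(** Each element contributes a leg inside its strong component, and separation makes these
    components disjoint. An interior vertex of a link to the next component cannot meet the later
    part of the route: it would be reached from that component as well as reach it, hence lie in
    it. *)
Lemma chain_rt v0 t : path below v0 t -> {subset v0 :: t <= R :&: X} ->
  forall x, x \in comp e X v0 -> exists A q n0 n1,
    [/\ rt e U A x q n0 n1, q \in P, n0 + n1 = (size t).+1,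
        A \subset [set z in X | conn X v0 z] & x \in A].
Proof.
have compX v z : z \in comp e X v -> z \in X by apply/subsetP/comp_sub.
have cX v z : z \in comp e X v -> conn X v z by rewrite inE => /andP[].
have Xc v z : z \in comp e X v -> conn X z v by rewrite inE => /andP[].
elim: t v0 => [|v1 t IH] v0 /=.
  move=> _ sub x xC; have /setIP[v0R v0X] := sub _ (mem_head _ _).
  have [k [q [p [pP kC lk qX]]]] := P_to_X v0X.
  have v0C := comp_self e v0X.
  have [I [O [l [lg xI kO]]]] := strong_leg (@comp_strong _ _ _ _) xC v0C kC.
  have [y ky r] := link_rt (rt_nil e U set0 p) lk (fun z _ => (negbT (in_set0 z))).
  exists (comp e X v0 :|: ([set z in q] :|: set0)), p, (0 + (l == 0)), (0 + (l != 0)); split=> //.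
  - apply: (rt_leg r lg _ xI kO ky) => //; first exact: (subsetP RU).
    by apply: disjI => z zC; rewrite setU0 inE => /qX[_ /negP].
  - by case: eqP.
  - rewrite setU0 subUset; apply/andP; split; apply/subsetP=> z.
      by move=> zC; rewrite inE (compX _ _ zC) cX.
    rewrite inE => zq; have [zX _] := qX z zq; rewrite inE zX.
    have qsub : {subset q <= X} by move=> w /qX[].
    have [/(_ (compX _ _ kC)) + _] := link_conn lk qsub zq.
    by apply: conn_trans; apply: cX.
  - by rewrite in_setU xC.
case/andP=> /andP[v01 c01] pt' sub x xC.
have /setIP[v0R v0X] := sub _ (mem_head _ _).
have v1RX : v1 \in R :&: X by apply: sub; rewrite !inE eqxx orbT.
have /setIP[v1R v1X] := v1RX.
have v0C := comp_self e v0X; have v1C := comp_self e v1X.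
have dC : [disjoint comp e X v0 & comp e X v1].
  apply: disjI => z z0 z1; apply: (Rsep v0R v1R v01) => //.
  by apply: conn_trans (cX _ _ z1) (Xc _ _ z0).
have [k [q [y [/setIP[kC _] /setIP[yC _] lk qX]]]] := link_exists v0C v1C c01 dC.
have [|A [p [n0 [n1 [r pP nn AX yA]]]]] := IH v1 pt' _ y yC.
  by move=> z zt; apply: sub; rewrite inE zt orbT.
have qsub : {subset q <= X} by move=> w /qX[].
have qA : {in q, forall z, z \notin A}.
  move=> z zq; have [zX z0 z1] := qX z zq; apply/negP=> /(subsetP AX); rewrite inE => /andP[_ c1z].
  case/negP: z1; rewrite inE c1z.
  have [_ /(_ (compX _ _ yC)) zy] := link_conn lk qsub zq.
  by apply: conn_trans zy (Xc _ _ yC).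
have [w kw r'] := link_rt r lk qA.
have [I [O [l [lg xI kO]]]] := strong_leg (@comp_strong _ _ _ _) xC v0C kC.
exists (comp e X v0 :|: ([set z in q] :|: A)), p, (n0 + (l == 0)), (n1 + (l != 0)); split=> //.
- apply: (rt_leg r' lg _ xI kO kw) => //; first exact: (subsetP RU).
  apply: disjI => z zC /setUP[|/(subsetP AX)].
    by rewrite inE => /qX[_ /negP].
  rewrite inE => /andP[_ c1z]; apply: (Rsep v0R v1R v01 c01).
  exact: conn_trans c1z (Xc _ _ zC).
- by rewrite addnACA nn; case: (l == 0); rewrite addn1.
- rewrite !subUset; apply/and3P; split; apply/subsetP=> z.
  + by move=> zC; rewrite inE (compX _ _ zC) cX.
  + rewrite inE => zq; have [zX _ _] := qX z zq; rewrite inE zX.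
    have [/(_ (compX _ _ kC)) + _] := link_conn lk qsub zq.
    by apply: conn_trans; apply: cX.
  + move/(subsetP AX); rewrite !inE => /andP[-> c1z] /=.
    by apply: conn_trans c01 c1z.
- by rewrite in_setU xC.
Qed.

Lemma chain_closed t : size t = n.*2 -> sorted below t -> {subset t <= R} -> unavoidable U n.
Proof.
case: t => [|v0 t]; first by case: (n) n3.
move=> sz /= st sub.
(* A chain with more than one element lies in [X], because [conn X] relates only vertices of [X]. *)
have subX : {subset v0 :: t <= R :&: X}.
  move=> z zt; rewrite in_setI sub //=.
  case: t st {sub} sz zt => [|v1 t]; first by case: (n) n3 => // -[].
  move=> /= + _; elim: t v0 v1 => [|v2 t IH] v0' v1' /=.
    move=> /andP[/andP[_ c] _]; rewrite in_cons mem_seq1.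
    by case/orP=> /eqP->; [exact: conn_inl c|exact: conn_inr c].
  case/andP=> /andP[_ c] st; rewrite inE => /orP[/eqP->|]; first exact: conn_inl c.
  exact: IH st.
have /setIP[v0R v0X] := subX _ (mem_head _ _).
have [p [q [k [pP kC lk qX]]]] := X_to_P v0X.
have [A [c [n0 [n1 [r cP nn AX kA]]]]] := chain_rt st subX kC.
have qsub : {subset q <= X} by move=> w /qX[].
have kX : k \in X by apply: (subsetP (comp_sub e X v0)).
have qA : {in q, forall z, z \notin A}.
  move=> z zq; have [zX z0] := qX z zq; apply/negP=> /(subsetP AX); rewrite inE => /andP[_ c0z].
  case/negP: z0; rewrite inE c0z.
  have [_ /(_ kX) zk] := link_conn lk qsub zq.
  by move: kC; rewrite inE => /andP[_]; apply: conn_trans.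
have [w pw r'] := link_rt r lk qA.
have qAX : [set z in q] :|: A \subset X.
  rewrite subUset; apply/andP; split; apply/subsetP=> z; first by rewrite inE => /qsub.
  by move/(subsetP AX); rewrite inE => /andP[].
have pA : p \notin [set z in q] :|: A by apply: contra (PX pP); apply/subsetP.
have r2 := rt_pre r' pw pA (subxx _).
apply: (closed_route r2) => //; first by rewrite setU11.
  apply: conn_mono (ring_conn cP pP); apply/subsetP=> z; rewrite !in_setU1 !in_setC in_setU1.
  by case: (eqVneq z p) => //= _; apply: contra; apply/subsetP.
by rewrite nn -sz.
Qed.

(* The path reaches u off the path from its origins and is reached from u at *)
(* its landings; [pp u] is the last origin and [qq u] the first landing.      *)
Definition orig u i := (i <= size s) && conn (pt i |: X) (pt i) u.
Definition land u i := (i <= size s) && conn (pt i |: X) u (pt i).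
Definition pp u := maxidx (orig u) (size s).
Definition qq u := minidx (land u) (size s).

Lemma pt_P i : i <= size s -> pt i \in P.
Proof. by move=> im; rewrite inP mem_nth. Qed.

Lemma idx_pt i : i <= size s -> idx (pt i) = i.
Proof. by move=> im; rewrite index_uniq. Qed.

Lemma pt_idx z : z \in P -> pt (idx z) = z.
Proof. by rewrite inP => /nth_index->. Qed.

Lemma X_or_P u : u \in S -> u \in P \/ u \in X.
Proof. by move=> uS; rewrite in_setD uS andbT; case: (u \in P); [left|right]. Qed.

Lemma orig_P u i : u \in P -> orig u i -> i = idx u.
Proof.
move=> uP /andP[im /conn_inr]; rewrite in_setU1 (negPf (PX uP)) orbF => /eqP->.
by rewrite idx_pt.
Qed.

Lemma land_P u i : u \in P -> land u i -> i = idx u.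
Proof.
move=> uP /andP[im /conn_inl]; rewrite in_setU1 (negPf (PX uP)) orbF => /eqP->.
by rewrite idx_pt.
Qed.

Lemma origP u : u \in S -> orig u (pp u) /\ forall i, orig u i -> i <= pp u.
Proof.
move=> uS; have [i oi] : exists i, orig u i.
  have [uP|uX] := X_or_P uS.
    by exists (idx u); rewrite /orig idx_le // pt_idx // conn_refl // setU11.
  have [p [q [k [pP kC lk qX]]]] := X_to_P uX.
  have kX := subsetP (comp_sub e X u) _ kC.
  exists (idx p); rewrite /orig idx_le // pt_idx //; apply: (@conn_trans _ _ _ k); last first.
    by move: kC; rewrite inE => /andP[_]; apply: conn_mono; apply: subsetUr.
  have [z zq kz] := link_first lk.
  have zX : z \in X by move: zq; rewrite mem_rcons inE => /orP[/eqP->|/qX[]].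
  apply: (@conn_trans _ _ _ z); first by apply: conn1; rewrite // in_setU1 ?eqxx ?zX ?orbT.
  apply: conn_mono (subsetUr _ _) _.
  move: zq; rewrite mem_rcons inE => /orP[/eqP->|zq]; first exact: conn_refl.
  by have [_ ->] := link_conn lk (fun z zq => (qX z zq).1) zq.
split; first by have := oi => /andP[im _]; have [] := maxidxP im oi.
by move=> j oj; have := oj => /andP[jm _]; have [] := maxidxP jm oj.
Qed.

Lemma landP u : u \in S -> land u (qq u) /\ forall i, land u i -> qq u <= i.
Proof.
move=> uS; have [i oi] : exists i, land u i.
  have [uP|uX] := X_or_P uS.
    by exists (idx u); rewrite /land idx_le // pt_idx // conn_refl // setU11.
  have [k [q [p [pP kC lk qX]]]] := P_to_X uX.
  have kX := subsetP (comp_sub e X u) _ kC.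
  exists (idx p); rewrite /land idx_le // pt_idx //; apply: (@conn_trans _ _ _ k).
    by move: kC; rewrite inE => /andP[+ _]; apply: conn_mono; apply: subsetUr.
  have [z zq kz] := link_last lk.
  have zX : z \in X by move: zq; rewrite inE => /orP[/eqP->|/qX[]].
  apply: (@conn_trans _ _ _ z); last by apply: conn1; rewrite // in_setU1 ?eqxx ?zX ?orbT.
  apply: conn_mono (subsetUr _ _) _.
  move: zq; rewrite inE => /orP[/eqP->|zq]; first exact: conn_refl.
  by have [+ _] := link_conn lk (fun z zq => (qX z zq).1) zq; apply.
split; first by have := oi => /andP[im _]; have [] := minidxP im oi.
by move=> j oj; have := oj => /andP[jm _]; have [] := minidxP jm oj.
Qed.

(** The interval of [u] on the path is spanned by its last origin and its first landing, which may
    come in either order. *)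
Definition lo u := minn (pp u) (qq u).
Definition hi u := maxn (pp u) (qq u).

Definition zin u := [set z in X | conn (pt (pp u) |: X) (pt (pp u)) z && conn X z u].
Definition zout u := [set z in X | conn (pt (qq u) |: X) z (pt (qq u)) && conn X u z].
Definition W u := zin u :|: zout u.

Lemma WX u : W u \subset X.
Proof. by rewrite subUset; apply/andP; split; apply/subsetP=> z; rewrite inE => /andP[]. Qed.

Lemma pp_le u : u \in S -> pp u <= size s.
Proof. by case/origP=> /andP[]. Qed.

Lemma qq_le u : u \in S -> qq u <= size s.
Proof. by case/landP=> /andP[]. Qed.

Lemma in_conn u : u \in S -> conn (pt (pp u) |: W u) (pt (pp u)) u.
Proof.
move=> uS; have [/andP[_ c] _] := origP uS.
apply: conn_mono (conn_via _ (conn_inr c) c); last by rewrite PX // pt_P // pp_le.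
by apply: setUS; apply: subsetUl.
Qed.

Lemma out_conn u : u \in S -> conn (pt (qq u) |: W u) u (pt (qq u)).
Proof.
move=> uS; have [/andP[_ c] _] := landP uS.
apply: conn_mono (conn_via_rev _ (conn_inl c) c); last by rewrite PX // pt_P // qq_le.
by apply: setUS; apply: subsetUr.
Qed.

Lemma comp_W u : u \in S -> comp e X u \subset W u.
Proof.
move=> uS; apply/subsetP=> z; rewrite inE => /andP[uz zu].
have [/andP[_ c] _] := origP uS; rewrite in_setU; apply/orP; left.
by rewrite inE (conn_inl zu) zu (conn_trans c (conn_mono (subsetUr _ _) uz)).
Qed.

Lemma sub_lohi u i : lo u <= i <= hi u -> i <= size s -> pt i \in seg a s (lo u) (hi u).
Proof. by move=> ? ?; apply: nth_in_seg. Qed.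

(** If the landing is not after the origin, the interval and [W u] have a strong component
    containing both ends and [u], and a leg in it carries the route from one end to the other.
    Otherwise the route leaves the path at the origin, passes through the component of [u] and comes
    back at the landing. *)
Lemma item_rt u A a' c n0 n1 : u \in R -> rt e U A a' c n0 n1 -> e (pt (hi u)) a' ->
  [disjoint seg a s (lo u) (hi u) :|: W u & A] ->
  exists m0 m1, rt e U (seg a s (lo u) (hi u) :|: W u :|: A) (pt (lo u)) c m0 m1 /\
    m0 + m1 = (n0 + n1).+1.
Proof.
move=> uR r ea d; have uS := subsetP RS _ uR; have uU := subsetP RU _ uR.
have ps := pp_le uS; have qs := qq_le uS.
have pseg : pt (pp u) \in seg a s (lo u) (hi u).
  by apply: sub_lohi => //; rewrite geq_minl leq_maxl.
have qseg : pt (qq u) \in seg a s (lo u) (hi u).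
  by apply: sub_lohi => //; rewrite geq_minr leq_maxr.
have ci := in_conn uS; have co := out_conn uS.
have [qp|pq] := leqP (qq u) (pp u).
  have El : lo u = qq u by apply/minn_idPr.
  have Eh : hi u = pp u by apply/maxn_idPl.
  pose Z := seg a s (lo u) (hi u) :|: W u; pose B := comp e Z u.
  have ci' : conn Z (pt (pp u)) u.
    apply: conn_mono ci; apply: setSU; by rewrite sub1set.
  have co' : conn Z u (pt (qq u)).
    apply: conn_mono co; apply: setSU; by rewrite sub1set.
  have cs : conn Z (pt (qq u)) (pt (pp u)).
    apply: conn_mono (subsetUl _ _) _; apply: seg_conn => //.
    by rewrite !idx_pt.
  have uB : u \in B by apply: comp_self; apply: conn_inl co'.
  have pB : pt (pp u) \in B by rewrite inE (conn_trans co' cs) ci'.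
  have qB : pt (qq u) \in B by rewrite inE co' (conn_trans cs ci').
  have [I [O [l [lg qI pO]]]] := strong_leg (@comp_strong _ _ _ _) qB uB pB.
  exists (n0 + (l == 0)), (n1 + (l != 0)); split; last by rewrite addnACA; case: (l == 0); rewrite addn1.
  rewrite El; rewrite Eh in ea; apply: (rt_leg r lg uU qI pO ea).
    by apply: disjointWl d; apply: comp_sub.
  by apply: setSU; rewrite -{1}El; apply: comp_sub.
have El : lo u = pp u by apply/minn_idPl; apply: ltnW.
have Eh : hi u = qq u by apply/maxn_idPr; apply: ltnW.
have uX : u \in X.
  have [uP|//] := X_or_P uS.
  have [o _] := origP uS; have [o' _] := landP uS.
  by move: pq; rewrite (orig_P uP o) (land_P uP o') ltnn.
have uK := comp_self e uX; set K := comp e X u in uK.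
have KX : K \subset X by apply: comp_sub.
have dp z : z \in P -> [disjoint [set z] & K].
  by move=> zP; rewrite disjoints1; apply: contra (PX zP); apply/subsetP.
have [x1 [q1 [k1 [/setIP[/set1P-> _] /setIP[k1K _] lk1 q1X]]]] :=
  link_exists (set11 _) uK ci (dp _ (pt_P ps)).
have dq : [disjoint K & [set pt (qq u)]] by rewrite disjoint_sym; apply: dp; apply: pt_P.
have [k2 [q2 [x2 [/setIP[k2K _] /setIP[/set1P-> _] lk2 q2X]]]] :=
  link_exists uK (set11 _) co dq.
have q1W : {in q1, forall z, z \in W u /\ z \notin K}.
  by move=> z /q1X[+ + zK]; rewrite in_setU1 in_set1 => /orP[->//|].
have q2W : {in q2, forall z, z \in W u /\ z \notin K}.
  by move=> z /q2X[+ zK +]; rewrite in_setU1 in_set1 => /orP[->//|].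
have q12 : {in q1, forall z, z \notin q2}.
  apply: (links_disjoint lk1 lk2 k1K k2K) => z.
    by move=> /q1W[zW zK]; rewrite (subsetP (WX u) _ zW).
  by move=> /q2W[zW _]; rewrite (subsetP (WX u) _ zW).
have WA : [disjoint W u & A] by apply: disjointWl d; apply: subsetUr.
have sA : [disjoint seg a s (lo u) (hi u) & A] by apply: disjointWl d; apply: subsetUl.
have Wseg z : z \in W u -> z \notin P.
  by move=> /(subsetP (WX u)); rewrite in_setD => /andP[].
have nA z : z \in seg a s (lo u) (hi u) -> z \notin A.
  by move=> zs; apply/negP=> zA; apply: disjE sA zs zA.
have nWA z : z \in W u -> z \notin A.
  by move=> zs; apply/negP=> zA; apply: disjE WA zs zA.
rewrite Eh in ea; have r1 := rt_pre r ea (nA _ qseg) (subxx _).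
have [|y ky r2] := link_rt r1 lk2.
  move=> z /q2W[zW _]; rewrite in_setU1 negb_or nWA // andbT.
  by apply: contraNneq (Wseg _ zW) => ->; apply: pt_P.
have [I [O [l [lg k1I k2O]]]] := strong_leg (@comp_strong _ _ _ _) k1K uK k2K.
have KW : K \subset W u by apply: comp_W.
have dKA : [disjoint K & [set z in q2] :|: (pt (qq u) |: A)].
  apply: disjI => z zK; have zW := subsetP KW _ zK; rewrite !in_setU in_set1 inE => /or3P[/q2W[_]|/eqP E|zA].
  - by rewrite zK.
  - by move: (Wseg _ zW); rewrite E pt_P.
  - by move: (nWA _ zW); rewrite zA.
have r3 := rt_leg r2 lg uU k1I k2O ky dKA (subxx _).
have [|w pw r4] := link_rt r3 lk1.
  move=> z zq; have [zW zK] := q1W z zq; rewrite !in_setU in_set1 inE !negb_or zK q12 //= nWA // andbT.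
  by apply: contraNneq (Wseg _ zW) => ->; apply: pt_P.
have pnot : pt (pp u) \notin [set z in q1] :|: (comp e X u :|: ([set z in q2] :|: (pt (qq u) |: A))).
  have pP := pt_P ps; rewrite !in_setU in_set1 !negb_or; apply/and5P; split.
  - by rewrite inE; apply: contraL pP => /q1W[/Wseg].
  - by apply: contraL pP => /(subsetP KW)/Wseg.
  - by rewrite inE; apply: contraL pP => /q2W[/Wseg].
  - by apply/eqP=> /(congr1 (fun z => idx z)); rewrite !idx_pt // => E; rewrite E ltnn in pq.
  - exact: nA.
have r5 := rt_pre r4 pw pnot (subxx _).
exists (n0 + (l == 0)), (n1 + (l != 0)); split; last by rewrite addnACA; case: (l == 0); rewrite addn1.
have sW : W u \subset seg a s (lo u) (hi u) :|: W u :|: A.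
  by rewrite -setUA setUCA subsetUl.
rewrite {2}El; apply: rt_sub r5; rewrite !subUset !sub1set; apply/and5P; split.
- by rewrite !in_setU pseg.
- by apply/subsetP=> z; rewrite in_set => /q1W[zW _]; apply: (subsetP sW).
- exact: subset_trans KW sW.
- by apply/subsetP=> z; rewrite in_set => /q2W[zW _]; apply: (subsetP sW).
- by rewrite !in_setU qseg subsetUr.
Qed.

Lemma lo_hi u : lo u <= hi u.
Proof. exact: minn_le_maxn. Qed.

Lemma zin_X u z : z \in zin u -> conn X z u. Proof. by rewrite inE => /and3P[]. Qed.

Lemma zout_X u z : z \in zout u -> conn X u z. Proof. by rewrite inE => /and3P[]. Qed.

Lemma zin_le u v z : u \in R -> v \in R -> z \in zin u -> conn X z v -> pp u <= pp v.
Proof.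
move=> uR vR; rewrite inE => /and3P[_ pz _] zv.
have [_] := origP (subsetP RS _ vR); apply; rewrite /orig pp_le ?(subsetP RS) //=.
by apply: conn_trans pz _; apply: conn_mono zv; apply: subsetUr.
Qed.

Lemma zout_le u v z : u \in R -> v \in R -> z \in zout u -> conn X v z -> qq v <= qq u.
Proof.
move=> uR vR; rewrite inE => /and3P[_ zq _] vz.
have [_] := landP (subsetP RS _ vR); apply; rewrite /land qq_le ?(subsetP RS) //=.
by apply: conn_trans zq; apply: conn_mono vz; apply: subsetUr.
Qed.

Variable A : {set D}.
Hypothesis AR : A \subset R.
Hypothesis Aanti : {in A &, forall x y, ~~ below x y}.

Lemma A_disc u v : u \in A -> v \in A -> u != v -> conn X u v -> False.
Proof. by move=> uA vA uv c; move: (Aanti uA vA); rewrite /below uv c. Qed.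

(** A common vertex of the two in-parts makes the last origin of [v] an origin of [u], and one of
    the two out-parts makes the first landing of [u] a landing of [v]; both contradict the order of
    the intervals. In the mixed cases one element reaches the other within [X], against [Aanti]. *)
Lemma W_disjoint u v : u \in A -> v \in A -> hi u < lo v -> [disjoint W u & W v].
Proof.
move=> uA vA lt; have [uR vR] := (subsetP AR _ uA, subsetP AR _ vA).
have uv : u != v by apply: contraTneq lt => ->; rewrite -leqNgt lo_hi.
have vu : v != u by rewrite eq_sym.
apply: disjI => z /setUP[zu|zu] /setUP[zv|zv].
- have := zin_le vR uR zv (zin_X zu); rewrite leqNgt => /negP; apply.
  by case/maxn_lt_minn: lt.
- by apply: (A_disc vA uA vu); apply: conn_trans (zout_X zv) (zin_X zu).
- by apply: (A_disc uA vA uv); apply: conn_trans (zout_X zu) (zin_X zv).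
- have := zout_le uR vR zu (zout_X zv); rewrite leqNgt => /negP; apply.
  by case/maxn_lt_minn: lt.
Qed.

Definition before : rel D := fun u v => hi u < lo v.

Lemma before_trans : transitive before.
Proof.
move=> v u w; rewrite /before => uv vw; apply: leq_trans uv _.
by apply: leq_trans (ltnW vw); apply: lo_hi.
Qed.

Lemma hi_le u : u \in A -> hi u <= size s.
Proof.
by move=> /(subsetP AR)/(subsetP RS) uS; rewrite geq_max pp_le ?qq_le.
Qed.

Lemma arc_pt i : i < size s -> e (pt i) (pt i.+1).
Proof. by move=> im; have /(pathP a) -> := pth. Qed.

Lemma pre_seg i j B c n0 n1 : i <= j <= size s ->
  rt e U B (pt j) c n0 n1 -> (forall z, z \in P -> i <= idx z < j -> z \notin B) ->
  exists2 B' : {set D}, B' \subset B :|: [set z in P | i <= idx z] & rt e U B' (pt i) c n0 n1.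
Proof.
case/andP=> ij js r nB; have [->|ne] := eqVneq i j; first by exists B => //; apply: subsetUl.
have ij' : i < j by rewrite ltn_neqAle ne.
have sj : seg a s i j.-1 \subset [set z in P | i <= idx z].
  by apply/subsetP=> z; rewrite in_seg !inE => /and3P[-> ->].
exists (seg a s i j.-1 :|: B); first by rewrite setUC setUS.
apply: (rt_conn (y := pt j.-1) r).
- apply: seg_conn => //; first by apply: nth_in_seg => //; slia.
    by apply: nth_in_seg => //; slia.
  by rewrite !idx_pt; slia.
- by rewrite -{2}(prednK (leq_ltn_trans (leq0n i) ij')); apply: arc_pt; slia.
apply: disjI => z zs zB; have := zs; rewrite in_seg => /and3P[zP iz zj].
by have := nB z; rewrite inP zP zB => /(_ isT) H; have := H; rewrite iz; move: zj ij'; slia.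
Qed.

(** The intervals are traversed from left to right, each by [item_rt] and the gap before it by
    [pre_seg]. The bound on [B] keeps the route disjoint from everything to be prepended later. *)
Lemma intervals_rt t : sorted before t -> {subset t <= A} -> forall i c, i <= size s ->
  (forall v, v \in t -> i <= lo v) -> e (last a s) c ->
  exists (B : {set D}) n0 n1, [/\ rt e U B (pt i) c n0 n1, n0 + n1 = size t
    & B \subset [set z in P | i <= idx z] :|: \bigcup_(v in t) W v].
Proof.
elim: t => [|v t IH] st tA i c im iv ec.
  have bE : last a s = pt (size s) by rewrite (last_nth a).
  exists (seg a s i (size s) :|: set0), 0, 0; split=> //.
    apply: (rt_conn (y := last a s) (rt_nil e U set0 c)) => //.
      rewrite bE; apply: seg_conn => //.
      - by apply: nth_in_seg => //; rewrite leqnn.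
      - by apply: nth_in_seg => //; rewrite leqnn im.
      - by rewrite !idx_pt.
    by rewrite -setI_eq0 setI0.
  rewrite setU0; apply: subset_trans (subsetUl _ _).
  by apply/subsetP=> z; rewrite in_seg !inE => /and3P[-> ->].
have vA := tA _ (mem_head _ _); have vR := subsetP AR _ vA.
have all_t : all (before v) t by apply: (order_path_min before_trans).
have st' := path_sorted st.
have tA' : {subset t <= A} by move=> w wt; apply: tA; rewrite inE wt orbT.
have hs := hi_le vA.
have [B [a' [n0 [n1 [r nn ea sB]]]]] : exists (B : {set D}) a' n0 n1, [/\ rt e U B a' c n0 n1,
    n0 + n1 = size t, e (pt (hi v)) a' &
    B \subset [set z in P | hi v < idx z] :|: \bigcup_(v in t) W v].
  have [lt|ge] := ltnP (hi v) (size s).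
    have [|B [n0 [n1 [r nn sB]]]] := IH st' tA' (hi v).+1 c lt _ ec.
      by move=> w /(allP all_t).
    by exists B, (pt (hi v).+1), n0, n1; split=> //; apply: arc_pt.
  have E : hi v = size s by apply/eqP; rewrite eqn_leq hs.
  case: t st tA {IH st' iv} all_t tA' => [|w t] st tA all_t tA'; last first.
    have := allP all_t w (mem_head _ _); rewrite /before E ltnNge.
    by rewrite (leq_trans (lo_hi w) (hi_le (tA' _ (mem_head _ _)))).
  exists set0, c, 0, 0; split; rewrite ?sub0set //; first exact: rt_nil.
  by rewrite E -(last_nth a).
have [|m0 [m1 [r1 mm]]] := item_rt vR r ea.
  apply: disjI => z /setUP[zs|zW] /(subsetP sB)/setUP[zh|/bigcupP[w wt zw]].
  - by move: zs zh; rewrite in_seg !inE => /and3P[_ _ z1] /andP[_]; rewrite ltnNge z1.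
  - move: zs; rewrite in_seg => /andP[zP _]; have := subsetP (WX w) _ zw.
    by apply/negP; apply: PX; rewrite inP.
  - move: zh; rewrite inE => /andP[zP _]; have := subsetP (WX v) _ zW.
    by apply/negP; apply: PX.
  - by have := W_disjoint vA (tA' _ wt) (allP all_t _ wt) => d; apply: disjE d zW zw.
have [||B' sB' r2] := @pre_seg i (lo v) _ c m0 m1 _ r1.
- by rewrite iv ?mem_head // (leq_trans (lo_hi v) hs).
- move=> z zP /andP[_ zl]; rewrite !in_setU !negb_or in_seg; apply/andP; split.
    apply/andP; split; first by rewrite leqNgt zl /= andbF.
    by rewrite -negb_or -in_setU; apply: contraL zP => /(subsetP (WX v)); rewrite in_setD => /andP[].
  apply/negP=> /(subsetP sB)/setUP[|/bigcupP[w wt /(subsetP (WX w)) zX]].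
    by rewrite inE => /andP[_]; have := leq_trans zl (lo_hi v); slia.
  by move: (PX zP); rewrite zX.
exists B', m0, m1; split=> //; first by rewrite mm nn.
apply: subset_trans sB' _; rewrite subUset; apply/andP; split; last exact: subsetUl.
rewrite subUset; apply/andP; split; first (rewrite subUset; apply/andP; split).
- apply: subset_trans (subsetUl _ _); apply/subsetP=> z; rewrite in_seg !inE => /and3P[-> z1 _] /=.
  by apply: leq_trans z1; apply: iv; rewrite mem_head.
- apply: subset_trans (subsetUr _ _).
  by apply: (bigcup_sup (P := fun w => w \in v :: t) v) => //; rewrite mem_head.
apply: subset_trans sB _; rewrite subUset; apply/andP; split.
  apply: subset_trans (subsetUl _ _); apply/subsetP=> z; rewrite !inE => /andP[-> z1] /=.
  apply: leq_trans (ltnW z1); apply: leq_trans (lo_hi v).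
  by apply: iv; rewrite mem_head.
apply: subset_trans (subsetUr _ _); apply/bigcupsP=> w wt.
by apply: (bigcup_sup (P := fun w => w \in v :: t) w) => //; rewrite inE wt orbT.
Qed.

Lemma disjoint_closed t : size t = n.*2 -> sorted before t -> {subset t <= A} -> unavoidable U n.
Proof.
move=> sz st tA.
(* If the path ended where it starts, it would be a single vertex and could not contain two disjoint
   intervals. *)
have ba : last a s != a.
  case: t sz st tA => [|v [|w t]] sz st tA; first by case: (n) n3 sz.
    by move: sz n3; case: (n) => [|[|[]]].
  have lt : hi v < lo w by case/andP: st.
  apply: contraTneq lt => /(congr1 (fun z => idx z)); rewrite idx_b /= eqxx => s0.
  have := hi_le (tA w _); rewrite s0 !inE eqxx orbT => /(_ isT) h.
  by have := lo_hi w; move: h; slia.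
case: ret => [E|[c bc ca]]; first by rewrite E eqxx in ba.
have [||B [n0 [n1 [r nn sB]]]] := intervals_rt st tA (i := 0) (c := c) _ _ bc => //.
have BS : B \subset S.
  apply: subset_trans sB _; rewrite subUset; apply/andP; split.
    by apply/subsetP=> z; rewrite inE => /andP[/(subsetP PS)].
  by apply/bigcupsP=> v _; apply: subset_trans (WX v) X_S.
apply: (closed_route (rt_sub (subsetUr [set a] B) r)); first by rewrite setU11.
- apply: conn_mono ca; apply/subsetP=> z; rewrite !in_setU !in_setC in_set1 in_setU1.
  case: (eqVneq z a) => //= _; apply: contra.
  exact: (subsetP BS).
- by rewrite nn sz.
- exact: n3.
Qed.

Definition near_in u := pt (pp u) |: [set z in X | conn X z u & z \notin comp e X u].
Definition near_out u := pt (qq u) |: [set z in X | conn X u z & z \notin comp e X u].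
(** The ways into [u] from its last origin, off its component. They will be added to the out-tree of
    the centre of the star, and [out_tree] to its in-tree. *)
Definition in_tree u := [set z in near_in u | conn (near_in u) (pt (pp u)) z].
Definition out_tree u := [set z in near_out u | conn (near_out u) z (pt (qq u))].

Lemma in_treeP u z : z \in in_tree u -> z \in X -> pp u <= size s -> conn X z u /\ z \notin comp e X u.
Proof.
rewrite inE in_setU1 => /andP[/orP[/eqP->|zY] _] zX ps; first by move: (PX (pt_P ps)); rewrite zX.
by move: zY; rewrite in_set => /and3P[].
Qed.

Lemma out_treeP u z : z \in out_tree u -> z \in X -> qq u <= size s -> conn X u z /\ z \notin comp e X u.
Proof.
rewrite inE in_setU1 => /andP[/orP[/eqP->|zY] _] zX ps; first by move: (PX (pt_P ps)); rewrite zX.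
by move: zY; rewrite in_set => /and3P[].
Qed.

Lemma in_tree_nX u z : z \in in_tree u -> z \notin X -> z = pt (pp u).
Proof. by rewrite inE in_setU1 inE => /andP[/orP[/eqP//|/andP[->]]]. Qed.

Lemma out_tree_nX u z : z \in out_tree u -> z \notin X -> z = pt (qq u).
Proof. by rewrite inE in_setU1 inE => /andP[/orP[/eqP//|/andP[->]]]. Qed.

(** The centre is enlarged by the ways into and out of the elements of [R3]. A vertex of [X] on a
    way out of [u] and on a way into [v] forces [u = v] by [A_disc], and then lies in the component
    of [u], which these ways avoid. So the trees still meet only in the root, and the components
    supply the legs. *)
Lemma star_ext (R3 : {set D}) I1 O1 r : R3 \subset A -> R3 \subset X -> n <= #|R3| ->
  bset e I1 O1 r -> I1 :|: O1 \subset ~: X ->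
  {in R3, forall u, pt (pp u) \in O1 /\ pt (qq u) \in I1} -> unavoidable U n.
Proof.
move=> R3A R3X nR b1 sX io.
have [rI rO] := bset_root b1; case: (b1) => IO1 cI1 cO1.
have nX z : z \in I1 :|: O1 -> z \notin X by move/(subsetP sX); rewrite in_setC.
have uA u : u \in R3 -> u \in A by move/(subsetP R3A).
have uS u : u \in R3 -> u \in S by move/uA/(subsetP AR)/(subsetP RS).
pose I := I1 :|: \bigcup_(u in R3) out_tree u.
pose O := O1 :|: \bigcup_(u in R3) in_tree u.
have XI z : z \in X -> z \in I -> exists2 u, u \in R3 & conn X u z /\ z \notin comp e X u.
  move=> zX /setUP[zI|/bigcupP[u uR zu]].
    by have := nX z; rewrite in_setU zI zX => /(_ isT).
  by exists u => //; apply: out_treeP zu zX (qq_le (uS _ uR)).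
have XO z : z \in X -> z \in O -> exists2 u, u \in R3 & conn X z u /\ z \notin comp e X u.
  move=> zX /setUP[zI|/bigcupP[u uR zu]].
    by have := nX z; rewrite in_setU zI zX orbT => /(_ isT).
  by exists u => //; apply: in_treeP zu zX (pp_le (uS _ uR)).
have nXI z : z \notin X -> z \in I -> z \in I1.
  move=> zX /setUP[//|/bigcupP[u uR zu]].
  by rewrite (out_tree_nX zu zX); have [] := io u uR.
have nXO z : z \notin X -> z \in O -> z \in O1.
  move=> zX /setUP[//|/bigcupP[u uR zu]].
  by rewrite (in_tree_nX zu zX); have [] := io u uR.
have bIO : bset e I O r.
  split.
  - apply/setP=> z; apply/setIP/set1P=> [[zI zO]|->]; last by rewrite !in_setU rI rO.
    have [zX|zX] := boolP (z \in X); last first.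
      by apply/set1P; rewrite -IO1 in_setI nXI ?nXO.
    have [u uR [uz zC]] := XI z zX zI; have [v vR [zv _]] := XO z zX zO.
    have [E|uv] := eqVneq u v; last by case: (A_disc (uA _ uR) (uA _ vR) uv); apply: conn_trans zv.
    by case/negP: zC; rewrite inE uz E zv.
  - have H z : z \in I1 -> conn I z r by move=> zI; apply: conn_mono (cI1 _ zI); apply: subsetUl.
    move=> z /setUP[|/bigcupP[u uR]]; first exact: H.
    rewrite inE => /andP[_ /conn_coreach c]; apply: conn_trans (H _ (io u uR).2).
    by apply: conn_mono c; apply: subset_trans (subsetUr _ _); apply: (bigcup_sup u).
  - have H z : z \in O1 -> conn O r z by move=> zI; apply: conn_mono (cO1 _ zI); apply: subsetUl.
    move=> z /setUP[|/bigcupP[u uR]]; first exact: H.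
    rewrite inE => /andP[_ /conn_reach c]; apply: conn_trans (H _ (io u uR).1) _.
    by apply: conn_mono c; apply: subset_trans (subsetUr _ _); apply: (bigcup_sup u).
apply: (star_set nR _ bIO (K := comp e X)).
- by apply: subset_trans R3A _; apply: subset_trans AR RU.
- move=> u uR; have uX := subsetP R3X _ uR; have uK := comp_self e uX; split.
    apply: disjI => z zIO zC; have zX := subsetP (comp_sub e X u) _ zC.
    have /andP[uz zu] : conn X u z && conn X z u by move: zC; rewrite inE.
    case/setUP: zIO => [/(XI z zX)|/(XO z zX)] [v vR [c zv]].
      have [E|vu] := eqVneq v u; first by rewrite E zC in zv.
      by apply: (A_disc (uA _ vR) (uA _ uR) vu); apply: conn_trans zu.
    have [E|uv] := eqVneq u v; first by rewrite -E zC in zv.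
    by apply: (A_disc (uA _ uR) (uA _ vR) uv); apply: conn_trans c.
  have [/andP[ps ci] _] := origP (uS _ uR); have [/andP[qs co] _] := landP (uS _ uR).
  have dp z : z \in P -> [disjoint [set z] & comp e X u].
    by move=> zP; rewrite disjoints1; apply: contra (PX zP); apply/subsetP/comp_sub.
  have [x1 [q1 [k1 [/setIP[/set1P-> _] /setIP[k1K _] lk1 q1X]]]] :=
    link_exists (set11 _) uK ci (dp _ (pt_P ps)).
  have dq : [disjoint comp e X u & [set pt (qq u)]] by rewrite disjoint_sym; apply: dp; apply: pt_P.
  have [k2 [q2 [x2 [/setIP[k2K _] /setIP[/set1P-> _] lk2 q2X]]]] :=
    link_exists uK (set11 _) co dq.
  have [I' [O' [l [lg k1I k2O]]]] := strong_leg (@comp_strong _ _ _ _) k1K uK k2K.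
  have kX k : k \in comp e X u -> [/\ k \in X, conn X u k & conn X k u].
    by move=> kC; have := kC; rewrite inE => /andP[c ->]; rewrite (conn_inr c) c.
  exists I', O', l; split=> //.
  - have q1sub : {subset q1 <= X}.
      by move=> z /q1X[+ + _]; rewrite in_setU1 in_set1 => /orP[->|].
    have q1near : {subset q1 <= near_in u}.
      move=> z zq; rewrite in_setU1 inE q1sub //= orbC; apply/orP; left.
      have [_ _ ->] := q1X z zq; rewrite andbT.
      have [k1X _ k1u] := kX _ k1K.
      by have [_ /(_ k1X) c] := link_conn lk1 q1sub zq; apply: conn_trans c k1u.
    have [z zq zk] := link_last lk1; exists z, k1; split=> //.
    rewrite in_setU; apply/orP; right; apply/bigcupP; exists u => //.
    have pn : pt (pp u) \in near_in u by rewrite setU11.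
    rewrite inE; move: zq; rewrite inE => /orP[/eqP->|zq]; first by rewrite pn conn_refl.
    by rewrite q1near //; have [/(_ pn)] := link_conn lk1 q1near zq.
  - have q2sub : {subset q2 <= X}.
      by move=> z /q2X[+ _ +]; rewrite in_setU1 in_set1 => /orP[->|].
    have q2near : {subset q2 <= near_out u}.
      move=> z zq; rewrite in_setU1 inE q2sub //= orbC; apply/orP; left.
      have [_ -> _] := q2X z zq; rewrite andbT.
      have [k2X k2u _] := kX _ k2K.
      by have [/(_ k2X) c _] := link_conn lk2 q2sub zq; apply: conn_trans k2u c.
    have [z zq zk] := link_first lk2; exists k2, z; split=> //.
    rewrite in_setU; apply/orP; right; apply/bigcupP; exists u => //.
    have pn : pt (qq u) \in near_out u by rewrite setU11.
    rewrite inE; move: zq; rewrite mem_rcons inE => /orP[/eqP->|zq]; first by rewrite pn conn_refl.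
    by rewrite q2near //; have [_ /(_ pn)] := link_conn lk2 q2near zq.
move=> u v uR vR uv; apply: disjI => z; rewrite !inE => /andP[uz zu] /andP[vz zv].
by apply: (A_disc (uA _ uR) (uA _ vR) uv); apply: conn_trans uz zv.
Qed.

(** At most one element lies on the path. For the elements whose landing is not after the origin,
    the path rooted at position [x] is a centre. For the others the path is cut at one of the two
    steps at [x]: the part before the cut is an out-tree with root [a], and the part after it
    together with the return walk is an in-tree. *)
Lemma star_common (B : {set D}) x : B \subset A -> 3 * n < #|B| -> x <= size s ->
  {in B, forall u, lo u <= x <= hi u} -> unavoidable U n.
Proof.
move=> BA nB xs Bx.
have uA u : u \in B -> u \in A by move/(subsetP BA).
have uS u : u \in B -> u \in S by move/uA/(subsetP AR)/(subsetP RS).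
pose onP := B :&: P; pose bk := [set u in B :&: X | qq u <= pp u].
pose f1 := [set u in B :&: X | pp u <= x < qq u].
pose f2 := [set u in B :&: X | pp u <= x.-1 < qq u].
have onP1 : #|onP| <= 1.
  apply: leq_trans (_ : #|[set pt x]| <= 1); last by rewrite cards1.
  apply: subset_leq_card; apply/subsetP=> u /setIP[uB uP]; rewrite in_set1.
  have [o _] := origP (uS _ uB); have [o' _] := landP (uS _ uB).
  have := Bx u uB; rewrite /lo /hi (orig_P uP o) (land_P uP o') minnn maxnn => ux.
  by have -> : x = idx u by [slia]; rewrite pt_idx.
have cover : B \subset onP :|: (bk :|: (f1 :|: f2)).
  apply/subsetP=> u uB; have ux := Bx u uB.
  have [uP|uX] := X_or_P (uS _ uB); first by rewrite in_setU /onP in_setI uB uP.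
  have uBX : u \in B :&: X by rewrite in_setI uB.
  rewrite in_setU; apply/orP; right; rewrite in_setU.
  case/or3P: (straddle ux) => h; apply/orP; [left|right|right].
  - by rewrite in_set uBX.
  - by rewrite in_setU; apply/orP; left; rewrite in_set uBX.
  - by rewrite in_setU; apply/orP; right; rewrite in_set uBX.
have : #|B| <= 1 + (#|bk| + (#|f1| + #|f2|)).
  apply: leq_trans (subset_leq_card cover) _.
  apply: leq_trans (leq_card_setU _ _).1 _; apply: leq_add onP1 _.
  apply: leq_trans (leq_card_setU _ _).1 _; rewrite leq_add2l.
  exact: (leq_card_setU _ _).1.
have sBA (C : {set D}) : C \subset B :&: X -> C \subset A /\ C \subset X.
  move=> sC; split; apply: subset_trans sC _; last exact: subsetIr.
  by apply: subset_trans BA; apply: subsetIl.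
have sub (Q : pred D) : [set u in B :&: X | Q u] \subset B :&: X.
  by apply/subsetP=> u; rewrite inE => /andP[].
have forward y (C : {set D}) : C \subset B :&: X -> y < size s -> n <= #|C| ->
    {in C, forall u, pp u <= y < qq u} -> unavoidable U n.
  move=> sC ys nC Cy; have [CA CX] := sBA C sC.
  have ba : last a s != a.
    apply: contraTneq ys => /(congr1 (fun z => idx z)); rewrite idx_b /= eqxx => ->.
    by rewrite ltn0.
  case: ret => [E|[c bc ca]]; first by rewrite E eqxx in ba.
  pose Rt := [set z in a |: ~: S | conn (a |: ~: S) z a].
  pose I1 := seg a s y.+1 (size s) :|: Rt; pose O1 := seg a s 0 y.
  have aRt : a \in Rt by rewrite inE setU11 conn_refl // setU11.
  have RtP z : z \in Rt -> z = a \/ z \notin S.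
    by rewrite inE in_setU1 in_setC => /andP[/orP[/eqP->|->] _]; [left|right].
  apply: (@star_ext C I1 O1 a) => //.
  - split.
    + apply/setP=> z; apply/setIP/set1P=> [[/setUP[|/RtP[//|zS]]]|->].
      * by rewrite !in_seg => /and3P[_ z1 _] /and3P[_ _ z2]; move: z1 z2; clear; lia.
      * by rewrite in_seg => /andP[zP _]; move: zS; rewrite (subsetP PS) // inP.
      * by rewrite in_setU aRt orbT in_seg mem_head /= eqxx.
    + have cR z : z \in Rt -> conn I1 z a.
        rewrite inE => /andP[_ /conn_coreach]; apply: conn_mono; exact: subsetUr.
      move=> z /setUP[zs|/cR//].
      apply: (@conn_trans _ _ _ (last a s)).
        apply: conn_mono (subsetUl _ _) _; apply: seg_conn => //.
          by rewrite in_seg -inP bP idx_b leqnn andbT.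
        by rewrite idx_b; move: zs; rewrite in_seg => /and3P[].
      have cRt : c \in Rt by rewrite in_set (conn_inl ca).
      apply: conn_trans (cR c cRt).
      apply: conn1 => //; rewrite in_setU; last by rewrite cRt orbT.
      by rewrite in_seg -inP bP idx_b leqnn andbT ys.
    + move=> z zs; have := zs; rewrite in_seg => /and3P[zP _ zy].
      by apply: seg_conn => //; rewrite ?in_seg ?mem_head /= ?eqxx.
  - rewrite subUset segX andbT subUset segX /=; apply/subsetP=> z /RtP[->|zS].
      by rewrite in_setC PX // aP.
    by rewrite in_setC; apply: contra zS; apply: (subsetP X_S).
  - move=> u uC; have /andP[py yq] := Cy u uC.
    have uB : u \in B by have := subsetP sC _ uC; rewrite inE => /andP[].
    rewrite in_setU /I1 /O1; split; first by apply: nth_in_seg; rewrite ?py ?pp_le ?uS.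
    by apply/orP; left; apply: nth_in_seg; rewrite ?qq_le ?uS ?andbT.
have [nbk _|] := leqP n #|bk|.
  have [bA bX] := sBA _ (sub _ : bk \subset _).
  apply: (star_ext bA bX nbk (seg_bset pth un (i := 0) (j := size s) (k := x) _ xs)).
  - by rewrite /= xs.
  - by rewrite subUset !segX.
  move=> u; rewrite inE => /andP[/setIP[uB _] qp]; have := Bx u uB.
  rewrite /lo /hi (minn_idPr qp) (maxn_idPl qp) => /andP[qx xp].
  have := pp_le (uS _ uB); have := qq_le (uS _ uB) => qs ps.
  by split; apply: nth_in_seg; rewrite ?qx ?xp.
have [nf1 _ _|] := leqP n #|f1|.
  apply: (forward x f1 (sub _) _ nf1); last by move=> u; rewrite inE => /andP[].
  have /card_gt0P[u] : 0 < #|f1| by apply: leq_trans nf1; slia.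
  rewrite inE => /andP[/setIP[uB _] /andP[_ xq]]; apply: leq_trans xq _.
  exact: qq_le (uS _ uB).
have [nf2 _ _ _|] := leqP n #|f2|.
  apply: (forward x.-1 f2 (sub _) _ nf2); last by move=> u; rewrite inE => /andP[].
  have /card_gt0P[u] : 0 < #|f2| by apply: leq_trans nf2; slia.
  rewrite inE => /andP[/setIP[uB _] /andP[_ xq]]; apply: leq_trans xq _.
  exact: qq_le (uS _ uB).
move: nB; move: #|B| #|bk| #|f1| #|f2|; clear; lia.
Qed.

End Wide.

(** The chain length for reachability, the chain length for disjoint intervals, and the number of
    intervals that [star_common] needs. *)
Definition wide_bound n := n.*2 * (n.*2 * (3 * n).+1).

(** [mirsky] is applied to reachability off the path, and to the intervals of the resulting
    antichain. A chain in either order gives a closed route; what is left is a family of pairwise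
    intersecting intervals. *)
Theorem wide (D : digraph) (U S R : {set D}) (n : nat) (a : D) (s : seq D) :
  2 < n -> strong (@arc D) S -> path (@arc D) a s -> uniq (a :: s) ->
  [set z in a :: s] \subset S ->
  last a s = a \/ (exists2 c, arc (last a s) c & conn (@arc D) (a |: ~: S) c a) ->
  R \subset U -> R \subset S ->
  {in R &, forall x y, x != y -> conn (@arc D) (S :\: [set z in a :: s]) x y ->
     conn (@arc D) (S :\: [set z in a :: s]) y x -> False} ->
  wide_bound n <= #|R| -> unavoidable U n.
Proof.
move=> n3 stS pth un PS ret RU RS Rsep nR.
have n2 : 0 < n.*2 by rewrite double_gt0; apply: leq_trans n3.
have k2 : 0 < n.*2 * (3 * n).+1 by rewrite muln_gt0 n2.
have [[t [sz st tR]]|[A [AR kA An]]] := mirsky (below S a s) k2 nR.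
  exact: (chain_closed n3 stS pth un PS ret RU Rsep sz st tR).
have [[t [sz st tA]]|[B [BA kB Bn]]] := mirsky (before S a s) (ltn0Sn (3 * n)) kA.
  exact: (disjoint_closed n3 stS pth un PS ret RU RS AR An sz st tA).
have /card_gt0P[u1 u1B] : 0 < #|B| by apply: leq_trans kB.
(* Helly property: the largest left end lies in all the intervals. *)
case: (arg_maxnP (lo S a s) u1B) => u0 u0B umax.
have hl u : u \in B -> hi S a s u <= size s.
  by move=> uB; apply: (hi_le stS PS RS AR); apply: (subsetP BA).
apply: (star_common n3 stS pth un PS ret RU RS AR An BA kB (x := lo S a s u0)).
  exact: leq_trans (lo_hi _ _ _ _) (hl _ u0B).
move=> u uB; apply/andP; split; first exact: umax.
by move: (Bn _ _ uB u0B); rewrite /before -leqNgt.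
Qed.

(** * Rerouting through a component *)

Lemma link_uniq (V : finType) (e : rel V) x q y : link e x q y ->
  exists q', [/\ link e x q' y, uniq q' & {subset q' <= q}].
Proof.
case: q => [|z q]; first by move=> lk; exists [::].
rewrite /link /= rcons_path => /and3P[xz pth]; have [q' pth' un' sub'] := shortenP pth => la.
exists (z :: q'); split=> //; first by rewrite /= xz rcons_path pth'.
by move=> w; rewrite !inE => /orP[->//|/sub' ->]; rewrite orbT.
Qed.

Lemma conn_between (V : finType) (e : rel V) (X : {set V}) x y : conn e X x y ->
  conn e [set w in X | conn e X x w && conn e X w y] x y.
Proof.
move=> c; have [p [pp lp up sp]] := connP c.
have xX := conn_inl c; have sp' : {subset p <= X} by move=> w wp; apply: sp; rewrite inE wp orbT.
set Y := [set w in X | _].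
have pY : {subset x :: p <= Y}.
  move=> w wp; have [c1 c2] := path_conn pp xX sp' wp.
  by rewrite inE sp // c1 -lp.
have xY : x \in Y by apply: pY; rewrite mem_head.
have sY : {subset p <= Y} by move=> w wp; apply: pY; rewrite inE wp orbT.
by have [_] := path_conn pp xY sY (mem_head _ _); rewrite lp.
Qed.

Definition separated (V : finType) (e : rel V) (X R : {set V}) :=
  {in R &, forall x y, x != y -> conn e X x y -> conn e X y x -> False}.

(** Take a largest separated subset [R] of [W]. Every other vertex of [W] lies in the strong
    component of some vertex of [R], so if [R] is small, one of these components is heavy. *)
Lemma heavy_comp (V : finType) (e : rel V) (X W : {set V}) M h : 1 < h -> 0 < M ->
  M * h <= #|W| ->
  (exists R : {set V}, [/\ R \subset W, separated e X R & M <= #|R|]) \/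
  (exists2 v, v \in X & h <= #|W :&: comp e X v|).
Proof.
move=> h1 M0 MW.
pose good (R : {set V}) := (R \subset W) &&
  [forall x in R, forall y in R, [&& x != y, conn e X x y & conn e X y x] ==> false].
have g0 : good set0 by rewrite /good sub0set; apply/forall_inP=> x; rewrite inE.
have goodP R : good R -> R \subset W /\ separated e X R.
  case/andP=> RW /forall_inP H; split=> // x y xR yR xy c1 c2.
  by move/forall_inP: (H x xR) => /(_ y yR); rewrite xy c1 c2.
have [R gR maxR] := @arg_maxnP _ set0 good (fun R => #|R|) g0.
have [RW sR] := goodP R gR.
have [MR|RM] := leqP M #|R|; first by left; exists R.
(* [v] is added by hand because [comp e X v] is empty when [v] lies outside [X]. *)
right; have cov : W \subset \bigcup_(v in R) (v |: (W :&: comp e X v)).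
  apply/subsetP=> u uW; apply/bigcupP; have [uR|uR] := boolP (u \in R).
    by exists u => //; rewrite setU11.
  have [/exists_inP[v vR /andP[c1 c2]]|nex] := boolP [exists v in R, conn e X v u && conn e X u v].
    by exists v => //; rewrite in_setU1 in_setI uW inE c1 c2 orbT.
  have : good (u |: R).
    rewrite /good subUset sub1set uW RW; apply/forall_inP=> x xR; apply/forall_inP=> y yR.
    apply/implyP=> /and3P[xy c1 c2].
    case/setU1P: xR => [xu|xR]; case/setU1P: yR => [yu|yR].
    - by rewrite xu yu eqxx in xy.
    - by case/exists_inP: nex; exists y; rewrite // -xu c1 c2.
    - by case/exists_inP: nex; exists x; rewrite // -yu c1 c2.
    - by case: (sR x y xR yR xy c1 c2).
  by move/maxR; rewrite cardsU1 uR /= add1n ltnn.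
have [/existsP[v /andP[vR hv]]|nex] := boolP [exists v, (v \in R) && (h <= #|v |: (W :&: comp e X v)|)].
  have vX : v \in X.
    apply: contraT => vX; move: hv; suff -> : comp e X v = set0 by rewrite setI0 setU0 cards1 leqNgt h1.
    by apply/setP=> z; rewrite !inE /conn (negPf vX).
  exists v => //; apply: leq_trans hv _; apply: subset_leq_card.
  by rewrite subUset subxx andbT sub1set in_setI comp_self // (subsetP RW).
have : #|W| <= #|R| * h.-1.
  apply: leq_trans (subset_leq_card cov) _.
  apply: leq_trans (_ : \sum_(v in R) #|v |: (W :&: comp e X v)| <= _).
    apply: (big_ind2 (fun (A : {set V}) m => #|A| <= m)) => [|A1 m1 A2 m2 H1 H2|//].
      by rewrite cards0.
    by apply: leq_trans (leq_card_setU _ _).1 _; apply: leq_add.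
  rewrite -sum_nat_const; apply: leq_sum => v vR.
  by move: nex; rewrite negb_exists => /forallP/(_ v); rewrite vR /= -ltnNge; case: (h) h1 => // k _; rewrite ltnS.
move: MW RM h1; move: #|W| #|R| => w r; clear.
move=> MW rM h1 wr; have : M * h <= M * h.-1.
  by apply: leq_trans MW _; apply: leq_trans wr _; rewrite leq_mul2r (ltnW rM) orbT.
by rewrite leq_pmul2l ?(leq_ltn_trans _ rM) //; case: (h) h1 => // k _; rewrite ltnn.
Qed.

Section Back.
Variables (D : digraph) (U : {set D}) (n : nat).
Hypothesis n3 : 2 < n.
Local Notation e := (@arc D).
Local Notation conn := (conn (@arc D)).
Let M := wide_bound n.

Lemma M_gt0 : 0 < M.
Proof. by rewrite /M /wide_bound !muln_gt0 double_gt0 (leq_trans _ n3). Qed.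

Definition returns (S : {set D}) (a b : D) :=
  b = a \/ exists2 c, e b c & conn (a |: ~: S) c a.

Variables (S : {set D}) (a b : D).
Hypothesis stS : strong e S.
Hypothesis ret : returns S a b.

Definition rpath (S : {set D}) (a b : D) (s : seq D) :=
  [/\ path e a s, uniq (a :: s), last a s = b & {subset a :: s <= S}].

Definition backward (h : nat) := exists s v,
  [/\ rpath S a b s, v \in S :\: [set z in a :: s],
      h <= #|U :&: comp e (S :\: [set z in a :: s]) v| & qq S a s v <= pp S a s v].

(* A path from a to b is rerouted through the strong set K: it consists of sA *)
(* outside K, then of any path in K from x to y, then of sB outside K.  No    *)
(* walk leaves K and comes back to K without meeting sA or sB.                *)
Record reroute (K : {set D}) (x y : D) (sA sB : seq D) (R : {set D}) : Prop := Reroute {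
  rr_strong : strong e K;
  rr_sub : K \subset S;
  rr_x : x \in K;
  rr_y : y \in K;
  rr_pathA : sorted e (rcons sA x);
  rr_pathB : path e y sB;
  rr_a : head x sA = a;
  rr_b : last y sB = b;
  rr_uniq : uniq (sA ++ sB);
  rr_out : {in sA ++ sB, forall z, z \in S /\ z \notin K};
  rr_ret : returns K x y;
  rr_sep : forall u v w, u \in K -> v \notin K -> w \in K ->
    conn (S :\: [set z in sA ++ sB]) u v -> conn (S :\: [set z in sA ++ sB]) v w -> False;
  rr_rank : R \subset U :&: (S :\: K);
  rr_ranksep : separated e (S :\: [set z in sA ++ sB]) R }.

(** The path in [K] is completed by [sA] and [sB]. These avoid [K], so the walks in [K] off the
    inner path are also off the whole path, and positions are shifted by the length of [sA]. *)
Lemma reroute_path K x y sA sB R t : reroute K x y sA sB R -> rpath K x y t ->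
  exists s, [/\ a :: s = sA ++ (x :: t) ++ sB, rpath S a b s
    & forall v i, v \in K -> (orig K x t v i -> orig S a s v (size sA + i)) /\
        (land K x t v i -> land S a s v (size sA + i))].
Proof.
move=> [stK KS xK yK pA pB ha lb un out retK sep rk rks] [pt ut lt tK].
have [s Es] : exists s, a :: s = sA ++ (x :: t) ++ sB.
  by case: sA ha {pA un out sep rks} => [|z sA] /= <-; [exists (t ++ sB)|exists (sA ++ x :: t ++ sB)].
have us : uniq (a :: s).
  rewrite Es uniq_catCA cat_uniq ut un andbT /=; apply/hasPn=> z /out[_ zK].
  by apply: contra zK; apply: tK.
have subS : {subset a :: s <= S}.
  move=> z; rewrite Es !mem_cat => /or3P[zA|zt|zB].
  - by have [] := out z; rewrite // mem_cat zA.
  - by apply: (subsetP KS); apply: tK.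
  - by have [] := out z; rewrite // mem_cat zB orbT.
have pts : path e a s.
  have : sorted e (a :: s); last by [].
  rewrite Es; case: sA ha pA {un out sep rks Es} => [|z sA] /= ha pA.
    by rewrite cat_path pt lt pB.
  by rewrite cat_path /= cat_path lt pB andbT pt andbT -rcons_path.
have ls : last a s = b.
  have : last x (a :: s) = b; last by [].
  by rewrite Es !last_cat /= lt lb.
exists s; split=> // v i vK.
have sub : K :\: [set z in x :: t] \subset S :\: [set z in a :: s].
  apply/subsetP=> z; rewrite !in_setD !in_set Es !mem_cat !negb_or => /andP[zt zK].
  rewrite zt (subsetP KS) // andbT /=; apply/andP; split.
    by apply/negP=> zA; have [|_] := out z; rewrite ?mem_cat ?zA ?zK.
  by apply/negP=> zA; have [|_] := out z; rewrite ?mem_cat ?zA ?orbT ?zK.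
have E : i <= size t -> nth a (a :: s) (size sA + i) = nth x (x :: t) i.
  move=> it; rewrite Es nth_cat ltnNge leq_addr addKn (nth_cat a (x :: t)) /= ltnS it.
  by apply: set_nth_default; rewrite ltnS.
have sz : i <= size t -> size sA + i <= size s.
  by move=> it; rewrite -ltnS -[(size s).+1]/(size (a :: s)) Es !size_cat /=; slia.
split=> /andP[it c]; rewrite /orig /land sz //= E //; apply: conn_mono c; exact: setUS.
Qed.

Lemma last_take i s0 (z : D) : i <= size s0 -> last z (take i s0) = nth z (z :: s0) i.
Proof.
elim: s0 i z => [|w s0 IH] [|i] z //= si; rewrite IH //.
by case: i si => //= i si; apply: set_nth_default.
Qed.

(** If a heavy component off the path has its last origin before its first landing, the path is
    rerouted through it between these two vertices, and the component replaces [K]. If vertices of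
    [U] are lost in this, one of them joins [R]; as no walk off the fixed parts leaves [K] and comes
    back, it is separated from the earlier members. Once [R] has [M] members, [wide] applies, and
    this bounds how often the weight drops by the factor [M]. *)
Lemma back_induction h m (K R : {set D}) (x y : D) (sA sB : seq D) : 1 < h -> #|K| < m -> reroute K x y sA sB R ->
  #|R| <= M -> h * M ^ (M - #|R|).+1 <= #|U :&: K| -> unavoidable U n \/ backward h.
Proof.
move=> h1; elim: m => // m IH in K x y sA sB R *; rewrite ltnS => Km rr RM hK.
have [stK KS xK yK pA pB ha lb unAB out retK sep rk rks] := rr.
have [t [pt ut lt tK]] : exists t, rpath K x y t.
  by have [t [? ? ? ?]] := connP (stK _ _ xK yK); exists t.
have [s [Es [ps us ls sS] pos]] := reroute_path rr (And4 pt ut lt tK).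
have sS' : [set z in a :: s] \subset S by apply/subsetP=> z; rewrite inE => /sS.
have tK' : [set z in x :: t] \subset K by apply/subsetP=> z; rewrite inE => /tK.
have ret' : returns S a (last a s) by rewrite ls.
have [MR|RM'] := leqP M #|R|.
  left; apply: (wide n3 stS ps us sS' ret' _ _ _ MR).
  - by apply: subset_trans rk (subsetIl _ _).
  - by apply: subset_trans rk _; apply: subset_trans (subsetIr _ _) (subsetDl _ _).
  - have sub : S :\: [set z in a :: s] \subset S :\: [set z in sA ++ sB].
      apply: setDS; apply/subsetP=> z; rewrite !in_set Es !mem_cat => /orP[]->; rewrite ?orbT //.
    by move=> u v uR vR uv c1 c2; apply: (rks u v uR vR uv); apply: conn_mono sub _.
have retK' : returns K x (last x t) by rewrite lt.
set X := K :\: [set z in x :: t].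
(* The weight that is still required after one more vertex has joined [R]. *)
pose h' := h * M ^ (M - #|R|).
have Mp k : 0 < M ^ k by rewrite expn_gt0 M_gt0.
have hh' : h <= h' by rewrite leq_pmulr.
have [|[R' [R'W R'sep MR']]|[v vX hv]] := @heavy_comp _ e X (U :&: K) M h' (leq_trans h1 hh') M_gt0.
- by apply: leq_trans hK; rewrite expnS mulnCA.
- left; apply: (wide n3 stK pt ut tK' retK' _ _ _ MR') => //.
    exact: subset_trans R'W (subsetIl _ _).
  exact: subset_trans R'W (subsetIr _ _).
have XK : X \subset K by apply: subsetDl.
have vK : v \in K by apply: (subsetP XK).
have vS : v \in S by apply: (subsetP KS).
have [oK _] := origP stK tK' vK; have [lK lKmin] := landP stK tK' vK.
have XX : X \subset S :\: [set z in a :: s].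
  apply/subsetP=> z; rewrite !in_setD !in_set Es !mem_cat !negb_or => /andP[zt zK].
  rewrite zt (subsetP KS) // andbT /=; apply/andP; split.
    by apply/negP=> zA; have [|_] := out z; rewrite ?mem_cat ?zA ?zK.
  by apply/negP=> zA; have [|_] := out z; rewrite ?mem_cat ?zA ?orbT ?zK.
have [qp|pq] := leqP (qq K x t v) (pp K x t v).
  right; exists s, v; split=> //; first exact: (subsetP XX).
    apply: leq_trans hh' _; apply: leq_trans hv _; apply: subset_leq_card.
    apply: setISS; first exact: subsetIl.
    by apply/subsetP=> z; rewrite !inE => /andP[c1 c2]; rewrite !(conn_mono XX).
  have [_ omax] := origP stS sS' vS; have [_ lmin] := landP stS sS' vS.
  apply: leq_trans (lmin _ ((pos _ _ vK).2 lK)) _.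
  apply: leq_trans (omax _ ((pos _ _ vK).1 oK)).
  by rewrite leq_add2l.
set p := pp K x t v in oK pq; set q := qq K x t v in lK lKmin pq.
have /andP[pst cp] := oK; have /andP[qst cq] := lK.
set pt_p := nth x (x :: t) p in cp; set pt_q := nth x (x :: t) q in cq.
have pPt : pt_p \in x :: t by apply: mem_nth.
have qPt : pt_q \in x :: t by apply: mem_nth.
set K2 := comp e X v in hv.
have K2X : K2 \subset X by apply: comp_sub.
have vK2 : v \in K2 by apply: comp_self.
have nPX z : z \in x :: t -> z \notin X by move=> zt; rewrite in_setD in_set zt.
have dp z : z \in x :: t -> [disjoint [set z] & K2].
  by move=> zP; rewrite disjoints1; apply: contra (nPX z zP); apply/subsetP.
have [x1 [q1 [k1 [/setIP[/set1P-> _] /setIP[k1K _] lk1 q1X]]]] :=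
  link_exists (set11 _) vK2 cp (dp _ pPt).
have dq : [disjoint K2 & [set pt_q]] by rewrite disjoint_sym; apply: dp.
have [k2 [q2 [x2 [/setIP[k2K _] /setIP[/set1P-> _] lk2 q2X]]]] :=
  link_exists vK2 (set11 _) cq dq.
have {}q1X : {in q1, forall z, z \in X /\ z \notin K2}.
  by move=> z /q1X[+ + zK]; rewrite in_setU1 in_set1 => /orP[->//|].
have {}q2X : {in q2, forall z, z \in X /\ z \notin K2}.
  by move=> z /q2X[+ zK +]; rewrite in_setU1 in_set1 => /orP[->//|].
have q12 := links_disjoint lk1 lk2 k1K k2K q1X (fun z zq => (q2X z zq).1).
have [r1 [lkr1 ur1 sr1]] := link_uniq lk1; have [r2 [lkr2 ur2 sr2]] := link_uniq lk2.
have r1X z : z \in r1 -> z \in X /\ z \notin K2 by move/sr1/q1X.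
have r2X z : z \in r2 -> z \in X /\ z \notin K2 by move/sr2/q2X.
have K2K : K2 \subset K by apply: subset_trans K2X XK.
pose w := take (size sA + p) s.
have Ew : a :: w = sA ++ x :: take p t.
  rewrite -[LHS]/(take (size sA + p).+1 (a :: s)) Es take_cat ltnNge leqW ?leq_addr //=.
  rewrite subSn ?leq_addr // addKn /= takel_cat //.
have lw : last a w = pt_p.
  have -> : last a w = last a (a :: w) by [].
  by rewrite Ew last_cat /= last_take.
pose sA' := a :: w ++ r1; pose sB' := rcons r2 pt_q ++ (drop q t ++ sB).
have ltq : last x (take q t) = pt_q by rewrite last_take.
have in1 z : z \in x :: take p t = (z \in x :: t) && (index z (x :: t) <= p).
  have [zt|zt] := boolP (z \in x :: t); first by rewrite -[x :: take p t]/(take p.+1 (x :: t)) in_take.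
  by apply: contraNF zt; rewrite -[x :: take p t]/(take p.+1 (x :: t)); apply: mem_take.
have in2 z : z \in pt_q :: drop q t = (z \in x :: t) && (q <= index z (x :: t)).
  have -> : pt_q :: drop q t = drop q (x :: t) by rewrite (drop_nth x (n := q) (s := x :: t)).
  have [zt|zt] := boolP (z \in x :: t); last by apply: contraNF zt; apply: mem_drop.
  have := ut; rewrite -{1}(cat_take_drop q (x :: t)) cat_uniq => /and3P[_ /hasPn H _].
  rewrite leqNgt -in_take //=; apply/idP/negP=> [/H/negP//|zn].
  by move: zt; rewrite -{1}(cat_take_drop q (x :: t)) mem_cat; case/orP.
have inA z : z \in sA' = [|| z \in sA, (z \in x :: t) && (index z (x :: t) <= p) | z \in r1].
  by rewrite /sA' -cat_cons mem_cat Ew mem_cat in1 -orbA.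
have inB z : z \in sB' = [|| z \in r2, (z \in x :: t) && (q <= index z (x :: t)) | z \in sB].
  by rewrite /sB' cat_rcons -cat_cons !mem_cat in2.
have KAB z : z \in K -> (z \notin sA) && (z \notin sB).
  move=> zK; rewrite -negb_or -mem_cat; apply/negP=> /out[_].
  by rewrite zK.
have tX z : z \in x :: t -> z \notin K2.
  by move=> zt; apply: contra (nPX z zt); apply/subsetP.
have out' : {in sA' ++ sB', forall z, z \in S /\ z \notin K2}.
  have oK2 z : z \in sA ++ sB -> z \in S /\ z \notin K2.
    by move=> /out[-> zK]; split=> //; apply: contra zK; apply: (subsetP K2K).
  have oX z : z \in X -> z \in S by move/(subsetP XK)/(subsetP KS).
  move=> z; rewrite mem_cat inA inB => /orP[/or3P[zA|/andP[zt _]|zr]|/or3P[zr|/andP[zt _]|zB]].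
  - by apply: oK2; rewrite mem_cat zA.
  - by split; [apply: (subsetP KS); apply: tK|apply: tX].
  - by have [/oX] := r1X z zr.
  - by have [/oX] := r2X z zr.
  - by split; [apply: (subsetP KS); apply: tK|apply: tX].
  - by apply: oK2; rewrite mem_cat zB orbT.
have subY : S :\: [set z in sA' ++ sB'] \subset S :\: [set z in sA ++ sB].
  apply: setDS; apply/subsetP=> z; rewrite !in_set (mem_cat z sA) (mem_cat z sA') inA inB => /orP[]->//.
  by rewrite !orbT.
have lsdrop : last pt_q (drop q t) = y.
  by rewrite -ltq -last_cat cat_take_drop.
have inX z : z \in K -> z \notin x :: t -> z \in X by move=> zK zt; rewrite in_setD in_set zt.
have uX u : u \in K2 -> u \in X /\ conn X v u.
  by move=> uK; split; [apply: (subsetP K2X)|move: uK; rewrite inE => /andP[]].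
pose Y := S :\: [set z in sA' ++ sB'].
(* A walk off the new path that starts and ends in [K2] stays in [X]: by [sep] it does not leave
   [K], and a first vertex on the inner path would be a landing, hence at position [q] or later and
   thus in [sB']. *)
have stayX z0 z1 w0 u0 : u0 \in K2 -> conn X u0 z0 -> w0 \in K2 -> conn Y z0 z1 -> conn Y u0 z0 ->
    conn Y z1 w0 -> conn X z0 z1.
  move=> u0K cu0 w0K c1 c0 c2; have := conn_between c1; set Z := [set _ in _ | _] => cZ.
  apply: (@conn_ind _ _ Z (fun z => conn X z0 z) z0 z1 cZ); first exact: conn_refl (conn_inr cu0).
  move=> z z' zZ z'Z zz' cz.
  have z'K : z' \in K.
    apply: contraT => z'K; move: z'Z; rewrite inE => /and3P[_ c3 c4].
    case: (sep u0 z' w0) => //; try exact: (subsetP K2K).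
      exact: conn_mono subY (conn_trans c0 c3).
    exact: conn_mono subY (conn_trans c4 c2).
  apply: (conn_trans cz); apply: conn1 => //; first exact: conn_inr cz.
  apply: inX => //; apply/negP=> z't.
  have : q <= index z' (x :: t).
    apply: lKmin; rewrite /land -ltnS -[(size t).+1]/(size (x :: t)) index_mem z't nth_index //=.
    have [u0X cv] := uX u0 u0K.
    have sub : X \subset z' |: X by apply: subsetUr.
    apply: (@conn_trans _ _ _ z).
      exact: conn_mono sub (conn_trans cv (conn_trans cu0 cz)).
    apply: conn1 => //; last exact: setU11.
    by apply: (subsetP sub); apply: conn_inr cz.
  move=> qz; move: z'Z; rewrite inE => /andP[+ _].
  by rewrite in_setD in_set (mem_cat z' sA') inB z't qz !orbT.
have sep2 u v0 w0 : u \in K2 -> v0 \notin K2 -> w0 \in K2 -> conn Y u v0 -> conn Y v0 w0 -> False.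
  move=> uK /negP v0K w0K c1 c2; apply: v0K.
  have cu : conn X u u by apply: conn_refl; apply: (uX u uK).1.
  have c3 : conn X u v0 := stayX u v0 w0 u uK cu w0K c1 (conn_refl _ (conn_inl c1)) c2.
  have c4 : conn X v0 w0 := stayX v0 w0 w0 u uK c3 w0K c2 c1 (conn_refl _ (conn_inr c2)).
  by apply: (comp_fullP uK c3); apply: conn_trans c4 (comp_conn w0K uK).
have toC z : z \notin K2 -> z \in k1 |: ~: K2 by move=> zK; rewrite in_setU1 in_setC zK orbT.
have ret2 : returns K2 k1 k2.
  right; have [c crq k2c] := link_first lkr2; exists c => //.
  have r2C : {subset r2 <= k1 |: ~: K2} by move=> z /r2X[_ zK]; apply: toC.
  have r1C : {subset r1 <= k1 |: ~: K2} by move=> z /r1X[_ zK]; apply: toC.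
  have tC z : z \in x :: t -> z \in k1 |: ~: K2 by move/tX/toC.
  have c1 : conn (k1 |: ~: K2) c pt_q.
    move: crq; rewrite mem_rcons inE => /orP[/eqP->|cr]; first exact: conn_refl (tC _ qPt).
    by have [_] := link_conn lkr2 r2C cr; apply; apply: tC.
  have tn k : k <= size t -> nth x (x :: t) k \in k1 |: ~: K2.
    by move=> kt; apply: tC; apply: mem_nth.
  have c2 : conn (k1 |: ~: K2) pt_q y.
    have <- : nth x (x :: t) (size t) = y by rewrite -lt (last_nth x).
    by apply: nth_path_conn; rewrite ?qst //= => k /andP[_]; apply: tn.
  have c3 : conn (k1 |: ~: K2) y x.
    case: retK => [->|[c' yc' c'x]]; first by apply: conn_refl; apply: tC; rewrite mem_head.
    have sub : x |: ~: K \subset k1 |: ~: K2.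
      rewrite subUset sub1set tC ?mem_head //=; apply/subsetP=> z; rewrite in_setC => zK.
      by apply: toC; apply: contra zK; apply: (subsetP K2K).
    apply: conn_trans (conn_mono sub c'x); apply: conn1 yc'; first exact: conn_inr c2.
    exact: (subsetP sub) (conn_inl c'x).
  have c4 : conn (k1 |: ~: K2) x pt_p.
    have -> : x = nth x (x :: t) 0 by [].
    by apply: nth_path_conn; rewrite ?pst //= => k kp; apply: tn; apply: leq_trans kp pst.
  have c5 : conn (k1 |: ~: K2) pt_p k1.
    have k1C : k1 \in k1 |: ~: K2 by apply: setU11.
    have [z zr pz] := link_first lkr1.
    apply: (@conn_trans _ _ _ z).
      apply: conn1 => //; first exact: tC.
      by move: zr; rewrite mem_rcons inE => /orP[/eqP->|/r1C].
    move: zr; rewrite mem_rcons inE => /orP[/eqP->|zr]; first exact: conn_refl.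
    by have [_] := link_conn lkr1 r1C zr; apply.
  exact: conn_trans c1 (conn_trans c2 (conn_trans c3 (conn_trans c4 c5))).
have uniqA : uniq sA'.
  rewrite /sA' -cat_cons cat_uniq ur1 andbT; apply/andP; split.
    exact: (@take_uniq _ (a :: s) (size sA + p).+1).
  apply/hasPn=> z zr; have [zX _] := r1X z zr; rewrite Ew mem_cat in1 negb_or.
  have := KAB z (subsetP XK _ zX) => /andP[-> _] /=.
  by rewrite negb_and; apply/orP; left; apply: contraL zX; apply: nPX.
have uniqB : uniq sB'.
  rewrite /sB' cat_rcons -cat_cons cat_uniq ur2 andTb; apply/andP; split.
    apply/hasPn=> z; rewrite mem_cat in2 => zz; apply/negP=> /r2X[zX _].
    have := KAB z (subsetP XK _ zX) => /andP[_ /negPf zB].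
    by move: zz; rewrite zB orbF => /andP[/nPX]; rewrite zX.
  have -> : pt_q :: drop q t = drop q (x :: t) by rewrite (drop_nth x (n := q) (s := x :: t)).
  have := us; rewrite Es -{1}(cat_take_drop q (x :: t)) -catA cat_uniq => /and3P[_ _].
  by rewrite cat_uniq => /and3P[].
have uniqAB : uniq (sA' ++ sB').
  rewrite cat_uniq uniqA uniqB andbT; apply/hasPn=> z; rewrite inB => zB; apply/negP; rewrite inA => zA.
  have AtF : z \in sA -> z \in x :: t -> False.
    by move=> zA' /tK zK; have /andP[/negP] := KAB z zK.
  have BtF : z \in sB -> z \in x :: t -> False.
    by move=> zA' /tK zK; have /andP[_ /negP] := KAB z zK.
  have AXF : z \in sA -> z \in X -> False.
    by move=> zA' /(subsetP XK) zK; have /andP[/negP] := KAB z zK.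
  have BXF : z \in sB -> z \in X -> False.
    by move=> zA' /(subsetP XK) zK; have /andP[_ /negP] := KAB z zK.
  case/or3P: zA => [zA|/andP[zt zp]|/[dup] zr /r1X[zX _]];
    case/or3P: zB => [/[dup] zr' /r2X[zX' _]|/andP[zt' zq]|zB].
  - exact: AXF zA zX'.
  - exact: AtF zA zt'.
  - by move: unAB; rewrite cat_uniq => /and3P[_ /hasPn/(_ z zB)/negP].
  - by move: (nPX z zt); rewrite zX'.
  - by have := leq_trans zq zp; rewrite leqNgt pq.
  - exact: BtF zB zt.
  - by move: (q12 z (sr1 z zr)); rewrite sr2.
  - by move: (nPX z zt'); rewrite zX.
  - exact: BXF zB zX.
have pathA : sorted e (rcons sA' k1).
  rewrite /sA' -[sorted _ _]/(path e a (rcons (w ++ r1) k1)) rcons_cat cat_path lw.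
  by rewrite take_path //= .
have pathB : path e k2 sB'.
  rewrite /sB' cat_path last_rcons cat_path lsdrop pB andbT; apply/andP; split; first exact: lkr2.
  by move: pt; rewrite -{1}(cat_take_drop q t) cat_path ltq => /andP[].
have newrr (R2 : {set D}) : R2 \subset U :&: (S :\: K2) -> separated e Y R2 ->
    reroute K2 k1 k2 sA' sB' R2.
  move=> RU2 Rs2; split=> //.
  - exact: comp_strong.
  - exact: subset_trans K2K KS.
  - by rewrite /sB' !last_cat last_rcons lsdrop.
have sepR : separated e Y R.
  by move=> z z' zR z'R ne c1 c2; apply: (rks z z' zR z'R ne); apply: conn_mono subY _.
have SKK : S :\: K \subset S :\: K2 by apply: setDS.
have K2m : #|K2| < m.
  apply: leq_trans Km; apply: proper_card; apply/properP; split=> //; exists x => //.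
  by apply: tX; rewrite mem_head.
(* If no vertex of [U] is lost, only [K] shrinks; otherwise a lost vertex is charged to [R]. *)
have [E|[u uKK]] := set_0Vmem ((U :&: K) :\: K2).
  apply: (IH K2 k1 k2 sA' sB' R K2m _ RM).
    by apply: newrr => //; apply: subset_trans rk _; apply: setIS.
  apply: leq_trans hK _; apply: subset_leq_card; apply/subsetP=> z zUK.
  have zU : z \in U by move: zUK; rewrite in_setI => /andP[].
  rewrite in_setI zU /=; apply: contraT => zK2.
  by move/setP/(_ z): E; rewrite in_setD zK2 zUK in_set0.
move: uKK; rewrite in_setD in_setI => /and3P[uK2 uU uK].
have uR : u \notin R.
  by apply/negP=> /(subsetP rk); rewrite in_setI in_setD uK andbF.
have RK z : z \in R -> z \notin K.
  by move/(subsetP rk); rewrite in_setI in_setD => /and3P[].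
apply: (IH K2 k1 k2 sA' sB' (u |: R) K2m).
- apply: newrr.
    rewrite subUset sub1set in_setI in_setD uU uK2 (subsetP KS) //=.
    by apply: subset_trans rk _; apply: setIS.
  have sepu z : z \in R -> conn Y u z -> conn Y z u -> False.
    move=> zR c1 c2; apply: (sep u z u uK (RK z zR) uK); exact: conn_mono subY _.
  move=> z z' /setU1P[->|zR] /setU1P[->|z'R] ne c1 c2; first by rewrite eqxx in ne.
  - exact: sepu z'R c1 c2.
  - exact: sepu zR c2 c1.
  - exact: sepR zR z'R ne c1 c2.
- by rewrite cardsU1 uR.
rewrite cardsU1 uR add1n -subSn //.
apply: leq_trans hv _; apply: subset_leq_card; apply/subsetP=> z.
by rewrite !in_setI => /andP[/andP[-> _] ->].
Qed.

Theorem back h : 1 < h -> a \in S -> b \in S -> h * M ^ M.+1 <= #|U :&: S| ->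
  unavoidable U n \/ backward h.
Proof.
move=> h1 aS bS hS; apply: (@back_induction h #|S|.+1 S set0 a b [::] [::] h1) => //.
- split=> //.
  + by move=> u v w uS /negP vS _ c _; apply: vS; have := conn_inr c; rewrite in_setD => /andP[].
  + exact: sub0set.
  + by move=> z; rewrite inE.
- by rewrite cards0.
by rewrite cards0 subn0.
Qed.


End Back.

(** * Chains of branch sets *)

Lemma disjUl (V : finType) (A B C : {set V}) :
  [disjoint A :|: B & C] = [disjoint A & C] && [disjoint B & C].
Proof. by rewrite -!setI_eq0 setIUl setU_eq0. Qed.

Lemma disjUr (V : finType) (A B C : {set V}) :
  [disjoint C & A :|: B] = [disjoint C & A] && [disjoint C & B].
Proof. by rewrite -!setI_eq0 setIUr setU_eq0. Qed.

Section Chains.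
Variables (V : finType) (U : {set V}).
Implicit Types (e : rel V) (A B I O L : {set V}) (a b s t u r : V).

(* The ear of [chain_ear] is a tooth leg on one of the two connections        *)
(* between the core (I1, O1) and the next core (I2, O2): on the inward one if *)
(* [d] and on the outward one otherwise.                                      *)
Inductive chain e : {set V} -> V -> V -> nat -> nat -> nat -> Prop :=
| chain_base A B I O r l s t : leg e B I O r l -> s \in I -> t \in O -> B \subset A ->
    chain e A s t 0 0 0
| chain_core A A' B I O r l (c : bool) s t a b p f q : chain e A a b p f q ->
    leg e B I O r l -> (c -> r \in U) -> arcs e O [set a] -> arcs e [set b] I ->
    s \in I -> t \in O -> [disjoint B & A] -> B :|: A \subset A' ->
    chain e A' s t (p + c) f q
| chain_ear A A' B1 I1 O1 r1 l1 L I O u l B2 I2 O2 r2 l2 (d : bool) s t a b p f q :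
    chain e A a b p f q ->
    leg e B1 I1 O1 r1 l1 -> arcs e O1 [set a] -> arcs e [set b] I1 ->
    leg e L I O u l -> u \in U -> leg e B2 I2 O2 r2 l2 -> s \in I2 -> t \in O2 ->
    (if d then [/\ arcs e O2 I, arcs e O I1 & arcs e O1 I2]
     else [/\ arcs e O1 I, arcs e O I2 & arcs e O2 I1]) ->
    [disjoint B1 & A] -> [disjoint L & B1 :|: A] -> [disjoint B2 & L :|: (B1 :|: A)] ->
    B2 :|: (L :|: (B1 :|: A)) \subset A' ->
    chain e A' s t p (f + d) (q + ~~ d).

Lemma chain_sub e A A' s t p f q : A \subset A' -> chain e A s t p f q -> chain e A' s t p f q.
Proof.
move=> sA c; case: c sA => {A s t p f q}.
- by move=> A B I O r l s t lg sI tO sB sA; apply: chain_base lg sI tO (subset_trans sB sA).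
- move=> A A1 B I O r l c s t a b p f q ch lg cU a1 a2 sI tO d sB sA.
  exact: chain_core ch lg cU a1 a2 sI tO d (subset_trans sB sA).
move=> A A1 B1 I1 O1 r1 l1 L I O u l B2 I2 O2 r2 l2 d s t a b p f q ch lg1 a1 a2 lg uU lg2 sI tO ar d1 d2 d3 sB sA.
exact: chain_ear ch lg1 a1 a2 lg uU lg2 sI tO ar d1 d2 d3 (subset_trans sB sA).
Qed.

(** Reversal exchanges entrance and exit, and inward and outward ears. *)
Lemma chain_rev e A s t p f q : chain e A s t p f q -> chain (revr e) A t s p q f.
Proof.
elim=> {A s t p f q}.
- by move=> A B I O r l s t /leg_rev lg sI tO sB; apply: chain_base lg tO sI sB.
- move=> A A1 B I O r l c s t a b p f q _ IH /leg_rev lg cU a1 a2 sI tO d sB.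
  by apply: (chain_core IH lg cU _ _ tO sI d sB); apply/arcs_rev.
move=> A A1 B1 I1 O1 r1 l1 L I O u l B2 I2 O2 r2 l2 d s t a b p f q _ IH /leg_rev lg1 a1 a2
  /leg_rev lg uU /leg_rev lg2 sI tO ar d1 d2 d3 sB.
rewrite -{2}[d]negbK; apply: (chain_ear IH lg1 _ _ lg uU lg2 tO sI _ d1 d2 d3 sB); try exact/arcs_rev.
by case: d ar => -[? ? ?]; split; apply/arcs_rev.
Qed.

(** The teeth that survive for each kind of comb: those at cores without triangles, the inward or
    the outward ears with triangles of the respective orientation. *)
Definition chain_count (k : option bool) (p f q : nat) :=
  match k with None => p | Some false => f | Some true => q end.

(** Cores become beads, listed from the outermost inwards. An ear of the selected kind forms a
    triangle with the two cores it connects; an ear of another kind is a mere walk that joins a tree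
    of the outer core. The innermost core is always plain. *)
Lemma chain_beads e k A s t p f q : chain e A s t p f q ->
  exists (b0 : bead V) bs, [/\ beads e U k A (b0 :: bs), s \in pI b0 true, t \in pO b0 true,
    count (@bf _) (b0 :: bs) = chain_count k p f q & k != None -> ~~ bf (last b0 bs)].
Proof.
pose plain B I O r := Bead B B I O r 0 false (fun=> I) (fun=> O).
have plain_ok B I O r l : leg e B I O r l -> exists r', bead_ok e U k (plain B I O r').
  case/leg_bset=> -[r' b sB]; exists r'; split=> //=; first exact: leg0.
  by case: k.
elim=> {A s t p f q}.
- move=> A B I O r l s t lg sI tO sB; have [r' ok] := plain_ok _ _ _ _ _ lg.
  exists (plain B I O r'), [::]; split=> //=; first exact: beads1.
  by case: k {ok plain_ok} => [[]|].
- move=> A A1 B I O r l c s t a b p f q _ [b0 [bs [bds aI bO cnt lst]]] lg cU a1 a2 sI tO d sB.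
  have [BA1 AA1] : B \subset A1 /\ A \subset A1.
    by split; apply: subset_trans sB; rewrite ?subsetUl ?subsetUr.
  have lk (x : bead V) : pI x = (fun=> I) -> pO x = (fun=> O) -> linked e x b0.
    move=> E1 E2; split; rewrite ?E1 ?E2.
      by apply: arcs_sub a1; rewrite ?sub1set.
    by apply: arcs_sub a2; rewrite ?sub1set.
  have [r' ok] := plain_ok _ _ _ _ _ lg.
  have unflagged : chain_count k (p + c) f q = chain_count k p f q ->
      exists (b1 : bead V) bs1, [/\ beads e U k A1 (b1 :: bs1), s \in pI b1 true, t \in pO b1 true,
    count (@bf _) (b1 :: bs1) = chain_count k (p + c) f q & k != None -> ~~ bf (last b1 bs1)].
    move=> E; exists (plain B I O r'), (b0 :: bs); split=> //; last by rewrite E -cnt.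
    by apply: (beadsS bds ok) => //; apply: lk.
  case: c cU unflagged => cU unflagged; last by apply: unflagged; rewrite addn0.
  case: k {ok plain_ok} lst cnt bds unflagged => [sg|] lst cnt bds unflagged; first by apply: unflagged; case: (sg).
  exists (Bead B B I O r l true (fun=> I) (fun=> O)), (b0 :: bs); split=> //=.
    by apply: (beadsS bds) => //; first [by apply: lk|by split=> //; split=> // _; apply: cU].
  by move: cnt => /= ->; rewrite addnC.
move=> A A1 B1 I1 O1 r1 l1 L I O u l B2 I2 O2 r2 l2 d s t a b p f q _ [b0 [bs [bds aI bO cnt lst]]]
  lg1 a1 a2 lg uU lg2 sI tO ar d1 d2 d3 sB.
move: d2 d3; rewrite !disjUr => /andP[dL1 dLA] /and3P[d2L d21 d2A].
move: sB; rewrite !subUset => /and4P[B2A1 LA1 B1A1 AA1].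
have [r1' ok1] := plain_ok _ _ _ _ _ lg1.
have [[r1'' bs1] s1] := leg_bset lg1; have [[r2'' bs2] s2] := leg_bset lg2.
have [_ sIO] := leg_bset lg; move: (sIO); rewrite subUset => /andP[sIL sOL].
have lk (x : bead V) : pI x false = I1 -> pO x false = O1 -> linked e x b0.
  move=> E1 E2; split; rewrite ?E1 ?E2.
    by apply: arcs_sub a1; rewrite ?sub1set.
  by apply: arcs_sub a2; rewrite ?sub1set.
(* With orientation [~~ d] the three connections at the ear are exactly the arcs of
   [triangle_bead]. *)
have [/eqP E|ne] := boolP (k == Some (~~ d)); last first.
  have : exists I' O', [/\ leg e (L :|: B2) I' O' r2 l2, arcs e O' I1, arcs e O1 I', s \in I' & t \in O'].
    case: d ar {ne} => -[ar1 ar2 ar3].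
      have [x [z [xO zI xz]]] := ar1; have [y [w [yO wI yw]]] := ar2.
      pose J := [set v in L | conn e L z v].
      have zL : z \in L by apply: (subsetP sIL).
      have zJ : z \in J by rewrite inE zL conn_refl.
      have JL : J \subset L by apply/subsetP=> v; rewrite inE => /andP[].
      exists I2, (J :|: O2); split=> //.
      - apply: leg_sub (leg_extO lg2 _ _).
        + by rewrite setSU.
        + by rewrite disjoint_sym; apply: disjointWr d2L.
        move=> v vJ; exists x => //; apply: (@conn_trans _ _ _ z).
          by apply: conn1 xz; rewrite in_setU ?xO ?zJ ?orbT.
        move: vJ; rewrite inE => /andP[_ /conn_reach]; apply: conn_mono; exact: subsetUl.
      - exists y, w; split=> //; rewrite in_setU inE (subsetP sOL) //=.
        by rewrite (leg_conn lg zI yO).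
      - by rewrite in_setU tO orbT.
    have [x [z [xO zI xz]]] := ar1; have [y [w [yO wI yw]]] := ar2.
    pose J := [set v in L | conn e L v y].
    have yL : y \in L by apply: (subsetP sOL).
    have yJ : y \in J by rewrite inE yL conn_refl.
    have JL : J \subset L by apply/subsetP=> v; rewrite inE => /andP[].
    exists (J :|: I2), O2; split=> //.
    - apply: leg_sub (leg_extI lg2 _ _).
      + by rewrite setSU.
      + by rewrite disjoint_sym; apply: disjointWr d2L.
      move=> v vJ; exists w => //; apply: (@conn_trans _ _ _ y); last first.
        by apply: conn1 yw; rewrite in_setU ?wI ?yJ ?orbT.
      move: vJ; rewrite inE => /andP[_ /conn_coreach]; apply: conn_mono; exact: subsetUl.
    - exists x, z; split=> //; rewrite in_setU inE (subsetP sIL) //=.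
      by rewrite (leg_conn lg zI yO).
    - by rewrite in_setU sI orbT.
  case=> I' [O' [lg' ar1 ar2 sI' tO']]; have [r' ok'] := plain_ok _ _ _ _ _ lg'.
  have bds1 : beads e U k (B1 :|: A) [:: plain B1 I1 O1 r1', b0 & bs].
    by apply: (beadsS bds) => //; [apply: lk|apply: subsetUr|apply: subsetUl].
  exists (plain (L :|: B2) I' O' r'), [:: plain B1 I1 O1 r1', b0 & bs]; split=> //.
    apply: (beadsS bds1) => //.
    - by rewrite /= disjUl !disjUr dL1 dLA d21 d2A.
    - by rewrite subUset B1A1.
    - by rewrite /= subUset LA1.
  rewrite -[LHS]/(count (@bf V) (b0 :: bs)) cnt; case: k ne {ok' ok1 plain_ok lst cnt bds bds1} => [sg|] //=.
  by case: sg d ar => -[] //=; rewrite addn0.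
pose bd := Bead (B2 :|: (L :|: B1)) L I O u l true (fun x => if x then I2 else I1) (fun x => if x then O2 else O1).
exists bd, (b0 :: bs); split=> //.
- apply: (beadsS bds) => //.
  + split=> //; first by rewrite /= setUCA subsetUl.
    rewrite E /=; split.
    * move=> [] /=; split; [by exists r2''| |by exists r1''|]; rewrite subsetD.
        rewrite (subset_trans s2 (subsetUl _ _)); exact: disjointWl s2 d2L.
      rewrite setUA (subset_trans s1 (subsetUr _ _)); rewrite disjoint_sym in dL1; exact: disjointWl s1 dL1.
    * by apply: disjointWl s2 _; apply: disjointWr s1 _.
    * by case: d ar {E} => -[].
    * by case: d ar {E} => -[].
    * by case: d ar {E} => -[].
  + exact: lk.
  + by rewrite /= !disjUl d2A dLA.
  + by rewrite /= !subUset B2A1 LA1.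
rewrite -[LHS]/(1 + count (@bf V) (b0 :: bs)) cnt E.
by case: d {ar E} => /=; rewrite addnC.
Qed.

End Chains.

(** One of the three kinds of teeth occurs [n] times. For triangles, the leg outside the chain
    supplies an unflagged first bead. *)
Theorem chain_unavoidable (D : digraph) (U A : {set D}) s t p f q n :
  chain U (@arc D) A s t p f q -> forall B I O r l s' t', leg (@arc D) B I O r l -> [disjoint B & A] ->
  arcs (@arc D) O [set s] -> arcs (@arc D) [set t] I -> s' \in I -> t' \in O ->
  3 * n <= p + f + q -> unavoidable U n.
Proof.
move=> ch B I O r l s' t' lg d a1 a2 sI tO cnt.
have [np|np] := leqP n p.
  have [b0 [bs [bds _ _ c _]]] := chain_beads None ch.
  by apply: comb_model bds _; rewrite c.
have [sg nsg] : exists sg, n <= chain_count (Some sg) p f q.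
  have [nf|nf] := leqP n f; first by exists false.
  by exists true; move: cnt np nf; rewrite /=; clear; lia.
have [b0 [bs [bds aI bO c lst]]] := chain_beads (Some sg) ch.
have [[r' b'] sB] := leg_bset lg.
pose bd := Bead B B I O r' 0 false (fun=> I) (fun=> O).
apply: (@triangle_model D U n sg (B :|: A) (b0 :: bs) bd) => //; last 2 first.
- exact: lst.
- by rewrite -[count _ _]/(count (@bf D) (b0 :: bs)) c.
apply: (beadsS bds); rewrite ?subsetUl ?subsetUr //.
  by split=> //=; apply: leg0.
split.
  by apply: arcs_sub a1; rewrite ?sub1set.
by apply: arcs_sub a2; rewrite ?sub1set.
Qed.

(** * Layers and their teeth *)

Lemma arcs_memr (V : finType) (e : rel V) (A B : {set V}) y : arcs e A [set y] -> y \in B -> arcs e A B.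
Proof. by move=> ar yB; apply: arcs_sub ar; rewrite ?sub1set. Qed.

Lemma arcs_meml (V : finType) (e : rel V) (A B : {set V}) x : arcs e [set x] B -> x \in A -> arcs e A B.
Proof. by move=> ar yB; apply: arcs_sub ar; rewrite ?sub1set. Qed.

Lemma link_rev (V : finType) (e : rel V) x q y : link (revr e) y (rev q) x = link e x q y.
Proof.
have := rev_path (revr e) x (rcons q y).
by rewrite last_rcons belast_rcons rev_cons.
Qed.

Lemma leg_extI_arc (V : finType) (e : rel V) (A I O J : {set V}) u l x : leg e A I O u l ->
  [disjoint J & A] -> {in J, forall z, conn e J z x} -> arcs e [set x] I ->
  leg e (J :|: A) (J :|: I) O u l.
Proof.
move=> lg d cJ [x0 [y [/set1P-> yI xy]]]; apply: leg_extI lg d _ => z zJ; exists y => //.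
apply: (@conn_trans _ _ _ x); first by apply: conn_mono (cJ _ zJ); apply: subsetUl.
by apply: conn1 => //; rewrite in_setU ?yI ?orbT // (conn_inr (cJ z zJ)).
Qed.

Lemma leg_extO_arc (V : finType) (e : rel V) (A I O J : {set V}) u l x : leg e A I O u l ->
  [disjoint J & A] -> {in J, forall z, conn e J x z} -> arcs e O [set x] ->
  leg e (J :|: A) I (J :|: O) u l.
Proof.
move=> /leg_rev lg d cJ /arcs_rev ar; apply: (@leg_rev _ (revr e)); apply: leg_extI_arc lg d _ ar.
by move=> z zJ; rewrite (conn_rev e) cJ.
Qed.

Section Tooth.
Variables (V : finType) (U : {set V}).
Implicit Types (e : rel V) (S P K A B : {set V}) (a b s t : V).

Definition chained e S a b N :=
  exists p f q, N <= p + f + q /\ chain U e S a b p f q.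

(** The chain is only promised once a further core [B] is attached outside [S], since a tooth may
    have to become an ear between [B] and the cores in [S]. *)
Definition opened e S a b N :=
  forall (B I O : {set V}) r l s t, leg e B I O r l -> [disjoint B & S] -> arcs e O [set a] ->
    arcs e [set b] I -> s \in I -> t \in O -> chained e (B :|: S) s t N.

(** The outermost core is kept apart from the rest of the chain, so that it can still be enlarged
    and receive an ear. *)
Definition cored e K k1 k2 N := exists (A : {set V}) a b (B I O : {set V}) r l,
  [/\ chained e A a b N, leg e B I O r l, [disjoint B & A], B :|: A \subset K
    & [/\ arcs e O [set a], arcs e [set b] I, k1 \in I & k2 \in O]].

Lemma chained_sub e A B a b N : A \subset B -> chained e A a b N -> chained e B a b N.
Proof. by move=> AB [p [f [q [n c]]]]; exists p, f, q; split=> //; apply: chain_sub c. Qed.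

Lemma chained_rev e A a b N : chained e A a b N -> chained (revr e) A b a N.
Proof.
by move=> [p [f [q [n /chain_rev c]]]]; exists p, q, f; split=> //; rewrite addnAC.
Qed.

Lemma chained_core e A (B I O : {set V}) r l s t a b N : chained e A a b N -> leg e B I O r l ->
  [disjoint B & A] -> arcs e O [set a] -> arcs e [set b] I -> s \in I -> t \in O ->
  chained e (B :|: A) s t N.
Proof.
move=> [p [f [q [n c]]]] lg d a1 a2 sI tO; exists (p + false), f, q; rewrite addn0; split=> //.
by rewrite -[p]addn0; apply: (@chain_core _ _ _ _ _ _ _ _ _ _ false _ _ _ _ _ _ _ c lg).
Qed.

Lemma chained_tooth e A (B I O : {set V}) r l s t a b N : chained e A a b N -> leg e B I O r l ->
  r \in U -> [disjoint B & A] -> arcs e O [set a] -> arcs e [set b] I -> s \in I -> t \in O ->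
  chained e (B :|: A) s t N.+1.
Proof.
move=> [p [f [q [n c]]]] lg rU d a1 a2 sI tO; exists (p + true), f, q; split.
  by move: n; clear; lia.
exact: (@chain_core _ _ _ _ _ _ _ _ _ _ true _ _ _ _ _ _ _ c lg).
Qed.

Lemma chained_ear e A (B1 I1 O1 : {set V}) r1 l1 (L I O : {set V}) u l (B2 I2 O2 : {set V}) r2 l2 s t a b N :
  chained e A a b N ->
  leg e B1 I1 O1 r1 l1 -> arcs e O1 [set a] -> arcs e [set b] I1 ->
  leg e L I O u l -> u \in U -> leg e B2 I2 O2 r2 l2 -> s \in I2 -> t \in O2 ->
  arcs e O2 I -> arcs e O I1 -> arcs e O1 I2 ->
  [disjoint B1 & A] -> [disjoint L & B1 :|: A] -> [disjoint B2 & L :|: (B1 :|: A)] ->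
  chained e (B2 :|: (L :|: (B1 :|: A))) s t N.+1.
Proof.
move=> [p [f [q [n c]]]] lg1 a1 a2 lg uU lg2 sI tO b1 b2 b3 d1 d2 d3.
exists p, (f + true), (q + false); split; first by move: n; clear; lia.
exact: (@chain_ear _ _ _ _ _ _ _ _ _ _ _ _ _ _ _ _ _ _ _ _ true _ _ _ _ _ _ _ c lg1 a1 a2 lg uU lg2).
Qed.

Lemma chained_opened e S a b N : chained e S a b N -> opened e S a b N.
Proof. by move=> c B I O r l s t lg d a1 a2 sI tO; apply: (chained_core c lg). Qed.

Lemma opened_rev e S a b N : opened (revr e) S b a N -> opened e S a b N.
Proof.
move=> op B I O r l s t /leg_rev lg d /arcs_rev a1 /arcs_rev a2 sI tO.
exact: (@chained_rev (revr e) _ t s _ (op _ _ _ _ _ _ _ lg d a2 a1 tO sI)).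
Qed.

Lemma cored_rev e K k1 k2 N : cored e K k1 k2 N -> cored (revr e) K k2 k1 N.
Proof.
move=> [A [a [b [B [I [O [r [l [/chained_rev c /leg_rev lg d s [a1 a2 k1I k2O]]]]]]]]]].
by exists A, b, a, B, O, I, r, l; split=> //; split=> //; apply/arcs_rev.
Qed.

Lemma cored_chained e K k1 k2 N : cored e K k1 k2 N -> chained e K k1 k2 N.
Proof.
move=> [A [a [b [B [I [O [r [l [c lg d s [a1 a2 k1I k2O]]]]]]]]]].
by apply: chained_sub s _; apply: (chained_core c lg).
Qed.

(** The return condition in a form symmetric under reversal; [returning_returns] leads back to
    [returns]. *)
Definition returning e K k1 k2 := conn e (k1 |: (k2 |: ~: K)) k2 k1.

Lemma returning_rev e K k1 k2 : returning (revr e) K k1 k2 = returning e K k2 k1.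
Proof. by rewrite /returning (conn_rev e) setUCA. Qed.

(* P is the vertex set of a path from a to b in S on which pos is the index;  *)
(* p is the last vertex of P with a path to v and p' the first vertex of P    *)
(* with a path from v, both off P.                                            *)
Record layer e S P (v a b p p' : V) (pos : V -> nat) : Prop := Layer {
  ly_strong : strong e S;
  ly_v : v \in S :\: P;
  ly_P : P \subset S;
  ly_a : a \in P;
  ly_b : b \in P;
  ly_p : p \in P;
  ly_p' : p' \in P;
  ly_pos_a : pos a = 0;
  ly_pos : {in P, forall z, pos z <= pos b};
  ly_inj : {in P &, injective pos};
  ly_step : forall i, i < pos b ->
    exists z z', [/\ z \in P, z' \in P, pos z = i, pos z' = i.+1 & e z z'];
  ly_pp : pos p' <= pos p;
  ly_orig : conn e (p |: (S :\: P)) p v;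
  ly_land : conn e (p' |: (S :\: P)) v p';
  ly_max : forall z, z \in P -> conn e (z |: (S :\: P)) z v -> pos z <= pos p;
  ly_min : forall z, z \in P -> conn e (z |: (S :\: P)) v z -> pos p' <= pos z;
  ly_ret : conn e (~: (S :\: P)) b a }.

(** Positions are counted from the other end, and [p] and [p'] change roles. *)
Lemma layer_rev e S P v a b p p' pos : layer e S P v a b p p' pos ->
  layer (revr e) S P v b a p' p (fun z => pos b - pos z).
Proof.
case=> st vX PS aP bP pP p'P pa ple inj step pp ori lan mx mn ret; split=> //.
- exact: strong_rev.
- exact: subnn.
- by move=> z zP; rewrite leq_sub2l // pa.
- move=> x y xP yP E; apply: inj => //.
  by have := ple x xP; have := ple y yP; move: E; clear; lia.
- move=> i; rewrite pa subn0 => ib.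
  have [|z [z' [zP z'P z1 z2 zz']]] := step (pos b - i.+1); first by move: ib; clear; lia.
  by exists z', z; split=> //; rewrite ?z1 ?z2; move: ib; clear; lia.
- by rewrite leq_sub2l.
- by rewrite (conn_rev e).
- by rewrite (conn_rev e).
- by move=> z zP; rewrite (conn_rev e) => /(mn z zP); apply: leq_sub2l.
- by move=> z zP; rewrite (conn_rev e) => /(mx z zP); apply: leq_sub2l.
by rewrite (conn_rev e).
Qed.

Section Layer.
Variables (e : rel V) (S P : {set V}) (v a b p p' : V) (pos : V -> nat).
Hypothesis ly : layer e S P v a b p p' pos.
Let X := S :\: P.
Let K := comp e X v.
Local Notation conn := (conn e).

Definition stretch i j := [set z in P | i <= pos z <= j].

Lemma in_stretch i j z : (z \in stretch i j) = (z \in P) && (i <= pos z <= j).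
Proof. by rewrite in_set. Qed.

Lemma stretch_P i j : stretch i j \subset P.
Proof. by apply/subsetP=> z; rewrite in_stretch => /andP[]. Qed.

Lemma path_off : P \subset ~: X.
Proof. by apply/subsetP=> z zP; rewrite in_setC in_setD zP. Qed.

Lemma off_path z : z \in X -> z \notin P.
Proof. by rewrite in_setD => /andP[]. Qed.

Lemma layer_comp_sub : K \subset X. Proof. exact: comp_sub. Qed.

Lemma layer_center : v \in K. Proof. exact: comp_self (ly_v ly). Qed.

Lemma stretch_conn i j x y : x \in P -> y \in P -> i <= pos x -> pos x <= pos y -> pos y <= j ->
  conn (stretch i j) x y.
Proof.
move=> xP yP ix; elim: {y}(pos y) {-2}y (erefl (pos y)) yP => [|k IH] y Ek yP xy yj.
  have -> : y = x by apply: (ly_inj ly) => //; move: Ek xy; clear; lia.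
  by apply: conn_refl; rewrite in_stretch xP ix; move: xy yj; clear; lia.
have [Exy|ne] := eqVneq (pos x) (pos y).
  have -> : y = x by apply: (ly_inj ly).
  by apply: conn_refl; rewrite in_stretch xP ix Exy yj.
have kb : k < pos b by have := ly_pos ly yP; rewrite Ek.
have [z [z' [zP z'P z1 z2 zz']]] := ly_step ly kb.
have {z2 z'P} E : z' = y by apply: (ly_inj ly) => //; rewrite z2.
subst z'; have xz : pos x <= pos z by move: xy ne; rewrite Ek z1; clear; lia.
apply: conn_trans (IH z z1 zP xz _) _; first by move: yj; rewrite Ek z1; clear; lia.
by apply: conn1 => //; rewrite in_stretch ?zP ?yP; move: ix xz yj xy; rewrite ?Ek ?z1; clear; lia.
Qed.

Lemma layer_conn x y : x \in P -> y \in P -> conn (~: X) x y.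
Proof.
move=> xP yP; have sub i j : stretch i j \subset ~: X := subset_trans (stretch_P i j) path_off.
have aP := ly_a ly; have bP := ly_b ly.
apply: (@conn_trans _ _ _ b).
  by apply: conn_mono (sub 0 (pos b)) _; apply: stretch_conn => //; apply: (ly_pos ly).
apply: conn_trans (ly_ret ly) _.
by apply: conn_mono (sub 0 (pos y)) _; apply: stretch_conn => //; rewrite (ly_pos_a ly).
Qed.

Lemma exists_pos i : i <= pos b -> exists2 z, z \in P & pos z = i.
Proof.
rewrite leq_eqVlt => /orP[/eqP->|/(ly_step ly)[z [z' [zP _ zi _ _]]]]; last by exists z.
by exists b => //; apply: (ly_b ly).
Qed.

Lemma stretch_leg i j r : r \in P -> i <= pos r <= j ->
  leg e (stretch i j) (stretch i (pos r)) (stretch (pos r) j) r 0.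
Proof.
move=> rP /andP[ir rj]; apply: leg0; last first.
  by apply/subsetP=> z; rewrite in_setU !in_stretch => /orP[]/andP[->]; move: ir rj; clear; lia.
split=> [|x|x].
- apply/setP=> z; rewrite in_setI !in_stretch in_set1; apply/idP/eqP=> [|->].
    by case/andP=> /and3P[zP _ z1] /and3P[_ z2 _]; apply: (ly_inj ly) => //; apply/eqP; rewrite eqn_leq z1 z2.
  by rewrite rP ir rj leqnn.
- by rewrite in_stretch => /and3P[xP ix xr]; apply: stretch_conn.
- by rewrite in_stretch => /and3P[xP ix xr]; apply: stretch_conn.
Qed.

Lemma returning_via x y k1 k2 : x \in P -> y \in P -> conn (k1 |: ~: K) x k1 ->
  conn (k2 |: ~: K) k2 y -> returning e K k1 k2.
Proof.
move=> xP yP c1 c2; have XK : ~: X \subset ~: K by rewrite setCS layer_comp_sub.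
apply: (@conn_trans _ _ _ y).
  by apply: conn_mono c2; apply: subsetUr.
apply: (@conn_trans _ _ _ x).
  by apply: conn_mono (layer_conn yP xP); rewrite setUA; apply: subset_trans XK (subsetUr _ _).
by apply: conn_mono c1; rewrite setUCA; apply: subsetUr.
Qed.

Lemma path_disjoint_comp (z : V) : z \in P -> [disjoint [set z] & K].
Proof. by move=> zP; rewrite disjoints1; apply: contraL zP => /(subsetP layer_comp_sub)/off_path. Qed.

Lemma origin_link : exists q k, [/\ link e p q k, k \in K & {in q, forall z, z \in X /\ z \notin K}].
Proof.
have [x [q [k [/setIP[/set1P-> _] /setIP[kK _] lk qX]]]] :=
  link_exists (set11 _) layer_center (ly_orig ly) (path_disjoint_comp (ly_p ly)).
exists q, k; split=> // z /qX[+ + zK]; rewrite in_setU1 in_set1 => /orP[->//|] zX _.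
by split.
Qed.

End Layer.

Lemma landing_link e S P v a b p p' pos : layer e S P v a b p p' pos -> exists k q,
  [/\ link e k q p', k \in comp e (S :\: P) v
    & {in q, forall z, z \in S :\: P /\ z \notin comp e (S :\: P) v}].
Proof.
move=> /layer_rev/origin_link[q [k]]; rewrite comp_rev => -[lk kK qX].
exists k, (rev q); rewrite -[q]revK link_rev in lk; split=> // z.
by rewrite mem_rev; apply: qX.
Qed.

End Tooth.

Ltac split_disjoint := rewrite ?disjUl ?disjUr;
  repeat match goal with |- is_true (_ && _) => apply/andP; split end;
  try match goal with
  | |- is_true [disjoint _ & _] => first [by [] | by rewrite disjoint_sym]
  end.

Ltac split_sub := rewrite ?subUset;
  repeat match goal with |- is_true (_ && _) => apply/andP; split end; try by [].

(** * Layers as cores, and lost vertices on the path *)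

Section Cases.
Variables (V : finType) (U : {set V}).
Implicit Types (q : seq V) (k u r : V) (i j N : nat).

Section Layer.
Variables (e : rel V) (S P : {set V}) (v a b p p' : V) (pos : V -> nat).
Hypothesis ly : layer e S P v a b p p' pos.
Let X := S :\: P.
Let K := comp e X v.
Local Notation conn := (conn e).
Local Notation stretch := (stretch P pos).

Lemma disjoint_PX (A B : {set V}) : A \subset P -> B \subset X -> [disjoint A & B].
Proof. by move=> /subsetP AP /subsetP BX; apply: disjI => z /AP zP /BX/off_path; rewrite zP. Qed.

(** Rooted between [p'] and [p], the stretch has [p] in its out-tree and [p'] in its in-tree, so the
    links to and from the component prolong these trees. *)
Lemma core_leg q1 k1 k2 q2 i j r : link e p q1 k1 -> link e k2 q2 p' ->
  {subset q1 <= X} -> {subset q2 <= X} -> {in q1, forall z, z \notin q2} ->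
  r \in P -> i <= pos p' -> pos p' <= pos r <= pos p -> pos p <= j ->
  [/\ leg e ([set z in q2] :|: ([set z in q1] :|: stretch i j))
        ([set z in q2] :|: stretch i (pos r)) ([set z in q1] :|: stretch (pos r) j) r 0,
      arcs e ([set z in q1] :|: stretch (pos r) j) [set k1]
    & arcs e [set k2] ([set z in q2] :|: stretch i (pos r))].
Proof.
move=> lk1 lk2 q1X q2X q12 rP ip /andP[p'r rp] pj.
have nP z i' j' : z \in X -> z \notin stretch i' j'.
  by move=> /off_path; apply: contra; rewrite in_stretch => /andP[].
have pO : p \in stretch (pos r) j by rewrite in_stretch (ly_p ly) rp pj.
have pI : p' \in stretch i (pos r) by rewrite in_stretch (ly_p' ly) ip p'r.
split; last 2 first.
- exact: link_arcsO lk1 pO (set11 _).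
- exact: link_arcsI lk2 (set11 _) pI.
have lg : leg e (stretch i j) (stretch i (pos r)) (stretch (pos r) j) r 0.
  by apply: (stretch_leg ly rP); move: ip p'r rp pj; clear; lia.
apply: leg_linkI lk2 pI _; first by apply: leg_linkO lg lk1 pO _ => z /q1X/nP.
by move=> z zq; rewrite in_setU negb_or nP ?q2X // andbT inE; apply: contraL zq => /q12.
Qed.

Lemma link_returning q1 k1 k2 q2 x y : x \in P -> y \in P -> link e x q1 k1 -> link e k2 q2 y ->
  k1 \in K -> k2 \in K -> {in q1, forall z, z \notin K} -> {in q2, forall z, z \notin K} ->
  returning e K k1 k2.
Proof.
move=> xP yP lk1 lk2 k1K k2K q1K q2K.
have PK z : z \in P -> z \notin K by move=> zP; apply: contraL zP => /(subsetP (layer_comp_sub _ _ _ _))/off_path.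
apply: (returning_via ly xP yP).
  have sub : {subset q1 <= k1 |: ~: K} by move=> z /q1K zK; rewrite in_setU1 in_setC zK orbT.
  have [z zq xz] := link_first lk1.
  have zC : z \in k1 |: ~: K by move: zq; rewrite mem_rcons inE => /orP[/eqP->|/sub//]; rewrite setU11.
  apply: (@conn_trans _ _ _ z).
    by apply: conn1 => //; rewrite in_setU1 in_setC PK ?orbT.
  move: zq; rewrite mem_rcons inE => /orP[/eqP->|zq]; first exact/conn_refl/setU11.
  by have [_] := link_conn lk1 sub zq; apply; apply: setU11.
have sub : {subset q2 <= k2 |: ~: K} by move=> z /q2K zK; rewrite in_setU1 in_setC zK orbT.
have yC : y \in k2 |: ~: K by rewrite in_setU1 in_setC PK ?orbT.
have [z zq zy] := link_last lk2.
have zC : z \in k2 |: ~: K by move: zq; rewrite inE => /orP[/eqP->|/sub//]; rewrite setU11.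
apply: (@conn_trans _ _ _ z); last exact: conn1.
move: zq; rewrite inE => /orP[/eqP->|zq]; first exact/conn_refl/setU11.
by have [+ _] := link_conn lk2 sub zq; apply; apply: setU11.
Qed.

Lemma links : exists q1 k1 k2 q2,
  [/\ link e p q1 k1, link e k2 q2 p', k1 \in K, k2 \in K &
    [/\ {in q1, forall z, z \in X /\ z \notin K}, {in q2, forall z, z \in X /\ z \notin K},
        {in q1, forall z, z \notin q2} & returning e K k1 k2]].
Proof.
have [q1 [k1 [lk1 k1K q1X]]] := origin_link ly; have [k2 [q2 [lk2 k2K q2X]]] := landing_link ly.
exists q1, k1, k2, q2; split=> //; split=> //.
  exact: (links_disjoint lk1 lk2 k1K k2K q1X (fun z zq => (q2X z zq).1)).
apply: (link_returning (ly_p ly) (ly_p' ly) lk1 lk2 k1K k2K).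
  by move=> z /q1X[].
by move=> z /q2X[].
Qed.

Lemma layer_comp_S : K \subset S.
Proof. by apply: subset_trans (layer_comp_sub _ _ _ _) (subsetDl _ _). Qed.

Lemma side_facts q : {in q, forall z, z \in X /\ z \notin K} ->
  [/\ [set z in q] \subset S, [disjoint [set z in q] & K],
      forall i j, [disjoint [set z in q] & stretch i j] & {subset q <= X}].
Proof.
move=> qX; have XS : X \subset S by apply: subsetDl.
split=> [||i j|z /qX[]//].
- by apply/subsetP=> z; rewrite inE => /qX[/(subsetP XS)].
- by apply: disjI => z; rewrite inE => /qX[_ /negP].
rewrite disjoint_sym; apply: disjoint_PX (stretch_P _ _ _ _) _.
by apply/subsetP=> z; rewrite inE => /qX[].
Qed.

Lemma stretch_disjoint_comp i j : [disjoint stretch i j & K].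
Proof. exact: disjoint_PX (stretch_P _ _ _ _) (layer_comp_sub _ _ _ _). Qed.

Lemma stretch_S i j : stretch i j \subset S.
Proof. exact: subset_trans (stretch_P _ _ _ _) (ly_P ly). Qed.

Lemma layer_core : exists k1 k2 (B I O : {set V}) r,
  [/\ k1 \in K, k2 \in K, returning e K k1 k2, leg e B I O r 0 &
    [/\ B \subset S, [disjoint B & K], arcs e O [set k1] /\ arcs e [set k2] I, a \in I & b \in O]].
Proof.
have [q1 [k1 [k2 [q2 [lk1 lk2 k1K k2K [q1X q2X q12 ret]]]]]] := links.
have pb := ly_pos ly (ly_p ly).
have [q1S q1K q1P q1X'] := side_facts q1X; have [q2S q2K q2P q2X'] := side_facts q2X.
have [||//|lg a1 a2] := @core_leg q1 k1 k2 q2 0 (pos b) p lk1 lk2 q1X' q2X' q12 (ly_p ly) => //.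
  by rewrite (ly_pp ly) leqnn.
exists k1, k2; do 4! eexists; split; first exact: k1K; first exact: k2K; [exact: ret|exact: lg|].
have KP := stretch_disjoint_comp; have sS := stretch_S.
split=> //.
- by split_sub.
- by split_disjoint.
- by rewrite in_setU in_stretch (ly_a ly) (ly_pos_a ly) orbT.
by rewrite in_setU in_stretch (ly_b ly) pb leqnn orbT.
Qed.

(** The path of the layer is the outer core that [opened] asks for. *)
Lemma layer_chained N : {in K &, forall k1 k2, returning e K k1 k2 -> opened U e K k1 k2 N} ->
  chained U e S a b N.
Proof.
move=> H; have [k1 [k2 [B [I [O [r [k1K k2K ret lg [BS dB [a1 a2] aI bO]]]]]]]] := layer_core.
have := H k1 k2 k1K k2K ret _ _ _ _ _ _ _ lg dB a1 a2 aI bO; apply: chained_sub.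
by rewrite subUset BS layer_comp_S.
Qed.

Lemma layer_cored N : {in K &, forall k1 k2, returning e K k1 k2 -> chained U e K k1 k2 N} ->
  cored U e S a b N.
Proof.
move=> H; have [k1 [k2 [B [I [O [r [k1K k2K ret lg [BS dB [a1 a2] aI bO]]]]]]]] := layer_core.
exists K, k1, k2, B, I, O, r, 0; split=> //; first exact: H.
by rewrite subUset BS layer_comp_S.
Qed.

End Layer.

Section Path.
Variables (e : rel V) (S P : {set V}) (v a b p p' : V) (pos : V -> nat).
Hypothesis ly : layer e S P v a b p p' pos.
Let X := S :\: P.
Let K := comp e X v.
Local Notation conn := (conn e).
Local Notation stretch := (stretch P pos).
Variable N : nat.
Hypothesis inner : {in K &, forall k1 k2, returning e K k1 k2 -> cored U e K k1 k2 N}.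

(** The whole path, rooted at [u], is a core with [u] as its own tooth. *)
Lemma tooth_path_mid u : u \in U -> u \in P -> pos p' <= pos u <= pos p -> opened U e S a b N.+1.
Proof.
move=> uU uP pu; apply: chained_opened.
have [q1 [k1 [k2 [q2 [lk1 lk2 k1K k2K [q1X q2X q12 ret]]]]]] := links ly.
have pb := ly_pos ly (ly_p ly).
have [q1S q1K q1P q1X'] := side_facts pos q1X; have [q2S q2K q2P q2X'] := side_facts pos q2X.
have KS := layer_comp_S e S P v; have KP := stretch_disjoint_comp e S P v pos; have sS := stretch_S ly.
have [//|lg a1 a2] := core_leg ly (i := 0) (j := pos b) lk1 lk2 q1X' q2X' q12 uP isT pu.
have ch := cored_chained (inner k1K k2K ret).
apply: chained_sub (chained_tooth ch lg uU _ a1 a2 _ _).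
- by split_sub.
- by split_disjoint.
- by rewrite in_setU in_stretch (ly_a ly) (ly_pos_a ly) orbT.
by rewrite in_setU in_stretch (ly_b ly) (ly_pos ly) ?leqnn ?orbT.
Qed.

Lemma stretch_dis i j i' j' : j < i' -> [disjoint stretch i j & stretch i' j'].
Proof.
by move=> ji; apply: disjI => z; rewrite !in_stretch => /and3P[_ _ z1] /and3P[_ z2 _]; move: ji z1 z2; clear; lia.
Qed.

Lemma stretch_arc i : i < pos b -> exists2 z', z' \in P /\ pos z' = i.+1 &
  arcs e (stretch i i) [set z'].
Proof.
move=> /(ly_step ly)[z [z' [zP z'P z1 z2 zz']]]; exists z' => //; exists z, z'.
by rewrite in_stretch zP z1 leqnn set11.
Qed.

(** The path is cut just before [p']: the second part is a core, and the first part, rooted at [u],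
    is an inward ear between the outer core and this one. *)
Lemma tooth_path_left u : u \in U -> u \in P -> pos u < pos p' -> opened U e S a b N.+1.
Proof.
move=> uU uP pu B0 I0 O0 r0 l0 s t lg0 d0 a0 b0 sI tO.
have [q1 [k1 [k2 [q2 [lk1 lk2 k1K k2K [q1X q2X q12 ret]]]]]] := links ly.
have pb := ly_pos ly (ly_p ly); have p'b := ly_pos ly (ly_p' ly).
have [q1S q1K q1P q1X'] := side_facts pos q1X; have [q2S q2K q2P q2X'] := side_facts pos q2X.
have KS := layer_comp_S e S P v; have KP := stretch_disjoint_comp e S P v pos; have sS := stretch_S ly.
have pp : pos p' <= pos p <= pos p by rewrite (ly_pp ly) leqnn.
have [//|//|lg a1 a2] := core_leg ly (i := pos p') (j := pos b) lk1 lk2 q1X' q2X' q12 (ly_p ly) _ pp.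
have ch := cored_chained (inner k1K k2K ret).
have /(stretch_leg ly uP) lgL : 0 <= pos u <= (pos p').-1 by move: pu; clear; lia.
have [|z' [z'P z'p] ar] := @stretch_arc (pos p').-1; first by move: pu p'b; clear; lia.
have {z'p} E : z' = p'.
  by apply: (ly_inj ly) z'P (ly_p' ly) _; move: pu z'p; clear; lia.
subst z'.
apply: chained_sub (chained_ear ch lg a1 a2 lgL uU lg0 sI tO _ _ _ _ _ _).
- apply: setUS; split_sub; exact: sS.
- by apply: arcs_memr a0 _; rewrite in_stretch (ly_a ly) (ly_pos_a ly).
- apply: arcs_sub ar; last by rewrite sub1set in_setU in_stretch (ly_p' ly) leqnn (ly_pp ly) orbT.
  by apply/subsetP=> z; rewrite !in_stretch => /andP[->]; move: pu; clear; lia.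
- by apply: arcs_meml b0 _; rewrite in_setU in_stretch (ly_b ly) pb leqnn orbT.
- by split_disjoint.
- split_disjoint => //; try by rewrite disjoint_sym.
  by apply: stretch_dis; move: pu; clear; lia.
apply: disjointWr d0; split_sub; exact: sS.
Qed.


End Path.
End Cases.

Section LinkConn.
Variables (V : finType) (e : rel V).
Implicit Types (X L : {set V}) (x y u : V) (q : seq V).
Local Notation conn := (conn e).

Lemma link_conn_out X x q y : link e x q y -> {subset q <= X} -> y \in X -> conn (x |: X) x y.
Proof.
move=> lk qX yX; have [z zq xz] := link_first lk.
have sX : X \subset x |: X by apply: subsetUr.
have zX : z \in X by move: zq; rewrite mem_rcons inE => /orP[/eqP->|/qX].
apply: (@conn_trans _ _ _ z); first by apply: conn1; rewrite ?setU11 ?(subsetP sX).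
apply: conn_mono sX _; move: zq; rewrite mem_rcons inE => /orP[/eqP->|zq]; first exact: conn_refl.
by have [_] := link_conn lk qX zq; apply.
Qed.

Lemma link_conn_in X x q y : link e x q y -> {subset q <= X} -> x \in X -> conn (y |: X) x y.
Proof.
move=> lk qX xX; have [z zq zy] := link_last lk.
have sX : X \subset y |: X by apply: subsetUr.
have zX : z \in X by move: zq; rewrite inE => /orP[/eqP->|/qX].
apply: (@conn_trans _ _ _ z); last by apply: conn1; rewrite ?setU11 ?(subsetP sX).
apply: conn_mono sX _; move: zq; rewrite inE => /orP[/eqP->|zq]; first exact: conn_refl.
by have [+ _] := link_conn lk qX zq; apply.
Qed.

Lemma detour_leg X u x q1 l1 l2 q2 y : link e x q1 l1 -> link e l2 q2 y ->
  u \in X -> l1 \in comp e X u -> l2 \in comp e X u ->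
  {in q1, forall z, z \in X /\ z \notin comp e X u} ->
  {in q2, forall z, z \in X /\ z \notin comp e X u} ->
  exists (I O : {set V}) l, [/\ leg e ([set z in q2] :|: ([set z in q1] :|: comp e X u)) I O u l,
    arcs e [set x] I & arcs e O [set y]].
Proof.
move=> lk1 lk2 uX l1L l2L q1X q2X.
have [I [O [l [lg l1I l2O]]]] := strong_leg (@comp_strong _ e X u) l1L (comp_self e uX) l2L.
have q12 := links_disjoint lk1 lk2 l1L l2L q1X (fun z zq => (q2X z zq).1).
exists ([set z in q1] :|: I), ([set z in q2] :|: O), l; split.
- apply: leg_linkO lk2 l2O _; first exact: leg_linkI lg lk1 l1I (fun z zq => (q1X z zq).2).
  move=> z zq; rewrite in_setU negb_or (q2X z zq).2 andbT inE.
  by apply: contraL zq => /q12.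
- exact: link_arcsI lk1 (set11 _) l1I.
exact: link_arcsO lk2 l2O (set11 _).
Qed.

End LinkConn.

Lemma set_rev_seq (V : finType) (q : seq V) : [set z in rev q] = [set z in q].
Proof. by apply/setP=> z; rewrite !inE mem_rev. Qed.

(** * Lost vertices on a detour *)

Section Ears.
Variables (V : finType) (U : {set V}).
Implicit Types (q : seq V) (k u r : V) (i j N : nat).

(* A detour from o to d through the strong component of u. *)
Record ear (e : rel V) (S P : {set V}) (v p p' u k1 k2 : V) (q1 q2 : seq V)
    (o d : V) (q3 q4 : seq V) : Prop := Ear {
  er_u : u \in S :\: P;
  er_k1 : k1 \in comp e (S :\: P) v;
  er_k2 : k2 \in comp e (S :\: P) v;
  er_link1 : link e p q1 k1;
  er_link2 : link e k2 q2 p';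
  er_link3 : exists2 l1, l1 \in comp e (S :\: P) u & link e o q3 l1;
  er_link4 : exists2 l2, l2 \in comp e (S :\: P) u & link e l2 q4 d;
  er_o : o \in P \/ o \in q1;
  er_d : d \in P \/ d \in q2;
  er_1 : {in q1, forall z, z \in S :\: P /\ z \notin comp e (S :\: P) v};
  er_2 : {in q2, forall z, z \in S :\: P /\ z \notin comp e (S :\: P) v};
  er_3 : {in q3, forall z, z \in S :\: P /\ z \notin comp e (S :\: P) u};
  er_4 : {in q4, forall z, z \in S :\: P /\ z \notin comp e (S :\: P) u};
  er_12 : [disjoint [set z in q1] & [set z in q2]];
  er_13 : [disjoint [set z in q1] & [set z in q3]];
  er_14 : [disjoint [set z in q1] & [set z in q4]];
  er_23 : [disjoint [set z in q2] & [set z in q3]];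
  er_24 : [disjoint [set z in q2] & [set z in q4]];
  er_1L : [disjoint [set z in q1] & comp e (S :\: P) u];
  er_2L : [disjoint [set z in q2] & comp e (S :\: P) u];
  er_3K : [disjoint [set z in q3] & comp e (S :\: P) v];
  er_4K : [disjoint [set z in q4] & comp e (S :\: P) v];
  er_LK : [disjoint comp e (S :\: P) u & comp e (S :\: P) v] }.

Lemma ear_rev e S P v p p' u k1 k2 q1 q2 o d q3 q4 :
  ear e S P v p p' u k1 k2 q1 q2 o d q3 q4 ->
  ear (revr e) S P v p' p u k2 k1 (rev q2) (rev q1) d o (rev q4) (rev q3).
Proof.
case=> uX k1K k2K lk1 lk2 [l1 l1L lk3] [l2 l2L lk4] oP dP x1 x2 x3 x4 d12 d13 d14 d23 d24 d1L d2L d3K d4K dLK.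
split; rewrite ?set_rev_seq ?mem_rev ?(comp_rev e) ?(link_rev e) //.
- by exists l2; rewrite ?(comp_rev e) ?(link_rev e).
- by exists l1; rewrite ?(comp_rev e) ?(link_rev e).
- by move=> z; rewrite mem_rev; apply: x2.
- by move=> z; rewrite mem_rev; apply: x1.
- by move=> z; rewrite mem_rev; apply: x4.
- by move=> z; rewrite mem_rev; apply: x3.
- by rewrite disjoint_sym.
Qed.

(** Locked so that [split_disjoint] and [split_sub] treat the union as a single set. *)
Definition detour e S P u q3 q4 : {set V} :=
  locked ([set z in q4] :|: ([set z in q3] :|: comp e (S :\: P) u)).

Section Ear.
Variables (e : rel V) (S P : {set V}) (v a b p p' : V) (pos : V -> nat).
Hypothesis ly : layer e S P v a b p p' pos.
Let X := S :\: P.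
Let K := comp e X v.
Local Notation conn := (conn e).
Local Notation stretch := (stretch P pos).
Variable N : nat.
Variables (u k1 k2 : V) (q1 q2 : seq V) (o d : V) (q3 q4 : seq V).
Hypothesis er : ear e S P v p p' u k1 k2 q1 q2 o d q3 q4.
Hypothesis uU : u \in U.
Hypothesis ch : chained U e K k1 k2 N.
Let L := comp e X u.
Local Notation detour := (detour e S P u q3 q4).

Lemma ear_leg : exists (I O : {set V}) l, [/\ leg e detour I O u l,
  arcs e [set o] I & arcs e O [set d]].
Proof.
case: er => uX k1K k2K lk1 lk2 [l1 l1L lk3] [l2 l2L lk4] oP dP x1 x2 x3 x4 *.
rewrite /detour -lock; exact: detour_leg lk3 lk4 uX l1L l2L x3 x4.
Qed.

Lemma ear_facts : [/\ detour \subset S, [disjoint detour & K],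
  forall i j, [disjoint stretch i j & detour], [disjoint [set z in q1] & detour]
  & [disjoint [set z in q2] & detour]].
Proof.
case: er => uX k1K k2K lk1 lk2 [l1 l1L lk3] [l2 l2L lk4] oP dP x1 x2 x3 x4 d12 d13 d14 d23 d24 d1L d2L d3K d4K dLK.
have [q3S _ q3P _] := side_facts pos x3; have [q4S _ q4P _] := side_facts pos x4.
have LS := layer_comp_S e S P u; have LP := stretch_disjoint_comp e S P u pos.
split=> [||i j||]; rewrite /detour -lock.
- by split_sub.
- by split_disjoint.
- by split_disjoint; rewrite 1?disjoint_sym.
- by split_disjoint.
- by split_disjoint.
Qed.

Lemma ear_side : [/\ [set z in q1] \subset S, [disjoint [set z in q1] & K],
      forall i j, [disjoint [set z in q1] & stretch i j] & {subset q1 <= X}] /\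
   [/\ [set z in q2] \subset S, [disjoint [set z in q2] & K],
      forall i j, [disjoint [set z in q2] & stretch i j] & {subset q2 <= X}].
Proof. by split; [exact: (side_facts pos (er_1 er))|exact: (side_facts pos (er_2 er))]. Qed.

Lemma ear_core i r : r \in P -> i <= pos p' -> pos p' <= pos r <= pos p ->
  [/\ leg e ([set z in q2] :|: ([set z in q1] :|: stretch i (pos b)))
        ([set z in q2] :|: stretch i (pos r)) ([set z in q1] :|: stretch (pos r) (pos b)) r 0,
      arcs e ([set z in q1] :|: stretch (pos r) (pos b)) [set k1]
    & arcs e [set k2] ([set z in q2] :|: stretch i (pos r))].
Proof.
move=> rP ip pr; have [[_ _ _ q1X] [_ _ _ q2X]] := ear_side.
apply: (core_leg ly (er_link1 er) (er_link2 er) q1X q2X _ rP ip pr (ly_pos ly (ly_p ly))).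
by move=> z zq; apply/negP=> zq'; apply: (disjE (er_12 er) (z := z)); rewrite inE.
Qed.

(** The detour starts in the out-tree and ends in the in-tree of the path rooted at [r], so it hangs
    on this core as a leg to [u]. *)
Lemma ear_mid r : r \in P -> pos p' <= pos r <= pos p ->
  o \in [set z in q1] :|: stretch (pos r) (pos b) -> d \in [set z in q2] :|: stretch 0 (pos r) ->
  opened U e S a b N.+1.
Proof.
move=> rP pr oO dI; apply: chained_opened.
have [lg a1 a2] := ear_core rP (leq0n _) pr; have [IL [OL [l [lgL aI aO]]]] := ear_leg.
have [dS dK dP d1 d2] := ear_facts; have [[q1S q1K q1P _] [q2S q2K q2P _]] := ear_side.
have [[r' bs] sB] := leg_bset lg.
have KS := layer_comp_S e S P v; have KP := stretch_disjoint_comp e S P v pos; have sS := stretch_S ly.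
set B := _ :|: _ in lg; set I := _ :|: _ in lg; set O := _ :|: _ in lg.
have lg' : leg e (B :|: detour) I O u l.+1.
  apply: (legS bs (subset_trans sB (subsetUl _ _)) lgL (subsetUr _ _)).
  - apply: disjointWl sB _; rewrite /B; split_disjoint.
  - exact: (arcs_meml aI oO).
  - exact: arcs_memr aO dI.
apply: chained_sub (chained_tooth ch lg' uU _ a1 a2 _ _).
- by rewrite /B; split_sub.
- by rewrite /B; split_disjoint.
- by rewrite in_setU in_stretch (ly_a ly) (ly_pos_a ly) orbT.
by rewrite in_setU in_stretch (ly_b ly) (ly_pos ly) ?leqnn ?orbT.
Qed.

(** The core follows the detour instead of the path between [o] and [d]: the path up to [o] joins
    the in-tree of the detour and the path from [d] on joins its out-tree, each with its link. *)
Lemma ear_through : o \in P -> d \in P -> pos p' <= pos o -> pos o < pos d -> pos d <= pos p ->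
  opened U e S a b N.+1.
Proof.
move=> oP dP po od dp; apply: chained_opened.
have [IL [OL [l [lgL aI aO]]]] := ear_leg.
have [dS dK dtP d1 d2] := ear_facts; have [[q1S q1K q1P _] [q2S q2K q2P _]] := ear_side.
have KS := layer_comp_S e S P v; have KP := stretch_disjoint_comp e S P v pos; have sS := stretch_S ly.
have q12 := er_12 er; have lk1 := er_link1 er; have lk2 := er_link2 er.
have ob := ly_pos ly oP; have db := ly_pos ly dP; have pb := ly_pos ly (ly_p ly).
have p'b := ly_pos ly (ly_p' ly).
pose J1 := [set z in q2] :|: stretch 0 (pos o); pose J2 := [set z in q1] :|: stretch (pos d) (pos b).
have pO : p \in stretch (pos d) (pos b) by rewrite in_stretch (ly_p ly) dp pb.
have pI : p' \in stretch 0 (pos o) by rewrite in_stretch (ly_p' ly) po.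
have J1c : {in J1, forall z, conn J1 z o}.
  have co z : z \in stretch 0 (pos o) -> conn J1 z o.
    rewrite in_stretch => /and3P[zP _ zo]; apply: conn_mono (subsetUr _ _) _.
    exact: (stretch_conn ly).
  move=> z /setUP[|/co//]; rewrite inE => zq; apply: (conn_trans _ (co _ pI)).
  have qJ : {subset q2 <= J1} by move=> w wq; rewrite in_setU inE wq.
  by have [_] := link_conn lk2 qJ zq; apply; rewrite in_setU pI orbT.
have J2c : {in J2, forall z, conn J2 d z}.
  have co z : z \in stretch (pos d) (pos b) -> conn J2 d z.
    rewrite in_stretch => /and3P[zP dz zb]; apply: conn_mono (subsetUr _ _) _.
    exact: (stretch_conn ly).
  move=> z /setUP[|/co//]; rewrite inE => zq; apply: (conn_trans (co _ pO)).
  have qJ : {subset q1 <= J2} by move=> w wq; rewrite in_setU inE wq.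
  by have [+ _] := link_conn lk1 qJ zq; apply; rewrite in_setU pO orbT.
have dst : [disjoint stretch 0 (pos o) & stretch (pos d) (pos b)] by apply: stretch_dis.
have dJ : [disjoint J1 & J2] by rewrite /J1 /J2; split_disjoint.
have dJ1 : [disjoint J1 & detour] by rewrite /J1; split_disjoint.
have dJ2 : [disjoint J2 & detour] by rewrite /J2; split_disjoint.
have lg1 := leg_extI_arc lgL dJ1 J1c aI.
have lg2 : leg e (J2 :|: (J1 :|: detour)) (J1 :|: IL) (J2 :|: OL) u l.
  by apply: leg_extO_arc lg1 _ J2c aO; rewrite disjUr disjoint_sym dJ dJ2.
apply: chained_sub (chained_tooth ch lg2 uU _ _ _ _ _).
- by rewrite /J1 /J2; split_sub.
- by rewrite /J1 /J2; split_disjoint.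
- rewrite /J2 -setUA; apply: arcs_sub (link_arcsO lk1 pO (set11 _)) => //.
  by rewrite setUA subsetUl.
- rewrite /J1 -setUA; apply: arcs_sub (link_arcsI lk2 (set11 _) pI) => //.
  by rewrite setUA subsetUl.
- by rewrite /J1 !in_setU in_stretch (ly_a ly) (ly_pos_a ly) !orbT.
by rewrite /J2 !in_setU in_stretch (ly_b ly) (ly_pos ly) ?leqnn ?orbT.
Qed.

End Ear.
End Ears.

Section Ears.
Variables (V : finType) (U : {set V}).
Implicit Types (q : seq V) (k r : V) (i j N : nat).

Section Ear.
Variables (e : rel V) (S P : {set V}) (v a b p p' : V) (pos : V -> nat).
Hypothesis ly : layer e S P v a b p p' pos.
Let X := S :\: P.
Let K := comp e X v.
Local Notation conn := (conn e).
Local Notation stretch := (stretch P pos).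
Variable N : nat.
Variables (u k1 k2 : V) (q1 q2 : seq V) (o d : V) (q3 q4 : seq V).
Hypothesis er : ear e S P v p p' u k1 k2 q1 q2 o d q3 q4.
Hypothesis uU : u \in U.
Hypothesis ch : chained U e K k1 k2 N.
Local Notation detour := (detour e S P u q3 q4).

(** The path strictly between [o] and [d] is a core of its own. Its outer parts join the trees of
    the new outer core, from which the detour hangs as a leg to [u]. *)
Lemma ear_rung : o \in P -> d \in P -> pos o < pos p' -> pos p < pos d -> opened U e S a b N.+1.
Proof.
move=> oP dP op' pd B0 I0 O0 r0 l0 s t lg0 d0 a0 b0 sI tO.
have [IL [OL [l [lgL aI aO]]]] := ear_leg er.
have [dS dK dtP d1 d2] := ear_facts pos er.
have [[q1S q1K q1P q1X] [q2S q2K q2P q2X]] := ear_side pos er.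
have KS := layer_comp_S e S P v; have KP := stretch_disjoint_comp e S P v pos; have sS := stretch_S ly.
have pp := ly_pp ly; have d12 := er_12 er.
have p'b := ly_pos ly (ly_p' ly); have db := ly_pos ly dP.
have q12 : {in q1, forall z, z \notin q2}.
  by move=> z zq; apply/negP=> zq'; apply: (disjE d12 (z := z)); rewrite inE.
have prp : pos p' <= pos p <= pos p by rewrite pp leqnn.
have pd' : pos p <= (pos d).-1 by move: pd; clear; lia.
have [lg a1 a2] := core_leg ly (er_link1 er) (er_link2 er) q1X q2X q12 (ly_p ly) op' prp pd'.
have [|z [s1 [zP s1P zo s1o zs]]] := ly_step ly (i := pos o); first by move: op' p'b; clear; lia.
have {zP} E : z = o by apply: (ly_inj ly).
subst z => {zo}.
have [|t1 [z [t1P zP t1d zd tz]]] := ly_step ly (i := (pos d).-1); first by move: pd db; clear; lia.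
have {zP} E : z = d by apply: (ly_inj ly) => //; move: zd pd; clear; lia.
subst z => {zd}.
pose C := [set z in q2] :|: ([set z in q1] :|: stretch (pos o).+1 (pos d).-1).
have c1 : chained U e (C :|: K) s1 t1 N.
  apply: (chained_core ch lg _ a1 a2 (s := s1) (t := t1)).
  - by split_disjoint.
  - by rewrite in_setU in_stretch s1P s1o ltnSn (leq_trans op' pp) orbT.
  - by rewrite in_setU in_stretch t1P t1d pd' leqnn orbT.
pose J1 := stretch 0 (pos o); pose J2 := stretch (pos d) (pos b).
have J1c : {in J1, forall z, conn J1 a z}.
  move=> z; rewrite in_stretch => /andP[zP zo]; apply: (stretch_conn ly) => //; first exact: (ly_a ly).
  by rewrite (ly_pos_a ly).
have J2c : {in J2, forall z, conn J2 z b}.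
  move=> z; rewrite in_stretch => /and3P[zP zo _]; apply: (stretch_conn ly) => //; first exact: (ly_b ly).
  exact: (ly_pos ly).
have dB (A : {set V}) : A \subset S -> [disjoint B0 & A] by move=> AS; apply: disjointWr d0.
have dBs i j := dB _ (sS i j).
have dB1 := dB _ q1S; have dB2 := dB _ q2S; have dBK := dB _ KS; have dBd := dB _ dS.
have st i j i' j' : j < i' -> [disjoint stretch i j & stretch i' j'] by apply: stretch_dis.
have od : pos o < pos d by move: op' pp pd; clear; lia.
have dJ1 : [disjoint J1 & B0] by rewrite /J1; split_disjoint.
have lg1 := leg_extO_arc lg0 dJ1 J1c a0.
have dJ2 : [disjoint J2 & J1 :|: B0].
  by rewrite disjUr disjoint_sym st //= /J2; split_disjoint.
have lg2 := leg_extI_arc lg1 dJ2 J2c b0.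
have [[r' bs] sB] := leg_bset lg2.
have oJ : o \in J1 :|: O0 by rewrite in_setU in_stretch oP leqnn.
have dJ : d \in J2 :|: I0 by rewrite in_setU in_stretch dP leqnn db.
have lg' : leg e ((J2 :|: (J1 :|: B0)) :|: detour) (J2 :|: I0) (J1 :|: O0) u l.+1.
  apply: (legS bs (subset_trans sB (subsetUl _ _)) lgL (subsetUr _ _)).
  - by apply: disjointWl sB _; rewrite /J1 /J2; split_disjoint.
  - exact: arcs_meml aI oJ.
  - exact: arcs_memr aO dJ.
have c2 : chained U e (((J2 :|: (J1 :|: B0)) :|: detour) :|: (C :|: K)) s t N.+1.
  apply: (chained_tooth c1 lg' uU).
  - rewrite /C /J1 /J2; split_disjoint.
    + by rewrite disjoint_sym; apply: st; move: pd; clear; lia.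
    + by apply: st.
  - by exists o, s1; rewrite set11.
  - by exists t1, d; rewrite set11.
  - by rewrite in_setU sI orbT.
  - by rewrite in_setU tO orbT.
apply: chained_sub c2; have sub (A : {set V}) : A \subset S -> A \subset B0 :|: S.
  by move=> AS; apply: subset_trans AS (subsetUr _ _).
have BB : B0 \subset B0 :|: S by apply: subsetUl.
have h1 := sub _ q1S; have h2 := sub _ q2S; have h3 := sub _ KS; have h4 := sub _ dS.
have sBs i j := sub _ (sS i j).
by rewrite /J1 /J2 /C; split_sub.
Qed.

(** The path from position [m] on is the core, and [B] is an inward ear leading to it from the outer
    core. *)
Lemma ear_blob i m (B I O : {set V}) l : leg e B I O u l -> B \subset stretch 0 i :|: detour ->
  i < m <= pos p' -> a \in I -> arcs e O ([set z in q2] :|: stretch m (pos p)) ->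
  opened U e S a b N.+1.
Proof.
move=> lgB sB /andP[im mp'] aI aO B0 I0 O0 r0 l0 s t lg0 d0 a0 b0 sI tO.
have [dS dK dtP d1 d2] := ear_facts pos er.
have [[q1S q1K q1P q1X] [q2S q2K q2P q2X]] := ear_side pos er.
have KS := layer_comp_S e S P v; have KP := stretch_disjoint_comp e S P v pos; have sS := stretch_S ly.
have pp := ly_pp ly.
have prp : pos p' <= pos p <= pos p by rewrite pp leqnn.
have [lg a1 a2] := ear_core ly er (ly_p ly) mp' prp.
have st j' : [disjoint stretch 0 i & stretch m j'] by apply: stretch_dis.
have BS : B \subset S by apply: subset_trans sB _; split_sub.
have sub (A : {set V}) : A \subset S -> A \subset B0 :|: S.
  by move=> AS; apply: subset_trans AS (subsetUr _ _).
apply: chained_sub (chained_ear ch lg a1 a2 lgB uU lg0 sI tO _ aO _ _ _ _).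
- have BB : B0 \subset B0 :|: S by apply: subsetUl.
  have h1 := sub _ q1S; have h2 := sub _ q2S; have h3 := sub _ KS; have h4 := sub _ BS.
  have sBs i' j' := sub _ (sS i' j').
  by split_sub.
- exact: arcs_memr a0 aI.
- apply: arcs_meml b0 _; rewrite in_setU in_stretch (ly_b ly) leqnn andbT.
  by rewrite (ly_pos ly (ly_p ly)) orbT.
- by split_disjoint.
- by apply: disjointWl sB _; split_disjoint.
- by apply: disjointWr d0; split_sub.
Qed.

(** The path up to [o] joins the in-tree of the detour, and together they form an ear. If the detour
    comes back at or before [o], the path in front of [p'] is the first branch set of the ear and
    the detour continues it as a leg. *)
Lemma ear_left : o \in P -> pos o < pos p' -> d \in P /\ pos d <= pos p \/ d \in q2 ->
  opened U e S a b N.+1.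
Proof.
move=> oP op' dd; have [IL [OL [l [lgL aI aO]]]] := ear_leg er.
have [dS dK dtP d1 d2] := ear_facts pos er.
have pp := ly_pp ly; have p'b := ly_pos ly (ly_p' ly).
have mk m : pos o < m <= pos p' -> d \in [set z in q2] :|: stretch m (pos p) ->
    opened U e S a b N.+1.
  move=> om dm; have J1c : {in stretch 0 (pos o), forall z, conn (stretch 0 (pos o)) z o}.
    by move=> z; rewrite in_stretch => /and3P[zP _ zo]; apply: (stretch_conn ly).
  have lg := leg_extI_arc lgL (dtP _ _) J1c aI.
  apply: (ear_blob lg (subxx _) om _ (arcs_memr aO dm)).
  by rewrite in_setU in_stretch (ly_a ly) (ly_pos_a ly).
case: dd => [[dP dp]|dq]; last by apply: (mk (pos p')); rewrite ?op' ?leqnn // in_setU inE dq.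
have [od|do'] := ltnP (pos o) (pos d).
  (* The core has to contain both [d] and [p']. *)
  apply: (mk (minn (pos d) (pos p'))); first by move: op' od; clear; lia.
  by rewrite in_setU in_stretch dP dp geq_minl orbT.
have /(stretch_leg ly oP) lgo : 0 <= pos o <= (pos p').-1 by move: op'; clear; lia.
have [[r' bs] sB] := leg_bset lgo.
have lg' : leg e (stretch 0 (pos p').-1 :|: detour) (stretch 0 (pos o)) (stretch (pos o) (pos p').-1) u l.+1.
  apply: (legS bs (subset_trans sB (subsetUl _ _)) lgL (subsetUr _ _)).
  - exact: disjointWl sB (dtP _ _).
  - by apply: arcs_meml aI _; rewrite in_stretch oP leqnn; move: op'; clear; lia.
  - by apply: arcs_memr aO _; rewrite in_stretch dP do'.
have [|z' [z'P z'p] ar] := stretch_arc ly (i := (pos p').-1); first by move: op' p'b; clear; lia.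
have {z'p} E : z' = p'.
  by apply: (ly_inj ly) z'P (ly_p' ly) _; move: op' z'p; clear; lia.
subst z'; apply: (ear_blob lg' (subxx _) (m := pos p')).
- by move: op'; clear; lia.
- by rewrite in_stretch (ly_a ly) (ly_pos_a ly).
apply: arcs_sub ar; last by rewrite sub1set in_setU in_stretch (ly_p' ly) leqnn pp orbT.
by apply/subsetP=> z; rewrite !in_stretch => /andP[->]; move: op'; clear; lia.
Qed.

End Ear.
End Ears.

(** * Every lost vertex becomes a tooth *)

Section Tooth.
Variables (V : finType) (U : {set V}).
Implicit Types (q : seq V) (k u r : V) (i j N : nat).

(** The component of [u] lies on a way from [o] on the path into [K], and becomes an inward ear at
    the outermost core of the chain in [K]. If [p'] is not after [o], the ear starts at the path,
    which is a core. Otherwise it starts at the outer core, with the path up to [o] in its in-tree,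
    and the path from [p'] on joins the out-tree of the core in [K]. *)
Lemma tooth_into (e : rel V) (S P : {set V}) (v a b p p' : V) (pos : V -> nat) N u :
  layer e S P v a b p p' pos ->
  {in comp e (S :\: P) v &, forall k1 k2, returning e (comp e (S :\: P) v) k1 k2 ->
    cored U e (comp e (S :\: P) v) k1 k2 N} ->
  u \in U -> conn e (S :\: P) u v -> ~~ conn e (S :\: P) v u -> opened U e S a b N.+1.
Proof.
move=> ly; set X := S :\: P; set K := comp e X v => inner uU cuv ncvu.
have uX := conn_inl cuv; have vX := conn_inr cuv.
have XS : X \subset S by apply: subsetDl.
have uS : u \in S by apply: (subsetP XS).
pose L := comp e X u; have uL : u \in L by apply: comp_self.
have LX : L \subset X by apply: comp_sub.
have KX : K \subset X by apply: comp_sub.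
have dPX := @disjoint_PX V S P.
have [o [q3 [l1 [/setIP[oP _] /setIP[l1L _] lk3 x3]]]] := link_exists (ly_a ly) uL
  (ly_strong ly (subsetP (ly_P ly) _ (ly_a ly)) uS) (dPX _ _ (subxx _) LX).
have {}x3 : {in q3, forall z, z \in X /\ z \notin L}.
  by move=> z /x3[zS zP zL]; rewrite in_setD zP zS.
have Kv z : z \in K -> conn e X v z /\ conn e X z v by rewrite inE => /andP[].
have Lu z : z \in L -> conn e X u z /\ conn e X z u by rewrite inE => /andP[].
have dLK : [disjoint L & K].
  by apply: disjI => z /Lu[_ zu] /Kv[vz _]; case/negP: ncvu; apply: conn_trans vz zu.
have [l2 [q4 [k [/setIP[l2L _] /setIP[kK _] lk4 x4]]]] := link_exists uL (layer_center ly) cuv dLK.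
have [k2 [q2 [lk2 k2K x2]]] := landing_link ly.
have [q3S _ q3P q3X] := side_facts pos x3; have [q2S q2K q2P q2X] := side_facts pos x2.
have x4' : {in q4, forall z, z \in X /\ z \notin L} by move=> z /x4[].
have [q4S _ q4P q4X] := side_facts pos x4'.
have q3u z : z \in q3 -> conn e X z u.
  move=> zq; have [_ /(_ (subsetP LX _ l1L)) c] := link_conn lk3 q3X zq.
  exact: conn_trans c (Lu _ l1L).2.
have q2v z : z \in q2 -> conn e X v z.
  move=> zq; have [/(_ (subsetP KX _ k2K)) c _] := link_conn lk2 q2X zq.
  exact: conn_trans (Kv _ k2K).1 c.
have q4v z : z \in q4 -> conn e X z v.
  move=> zq; have [_ /(_ (subsetP KX _ kK)) c] := link_conn lk4 q4X zq.
  exact: conn_trans c (Kv _ kK).2.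
have dq3K : [disjoint [set z in q3] & K].
  by apply: disjI => z; rewrite inE => /q3u zu /Kv[vz _]; case/negP: ncvu; apply: conn_trans vz zu.
have dq4K : [disjoint [set z in q4] & K].
  by apply: disjI => z; rewrite inE => /x4[_ _ /negP].
have d23 : [disjoint [set z in q2] & [set z in q3]].
  by apply: disjI => z; rewrite !inE => /q2v vz /q3u zu; case/negP: ncvu; apply: conn_trans vz zu.
have d2L : [disjoint [set z in q2] & L].
  by apply: disjI => z; rewrite in_set => /q2v vz /Lu[_ zu]; case/negP: ncvu; apply: conn_trans vz zu.
have d24 : [disjoint [set z in q2] & [set z in q4]].
  apply: disjI => z; rewrite !in_set => zq /q4v zv; have [_ /negP[]] := x2 z zq.
  by rewrite inE (q2v z zq) zv.
have op : pos o <= pos p.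
  apply: (ly_max ly oP); apply: (@conn_trans _ _ _ l1).
    by apply: link_conn_out lk3 q3X _; apply: (subsetP LX).
  apply: conn_mono (subsetUr _ _) _; apply: conn_trans (Lu _ l1L).2 cuv.
have LK : L \subset ~: K by rewrite -disjoints_subset.
have PK : P \subset ~: K by rewrite -disjoints_subset; apply: dPX.
(* The chain inside [K] is needed for the entrance [k] at which the ear arrives. *)
have ret : returning e K k k2.
  apply: (returning_via ly oP (ly_p' ly)).
    have q3C : {subset q3 <= ~: K}.
      by move=> z zq; rewrite in_setC; apply/negP=> zK; apply: (disjE dq3K _ zK); rewrite inE.
    have q4C : {subset q4 <= ~: K}.
      by move=> z zq; rewrite in_setC; apply/negP=> zK; apply: (disjE dq4K _ zK); rewrite inE.
    have l1C := subsetP LK _ l1L; have l2C := subsetP LK _ l2L.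
    apply: (@conn_trans _ _ _ l1).
      have oC : o |: ~: K \subset k |: ~: K.
        by rewrite subUset subsetUr andbT sub1set in_setU (subsetP PK _ oP) orbT.
      exact: conn_mono oC (link_conn_out lk3 q3C l1C).
    apply: (@conn_trans _ _ _ l2); last exact: link_conn_in lk4 q4C l2C.
    apply: conn_mono (comp_strong l1L l2L); exact: subset_trans LK (subsetUr _ _).
  have q2C : {subset q2 <= k2 |: ~: K}.
    by move=> z /x2[_ zK]; rewrite in_setU1 in_setC zK orbT.
  have := link_conn_in lk2 q2C (setU11 _ _); apply: conn_mono.
  by rewrite subUset subxx andbT sub1set in_setU1 (subsetP PK _ (ly_p' ly)) orbT.
have [A [a' [b' [B1 [I1 [O1 [r1 [l0 [ch lg1 d1A sBA [a1 a2 kI k2O]]]]]]]]]] := inner k k2 kK k2K ret.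
have [IL [OL [l [lgL l1I l2O]]]] := strong_leg (@comp_strong _ e X u) l1L uL l2L.
have d34 : {in q3, forall z, z \notin q4} := links_disjoint lk3 lk4 l1L l2L x3 q4X.
have dq34 : [disjoint [set z in q3] & [set z in q4]].
  by apply: disjI => z; rewrite !inE => /d34/negP.
have dq4L : [disjoint [set z in q4] & L] by apply: disjI => z; rewrite in_set => /x4'[_ /negP].
have lgL3 := leg_linkI lgL lk3 l1I (fun z zq => (x3 z zq).2).
have lgL4 : leg e ([set z in q4] :|: ([set z in q3] :|: L)) ([set z in q3] :|: IL) ([set z in q4] :|: OL) u l.
  apply: leg_linkO lgL3 lk4 l2O _ => z zq; rewrite in_setU negb_or (x4' z zq).2 andbT inE.
  by apply: contraL zq => /d34.
have [sB1K sAK] : B1 \subset K /\ A \subset K by move: sBA; rewrite subUset => /andP[].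
have KS : K \subset S by apply: subset_trans XS.
have LS : L \subset S by apply: subset_trans XS.
have kdis (C : {set V}) : [disjoint C & K] -> [disjoint C & B1] /\ [disjoint C & A].
  by move=> d; split; apply: disjointWr d.
have [t3B t3A] := kdis _ dq3K; have [t4B t4A] := kdis _ dq4K; have [tLB tLA] := kdis _ dLK.
have [t2B t2A] := kdis _ q2K.
have tPB i j : [disjoint stretch P pos i j & B1] := (kdis _ (stretch_disjoint_comp e S P v pos i j)).1.
have tPA i j : [disjoint stretch P pos i j & A] := (kdis _ (stretch_disjoint_comp e S P v pos i j)).2.
have dPL i j : [disjoint stretch P pos i j & L] := stretch_disjoint_comp e S P u pos i j.
have sS := stretch_S ly; have B1S := subset_trans sB1K KS; have AS := subset_trans sAK KS.
have pI i : pos p' <= i -> p' \in stretch P pos 0 i by move=> pi; rewrite in_stretch (ly_p' ly).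
have ob := ly_pos ly oP; have p'b := ly_pos ly (ly_p' ly).
have [p'o|op'] := leqP (pos p') (pos o).
  apply: chained_opened.
  have /(stretch_leg ly oP) lgP : 0 <= pos o <= pos b by [].
  have lgC := leg_linkI lgP lk2 (pI _ p'o).
  have {}lgC : leg e ([set z in q2] :|: stretch P pos 0 (pos b)) ([set z in q2] :|: stretch P pos 0 (pos o))
      (stretch P pos (pos o) (pos b)) o 0.
    by apply: lgC => z zq; apply/negP=> zP; apply: (disjE (q2P 0 (pos b)) _ zP); rewrite inE.
  have oO : o \in stretch P pos (pos o) (pos b) by rewrite in_stretch oP leqnn.
  apply: chained_sub (chained_ear ch lg1 a1 a2 lgL4 uU lgC _ _ _ _ _ _ _ _).
  - by split_sub.
  - by rewrite in_setU in_stretch (ly_a ly) (ly_pos_a ly) orbT.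
  - by rewrite in_stretch (ly_b ly) ob leqnn.
  - exact: link_arcsI lk3 oO l1I.
  - exact: link_arcsO lk4 l2O kI.
  - exact: link_arcsI lk2 k2O (pI _ p'o).
  - by [].
  - by split_disjoint.
  - by split_disjoint.
move=> B0 I0 O0 r0 m0 s t lg0 d0 a0 b0 sI tO.
pose J1 := stretch P pos 0 (pos o); pose J2 := stretch P pos (pos p') (pos b).
have J1c : {in J1, forall z, conn e J1 z o}.
  by move=> z; rewrite in_stretch => /and3P[zP _ zo]; apply: (stretch_conn ly).
have J2c : {in J2, forall z, conn e J2 p' z}.
  move=> z; rewrite in_stretch => /and3P[zP p'z _]; apply: (stretch_conn ly) => //.
    exact: (ly_p' ly).
  exact: (ly_pos ly).
have a3 : arcs e [set o] ([set z in q3] :|: IL) := link_arcsI lk3 (set11 _) l1I.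
have dJ1 : [disjoint J1 & [set z in q4] :|: ([set z in q3] :|: L)] by rewrite /J1; split_disjoint.
have lgL5 := leg_extI_arc lgL4 dJ1 J1c a3.
have lgN : leg e ([set z in q2] :|: B1) I1 ([set z in q2] :|: O1) r1 l0.
  by apply: leg_linkO lg1 lk2 k2O _ => z zq; apply/negP=> zP; apply: (disjE t2B _ zP); rewrite inE.
have a4 : arcs e ([set z in q2] :|: O1) [set p'] := link_arcsO lk2 k2O (set11 _).
have dJ2 : [disjoint J2 & [set z in q2] :|: B1] by rewrite /J2; split_disjoint.
have lgN5 := leg_extO_arc lgN dJ2 J2c a4.
have J12 : [disjoint J1 & J2] by apply: stretch_dis.
have aO' : arcs e (J2 :|: ([set z in q2] :|: O1)) [set a'].
  by rewrite setUA; apply: arcs_sub a1; rewrite ?subsetUr.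
have sub (C : {set V}) : C \subset S -> C \subset B0 :|: S.
  by move=> CS; apply: subset_trans CS (subsetUr _ _).
have dB (C : {set V}) : C \subset S -> [disjoint B0 & C] by move=> CS; apply: disjointWr d0.
apply: chained_sub (chained_ear ch lgN5 aO' a2 lgL5 uU lg0 sI tO _ _ _ _ _ _).
- have BB : B0 \subset B0 :|: S by apply: subsetUl.
  have sBs i j := sub _ (sS i j).
  have h1 := sub _ q2S; have h2 := sub _ q3S; have h3 := sub _ q4S; have h4 := sub _ LS.
  have h5 := sub _ B1S; have h6 := sub _ AS.
  by rewrite /J1 /J2; split_sub.
- by apply: arcs_memr a0 _; rewrite in_setU in_stretch (ly_a ly) (ly_pos_a ly).
- exact: link_arcsO lk4 l2O kI.
- by apply: arcs_meml b0 _; rewrite in_setU in_stretch (ly_b ly) leqnn p'b.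
- by rewrite /J2; split_disjoint.
- move: J12; rewrite /J1 /J2 => J12; by split_disjoint.
- by apply: dB; rewrite /J1 /J2; split_sub.
Qed.

(** As neither of [u] and [v] reaches the other off the path, the way into [u] can meet only [q1]
    and the way out of [u] only [q2]; allowing the detour to start on [q1] and to end on [q2] makes
    everything disjoint. *)
Lemma tooth_ear_exists (e : rel V) (S P : {set V}) (v a b p p' : V) (pos : V -> nat) u :
  layer e S P v a b p p' pos -> u \in S :\: P ->
  ~~ conn e (S :\: P) u v -> ~~ conn e (S :\: P) v u ->
  exists k1 k2 q1 q2 o d q3 q4, ear e S P v p p' u k1 k2 q1 q2 o d q3 q4 /\
    returning e (comp e (S :\: P) v) k1 k2.
Proof.
move=> ly; set X := S :\: P; set K := comp e X v => uX ncuv ncvu.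
have XS : X \subset S by apply: subsetDl.
have uS : u \in S by apply: (subsetP XS).
pose L := comp e X u; have uL : u \in L by apply: comp_self.
have LX : L \subset X by apply: comp_sub.
have KX : K \subset X by apply: comp_sub.
have dPX := @disjoint_PX V S P.
have [q1 [k1 [k2 [q2 [lk1 lk2 k1K k2K [x1 x2 q12 ret]]]]]] := links ly.
have [q1S q1K q1P q1X] := side_facts pos x1; have [q2S q2K q2P q2X] := side_facts pos x2.
have Kv z : z \in K -> conn e X v z /\ conn e X z v by rewrite inE => /andP[].
have Lu z : z \in L -> conn e X u z /\ conn e X z u by rewrite inE => /andP[].
have no1 z : conn e X u z -> conn e X z v -> False.
  by move=> uz zv; case/negP: ncuv; apply: conn_trans uz zv.
have no2 z : conn e X v z -> conn e X z u -> False.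
  by move=> uz zv; case/negP: ncvu; apply: conn_trans uz zv.
have q1v z : z \in q1 -> conn e X z v.
  move=> zq; have [_ /(_ (subsetP KX _ k1K)) c] := link_conn lk1 q1X zq.
  exact: conn_trans c (Kv _ k1K).2.
have q2v z : z \in q2 -> conn e X v z.
  move=> zq; have [/(_ (subsetP KX _ k2K)) c _] := link_conn lk2 q2X zq.
  exact: conn_trans (Kv _ k2K).1 c.
have d1L : [disjoint [set z in q1] & L].
  by apply: disjI => z; rewrite in_set => /q1v zv /Lu[uz _]; apply: no1 uz zv.
have d2L : [disjoint [set z in q2] & L].
  by apply: disjI => z; rewrite in_set => /q2v zv /Lu[_ uz]; apply: no2 zv uz.
have PL : [disjoint P & L] := dPX _ _ (subxx _) LX.
have aS := subsetP (ly_P ly) _ (ly_a ly).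
have aP q : a \in P :|: [set z in q] by rewrite in_setU (ly_a ly).
have [|o [q3 [l1 [/setIP[oP _] /setIP[l1L _] lk3 x3]]]] := link_exists (aP q1) uL
  (ly_strong ly aS uS); first by split_disjoint.
have [|l2 [q4 [d [/setIP[l2L _] /setIP[dP _] lk4 x4]]]] := link_exists uL (aP q2)
  (ly_strong ly uS aS); first by split_disjoint.
have {}x3 z : z \in q3 -> [/\ z \in X, z \notin q1 & z \notin L].
  move=> /x3[zS + zL]; rewrite in_setU inE negb_or => /andP[zP zq].
  by rewrite in_setD zP zS.
have {}x4 z : z \in q4 -> [/\ z \in X, z \notin q2 & z \notin L].
  move=> /x4[zS zL]; rewrite in_setU inE negb_or => /andP[zP zq].
  by rewrite in_setD zP zS.
have q3X : {subset q3 <= X} by move=> z /x3[].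
have q4X : {subset q4 <= X} by move=> z /x4[].
have q3u z : z \in q3 -> conn e X z u.
  move=> zq; have [_ /(_ (subsetP LX _ l1L)) c] := link_conn lk3 q3X zq.
  exact: conn_trans c (Lu _ l1L).2.
have q4u z : z \in q4 -> conn e X u z.
  move=> zq; have [/(_ (subsetP LX _ l2L)) c _] := link_conn lk4 q4X zq.
  exact: conn_trans (Lu _ l2L).1 c.
exists k1, k2, q1, q2, o, d, q3, q4; split=> //; split=> //.
- by exists l1.
- by exists l2.
- by move: oP; rewrite in_setU inE => /orP.
- by move: dP; rewrite in_setU inE => /orP.
- by move=> z /x3[].
- by move=> z /x4[].
- by apply: disjI => z; rewrite !inE => /q12/negP.
- by apply: disjI => z; rewrite !inE => zq /x3[_ /negP].
- by apply: disjI => z; rewrite !inE => /q1v zv /q4u uz; apply: no1 uz zv.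
- by apply: disjI => z; rewrite !inE => /q2v zv /q3u uz; apply: no2 zv uz.
- by apply: disjI => z; rewrite !inE => zq /x4[_ /negP].
- by apply: disjI => z; rewrite in_set => /q3u uz /Kv[vz _]; apply: no2 vz uz.
- by apply: disjI => z; rewrite in_set => /q4u uz /Kv[_ vz]; apply: no1 uz vz.
by apply: disjI => z /Lu[uz _] /Kv[_ vz]; apply: no1 uz vz.
Qed.

(** The cases are: [u] on the path; [u] off the path and related to [v] in one direction; [u]
    unrelated to [v], where the positions of [o] and [d] relative to [p'] and [p] decide. Mirror
    cases are obtained by reversal. *)
Theorem tooth (e : rel V) (S P : {set V}) (v a b p p' : V) (pos : V -> nat) N u :
  layer e S P v a b p p' pos ->
  {in comp e (S :\: P) v &, forall k1 k2, returning e (comp e (S :\: P) v) k1 k2 ->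
    cored U e (comp e (S :\: P) v) k1 k2 N} ->
  u \in U -> u \in S -> u \notin comp e (S :\: P) v -> opened U e S a b N.+1.
Proof.
move=> ly inner uU uS uK; have lyr := layer_rev ly.
have innerr : {in comp (revr e) (S :\: P) v &, forall k1 k2,
    returning (revr e) (comp (revr e) (S :\: P) v) k1 k2 ->
    cored U (revr e) (comp (revr e) (S :\: P) v) k1 k2 N}.
  move=> k1 k2; rewrite (comp_rev e) (returning_rev e) => k1K k2K ret.
  exact: cored_rev (inner _ _ k2K k1K ret).
have pp := ly_pp ly; have pb := ly_pos ly (ly_p ly).
have [uP|uP] := boolP (u \in P).
  have ub := ly_pos ly uP.
  have [up'|p'u] := ltnP (pos u) (pos p'); first exact: (tooth_path_left ly inner uU uP).
  have [up|pu] := leqP (pos u) (pos p); first by apply: (tooth_path_mid ly inner uU uP); rewrite p'u.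
  apply: opened_rev; apply: (tooth_path_left lyr innerr uU uP).
  by move: pu ub; clear; lia.
have uX : u \in S :\: P by rewrite in_setD uP uS.
have [cuv|ncuv] := boolP (conn e (S :\: P) u v).
  apply: (tooth_into ly inner uU cuv); apply: contra uK => cvu.
  by rewrite inE cvu cuv.
have [cvu|ncvu] := boolP (conn e (S :\: P) v u).
  by apply: opened_rev; apply: (tooth_into lyr innerr uU); rewrite (conn_rev e).
have [k1 [k2 [q1 [q2 [o [d [q3 [q4 [er ret]]]]]]]]] := tooth_ear_exists ly uX ncuv ncvu.
have ch := cored_chained (inner _ _ (er_k1 er) (er_k2 er) ret).
have err := ear_rev er; have chr := chained_rev ch; rewrite -(comp_rev e) in chr.
have p'P := ly_p' ly; have pP := ly_p ly.
have inI r : d \in q2 \/ d \in P /\ pos d <= pos r -> d \in [set z in q2] :|: stretch P pos 0 (pos r).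
  case=> [dq|[dP dr]]; first by rewrite in_setU inE dq.
  by rewrite in_setU in_stretch dP dr orbT.
have inO r : o \in q1 \/ o \in P /\ pos r <= pos o -> o \in [set z in q1] :|: stretch P pos (pos r) (pos b).
  case=> [oq|[oP ro]]; first by rewrite in_setU inE oq.
  by rewrite in_setU in_stretch oP ro (ly_pos ly oP) orbT.
have mirror : d \in P -> pos p < pos d -> o \in P /\ pos p' <= pos o \/ o \in q1 -> opened U e S a b N.+1.
  move=> dP pd oo; apply: opened_rev; apply: (ear_left lyr err uU chr dP).
    by have := ly_pos ly dP; move: pd; clear; lia.
  by case: oo => [[oP p'o]|oq]; [left|right]; rewrite ?mem_rev //; split=> //; apply: leq_sub2l.
case: (er_o er) => [oP|oq]; case: (er_d er) => [dP|dq].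
- have [op'|p'o] := ltnP (pos o) (pos p').
    have [dp|pd] := leqP (pos d) (pos p); last exact: (ear_rung ly er uU ch).
    by apply: (ear_left ly er uU ch oP op'); left.
  have [dp|pd] := leqP (pos d) (pos p); last by apply: mirror => //; left.
  have [do_|od] := leqP (pos d) (pos o); last exact: (ear_through ly er uU ch).
  (* The root has to lie between [p'] and [p], not before [d] and not after [o]. *)
  have [r rP Er] : exists2 r, r \in P & pos r = maxn (pos d) (pos p').
    by apply: (exists_pos ly); move: dp pp pb; clear; lia.
  apply: (ear_mid ly er uU ch rP); first by rewrite Er; move: dp pp; clear; lia.
    by apply: inO; right; rewrite Er; split=> //; move: do_ p'o; clear; lia.
  by apply: inI; right; rewrite Er; split=> //; apply: leq_maxl.
- have [op'|p'o] := ltnP (pos o) (pos p'); first by apply: (ear_left ly er uU ch oP op'); right.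
  apply: (ear_mid ly er uU ch p'P); first by rewrite leqnn pp.
    by apply: inO; right.
  by apply: inI; left.
- have [dp|pd] := leqP (pos d) (pos p); last by apply: mirror => //; right.
  apply: (ear_mid ly er uU ch pP); first by rewrite leqnn pp.
    by apply: inO; left.
  by apply: inI; right.
apply: (ear_mid ly er uU ch pP); first by rewrite leqnn pp.
  by apply: inO; left.
by apply: inI; left.
Qed.

End Tooth.

(** * The iteration *)

(** Constructive because [T] is finite: a search through [T] stops at the first [x] that yields
    [G]. *)
Lemma or_forall (T : finType) (G : Prop) (Q : T -> Prop) :
  (forall x, G \/ Q x) -> G \/ forall x, Q x.
Proof.
move=> H; suff : G \/ {in enum T, forall x, Q x}.
  by case=> [|HQ]; [left|right=> x; apply: HQ; rewrite mem_enum].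
elim: (enum T) => [|x s [g|IH]]; [by right|by left|].
case: (H x) => [g|qx]; first by left.
by right=> y; rewrite inE => /orP[/eqP->//|/IH].
Qed.

Lemma or_forall_in (T : finType) (G : Prop) (K : {set T}) (r : T -> T -> bool) (Q : T -> T -> Prop) :
  (forall x y, x \in K -> y \in K -> r x y -> G \/ Q x y) ->
  G \/ {in K &, forall x y, r x y -> Q x y}.
Proof.
move=> H; have [z|g|HQ] := @or_forall (T * T)%type G
    (fun z => z.1 \in K -> z.2 \in K -> r z.1 z.2 -> Q z.1 z.2).
- have [/and3P[z1 z2 rz]|nz] := boolP [&& z.1 \in K, z.2 \in K & r z.1 z.2].
    by case: (H _ _ z1 z2 rz) => [g|q]; [left|right].
  by right=> z1 z2 rz; move: nz; rewrite z1 z2 rz.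
- by left.
by right=> x y xK yK rxy; apply: (HQ (x, y)).
Qed.

Section Main.
Variables (D : digraph) (U : {set D}) (n : nat).
Hypothesis n3 : 2 < n.
Local Notation e := (@arc D).
Local Notation conn := (conn (@arc D)).
Let M := wide_bound n.
Let W := M ^ M.+1.

Lemma W_gt0 : 0 < W.
Proof. by rewrite expn_gt0 (M_gt0 n3). Qed.

Lemma returning_returns (K : {set D}) k1 k2 : k1 \in K -> k2 \in K ->
  returning e K k1 k2 -> returns K k1 k2.
Proof.
move=> k1K k2K; rewrite /returning; have [->|ne] := eqVneq k1 k2; first by left.
move=> c; right; have d : [disjoint [set k2] & [set k1]] by rewrite disjoints1 in_set1 eq_sym.
have [x [q [y [/setIP[/set1P-> _] /setIP[/set1P-> _] lk qX]]]] :=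
  link_exists (set11 _) (set11 _) c d.
have qC : {subset q <= k1 |: ~: K}.
  by move=> z /qX[+ + _]; rewrite !in_setU1 in_set1 => /or3P[->//|->//|->]; rewrite orbT.
have [z zq kz] := link_first lk; exists z => //.
move: zq; rewrite mem_rcons inE => /orP[/eqP->|zq]; first by apply: conn_refl; apply: setU11.
by have [_] := link_conn lk qC zq; apply; apply: setU11.
Qed.

Lemma backward_layer (S : {set D}) a b h : strong e S -> returns S a b -> backward U S a b h ->
  exists P v p p' pos, layer e S P v a b p p' pos /\ h <= #|U :&: comp e (S :\: P) v|.
Proof.
move=> st ret [s [v [[ps us ls sS] vX hv qp]]].
pose P := [set z in a :: s]; have PS : P \subset S by apply/subsetP=> z; rewrite inE => /sS.
have vS : v \in S by move: vX; rewrite in_setD => /andP[].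
have [/andP[pst cp] pmax] := origP st PS vS; have [/andP[qst cq] qmin] := landP st PS vS.
pose pos z := index z (a :: s).
have posP z : z \in P -> nth a (a :: s) (pos z) = z by rewrite inE => zP; apply: nth_index.
have posS z : z \in P -> pos z <= size s by rewrite inE -index_mem.
have nP i : i <= size s -> nth a (a :: s) i \in P by move=> is_; rewrite inE mem_nth.
have posn i : i <= size s -> pos (nth a (a :: s) i) = i by move=> is_; rewrite /pos index_uniq.
have posb : pos b = size s by rewrite /pos -ls index_last.
exists P, v, (nth a (a :: s) (pp S a s v)), (nth a (a :: s) (qq S a s v)), pos; split=> //.
split=> //.
- by rewrite inE mem_head.
- by rewrite inE -ls mem_last.
- exact: nP.
- exact: nP.
- by rewrite /pos /= eqxx.
- by move=> z zP; rewrite posb posS.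
- by move=> x y xP yP E; rewrite -(posP x xP) -(posP y yP) E.
- move=> i; rewrite posb => is_; exists (nth a (a :: s) i), (nth a (a :: s) i.+1).
  rewrite !nP ?posn //; try exact: ltnW.
  by split=> //; move/(pathP a): ps; apply.
- by rewrite !posn.
- move=> z zP c; rewrite posn //; apply: pmax.
  by rewrite /orig posS // posP.
- move=> z zP c; rewrite posn //; apply: qmin.
  by rewrite /land posS // posP.
have aP : a \in P by rewrite inE mem_head.
have bP : b \in P by rewrite inE -ls mem_last.
case: ret => [->|[c bc ca]]; first by apply: conn_refl; rewrite in_setC in_setD aP.
have sub : a |: ~: S \subset ~: (S :\: P).
  apply/subsetP=> z; rewrite in_setU1 !in_setC in_setD => /orP[/eqP->|/negPf->].
    by rewrite aP.
  by rewrite andbF.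
apply: conn_trans (conn_mono sub ca); apply: conn1 bc.
  by rewrite in_setC in_setD bP.
by apply: (subsetP sub); apply: conn_inl ca.
Qed.

Section Shells.
Variables (h N : nat) (Q : {set D} -> D -> D -> Prop).
Hypothesis h1 : 1 < h.
Hypothesis HQ : forall S a b, strong e S -> a \in S -> b \in S -> returns S a b ->
  h <= #|U :&: S| -> unavoidable U n \/ Q S a b.

(** One use of [back], which costs the factor [W], followed by the hypothesis for the component. *)
Lemma shell (S : {set D}) a b : strong e S -> a \in S -> b \in S -> returns S a b ->
  h * W <= #|U :&: S| ->
  unavoidable U n \/ exists P v p p' pos,
    [/\ layer e S P v a b p p' pos, h <= #|U :&: comp e (S :\: P) v| &
      {in comp e (S :\: P) v &, forall k1 k2, returning e (comp e (S :\: P) v) k1 k2 ->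
        Q (comp e (S :\: P) v) k1 k2}].
Proof.
move=> st aS bS ret hS; have [un|bk] := back n3 st ret h1 aS bS hS; first by left.
have [P [v [p [p' [pos [ly hK]]]]]] := backward_layer st ret bk.
pose K := comp e (S :\: P) v.
have [|un|HK] := @or_forall_in _ (unavoidable U n) K (returning e K) (Q K); [|by left|by right; exists P, v, p, p', pos].
move=> k1 k2 k1K k2K ret12; apply: HQ => //; first exact: comp_strong.
exact: returning_returns.
Qed.

End Shells.

Lemma shell_chained h N : 1 < h ->
  (forall S a b, strong e S -> a \in S -> b \in S -> returns S a b ->
    h <= #|U :&: S| -> unavoidable U n \/ opened U e S a b N) ->
  forall S a b, strong e S -> a \in S -> b \in S -> returns S a b ->
    h * W <= #|U :&: S| -> unavoidable U n \/ chained U e S a b N.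
Proof.
move=> h1 H S a b st aS bS ret hS.
have [un|[P [v [p [p' [pos [ly _ HK]]]]]]] := shell h1 H st aS bS ret hS; first by left.
by right; apply: (layer_chained ly HK).
Qed.

Lemma shell_cored h N : 1 < h ->
  (forall S a b, strong e S -> a \in S -> b \in S -> returns S a b ->
    h <= #|U :&: S| -> unavoidable U n \/ chained U e S a b N) ->
  forall S a b, strong e S -> a \in S -> b \in S -> returns S a b ->
    h * W <= #|U :&: S| -> unavoidable U n \/ cored U e S a b N.
Proof.
move=> h1 H S a b st aS bS ret hS.
have [un|[P [v [p [p' [pos [ly _ HK]]]]]]] := shell h1 H st aS bS ret hS; first by left.
by right; apply: (layer_cored ly HK).
Qed.

(** Each tooth costs three shells: the one that loses a vertex of [U], and the two inside it that
    turn [opened] into [chained] and then into [cored]. *)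
Definition depth_bound N := 2 * (W * W * W) ^ N.

Lemma depth_bound_gt1 N : 1 < depth_bound N.
Proof. by rewrite -[2]muln1 leq_mul2l /= expn_gt0 !muln_gt0 W_gt0. Qed.

Lemma two_shells N :
  (forall S a b, strong e S -> a \in S -> b \in S -> returns S a b ->
    depth_bound N <= #|U :&: S| -> unavoidable U n \/ opened U e S a b N) ->
  forall S a b, strong e S -> a \in S -> b \in S -> returns S a b ->
    depth_bound N * W * W <= #|U :&: S| -> unavoidable U n \/ cored U e S a b N.
Proof.
move=> H; apply: shell_cored; last exact: (shell_chained (depth_bound_gt1 N) H).
by apply: leq_trans (depth_bound_gt1 N) _; rewrite leq_pmulr // W_gt0.
Qed.

(** Induction on [N], and for fixed [N] on the size of [S]. If the component contains all of [U] in
    [S], the same bound holds for this smaller set; otherwise a lost vertex is a tooth, and the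
    component has to provide only [N] further ones. *)
Lemma deep_opened N S a b : strong e S -> a \in S -> b \in S -> returns S a b ->
  depth_bound N <= #|U :&: S| -> unavoidable U n \/ opened U e S a b N.
Proof.
elim: N S a b => [|N IHN] S a b.
  (* No tooth is required, so the attached core alone is a chain. *)
  move=> *; right=> B I O r l s t lg *; exists 0, 0, 0; split=> //.
  by apply: chain_base lg _ _ (subsetUl _ _).
have [m] := ubnP #|S|; elim: m => // m IHm in S a b *; rewrite ltnS => Sm st aS bS ret hS.
set h := depth_bound N * W * W.
have h1 : 1 < h.
  by apply: leq_trans (depth_bound_gt1 N) _; rewrite /h -mulnA leq_pmulr // muln_gt0 W_gt0.
have hW : h * W <= #|U :&: S|.
  by apply: leq_trans hS; rewrite /h /depth_bound expnSr -!mulnA leqnn.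
have [un|bk] := back n3 st ret h1 aS bS hW; first by left.
have [P [v [p [p' [pos [ly hK]]]]]] := backward_layer st ret bk.
pose K := comp e (S :\: P) v; have KS : K \subset S by apply: (layer_comp_S e S P v).
have [E|[u]] := set_0Vmem ((U :&: S) :\: K).
  have [|un|HK] := @or_forall_in _ (unavoidable U n) K (returning e K)
      (fun k1 k2 => opened U e K k1 k2 N.+1); [|by left|by right; apply: chained_opened; apply: (layer_chained ly HK)].
  move=> k1 k2 k1K k2K ret12; apply: IHm => //.
  - apply: leq_trans Sm; apply: proper_card; apply/properP; split=> //; exists a => //.
    by apply/negP=> /(subsetP (layer_comp_sub _ _ _ _))/off_path; rewrite (ly_a ly).
  - exact: comp_strong.
  - exact: returning_returns.
  apply: leq_trans hS _; apply: subset_leq_card; apply/subsetP=> z zUS.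
  have zU : z \in U by move: zUS; rewrite in_setI => /andP[].
  rewrite in_setI zU /=; apply: contraT => zK.
  by move/setP/(_ z): E; rewrite in_setD zK zUS in_set0.
rewrite in_setD in_setI => /and3P[uK uU uS].
have [|un|HK] := @or_forall_in _ (unavoidable U n) K (returning e K)
    (fun k1 k2 => cored U e K k1 k2 N); [|by left|by right; apply: (tooth ly HK uU uS uK)].
move=> k1 k2 k1K k2K ret12; apply: (two_shells IHN) => //; first exact: comp_strong.
exact: returning_returns.
Qed.

Lemma strongly_connected_unavoidable : strongly_connected D ->
  depth_bound (3 * n) * W * W <= #|U| -> unavoidable U n.
Proof.
move=> st hU; have /card_gt0P[x _] : 0 < #|U|.
  by apply: leq_trans hU; rewrite !muln_gt0 W_gt0 expn_gt0 !muln_gt0 W_gt0.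
(* The iteration starts with all of $D$ and [a = b = x], where the return condition is trivial; the
   factor 3 accounts for the three kinds of teeth. *)
have [| | | | |//|[A [a [b [B [I [O [r [l [[p [f [q [cnt ch]]]] lg d _ [a1 a2 xI xO]]]]]]]]]]] :=
  two_shells (@deep_opened (3 * n)) (S := setT) (a := x) (b := x).
- move=> y z _ _; rewrite /conn inE /=; have := st y z; rewrite (@eq_connect _ _ (relin e setT)) //.
  by move=> y' z'; rewrite /relin /= !inE.
- by rewrite inE.
- by rewrite inE.
- by left.
- by rewrite setIT.
exact: chain_unavoidable ch _ _ _ _ _ _ _ lg d a1 a2 xI xO cnt.
Qed.

End Main.

Theorem theorem1p1 :
  exists g : nat -> nat,
    forall (n : nat) (D : digraph) (U : {set D}),
      strongly_connected D ->
      g n <= #|U| ->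
      exists (H : digraph) (t : H -> {set D}) (T : {set H}),
        [/\ butterfly_minor t,
            shaped_by_star T \/ shaped_by_comb T
          & n <= #|[set a in T | t a :&: U != set0]|].
Proof.
pose W n := wide_bound n ^ (wide_bound n).+1.
(* The construction assumes [2 < n]; for smaller [n] the bound for 3 teeth suffices. *)
exists (fun n => let m := maxn n 3 in depth_bound m (3 * m) * W m * W m) => n D U st gn.
apply: (@unavoidable_leq D U n (maxn n 3)); first exact: leq_maxl.
by apply: strongly_connected_unavoidable st gn; apply: leq_maxr.
Qed.
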